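(* Let $\alpha>0$ and $m\in\mathbb{R}$, and consider the integro-differential equation $$x^m f(x)\;=\;\frac{1}{\Gamma(\alpha)}\int_0^x (x-v)^{\alpha-1} f(v)\,dv,\qquad x\in(0,\infty). \qquad (\ast)$$ The equation $(\ast)$ has a density solution if and only if $m>\alpha$. In that case the density solution is unique, and, writing $a=m-\alpha$, it is the density of a random variable $X_{m,\alpha}$ satisfying the two identities in law $$X_{m,\alpha}\;\stackrel{d}{=}\;\left(a^{\frac{m-a}{a}}\,\Gamma\!\left(\frac{m}{a}\right)\prod_{n=0}^{\infty}\left(\frac{m+an}{a+an}\right)\mathbf{B}_{a+an,\,m-a}\right)^{-1}\;\stackrel{d}{=}\;\left(\frac{\Gamma(m)}{\Gamma(a)}\prod_{n=0}^{\infty}\left(\frac{m+n}{a+n}\right)\mathbf{B}_{1+\frac{n}{a},\,\frac{m}{a}-1}\right)^{-\frac1a}.$$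
   Context: A density solution to $(\ast)$ is a function $f:(0,\infty)\to[0,\infty)$ that is a probability density on $(0,\infty)$ (i.e. measurable with $\int_0^\infty f(x)\,dx=1$) and satisfies $(\ast)$ on $(0,\infty)$; the right-hand integral is a Lebesgue integral of a non-negative function, so in particular it must be finite. For $p,q>0$, $\mathbf{B}_{p,q}$ denotes a Beta random variable, with density $\frac{\Gamma(p+q)}{\Gamma(p)\Gamma(q)}x^{p-1}(1-x)^{q-1}$ on $(0,1)$. In each infinite product, the Beta random variables are mutually independent, and the product is understood as the almost sure limit of the partial products (all infinite products are a.s. convergent). The symbol $\stackrel{d}{=}$ denotes equality in law. *)

(* Defs.v *)
From HB Require Import structures.
From mathcomp Require Import all_boot all_order all_algebra.
From mathcomp Require Import all_classical all_reals all_analysis.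
Set Implicit Arguments.
Unset Strict Implicit.
Unset Printing Implicit Defensive.
Import Order.TTheory GRing.Theory Num.Theory.
Import numFieldNormedType.Exports.
Local Open Scope classical_set_scope.
Local Open Scope ring_scope.

(* Euler's integral; meaningful for 0 < s. *)
Definition Gamma (R : realType) (s : R) : R :=
  \int[@lebesgue_measure R]_(t in `]0, +oo[) (t `^ (s - 1) * expR (- t)).

(* Functions on the half-line (0, oo) are encoded as total functions whose
   values outside of it are irrelevant. The equation is read in the extended
   reals, at every x > 0; its left-hand side being finite, it forces the
   integral to be finite. *)
Definition density_solution (R : realType) (alpha m : R) (f : R -> R) : Prop :=
  [/\ measurable_fun (`]0, +oo[ : set R) f,
      forall x : R, 0 < x -> 0 <= f x,
      (\int[@lebesgue_measure R]_(x in `]0%R, +oo[) (f x)%:E = 1)%E &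
      forall x : R, 0 < x ->
        ((x `^ m * f x)%:E =
          ((Gamma alpha)^-1)%:E *
          \int[@lebesgue_measure R]_(v in `]0%R, x[)
             ((x - v) `^ (alpha - 1) * f v)%:E)%E].

(* X takes values a.s. in D, where its law has density g; the values of g
   outside of D are irrelevant. *)
Definition has_density_on (R : realType) (d : measure_display)
    (T : measurableType d) (P : probability T R) (X : {RV P >-> R})
    (D : set R) (g : R -> R) : Prop :=
  forall A : set R, measurable A ->
    distribution P X A =
    (\int[@lebesgue_measure R]_(x in A `&` D) (g x)%:E)%E.

(* The library's beta_pdf only has natural number parameters. *)
Definition beta_density (R : realType) (p q : R) (x : R) : R :=
  Gamma (p + q) / (Gamma p * Gamma q) * x `^ (p - 1) * (1 - x) `^ (q - 1).

Definition is_beta (R : realType) (d : measure_display)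
    (T : measurableType d) (P : probability T R) (X : {RV P >-> R})
    (p q : R) : Prop :=
  has_density_on X `]0, 1[ (beta_density p q).

Definition mutually_independent (R : realType) (d : measure_display)
    (T : measurableType d) (P : probability T R)
    (X : nat -> {RV P >-> R}) : Prop :=
  forall (s : seq nat) (A : nat -> set R),
    uniq s -> (forall i, measurable (A i)) ->
    (P (\bigcap_(i in [set` s]) (X i @^-1` A i)) =
     \prod_(i <- s) P (X i @^-1` A i))%E.

Definition is_as_infinite_product (R : realType) (d : measure_display)
    (T : measurableType d) (P : probability T R)
    (Y : nat -> T -> R) (Z : T -> R) : Prop :=
  {ae P, forall w, \prod_(0 <= n < N) Y n w @[N --> \oo] --> Z w}.

Definition eq_law (R : realType) (d d' : measure_display)
    (T : measurableType d) (P : probability T R) (X : T -> R)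
    (T' : measurableType d') (P' : probability T' R) (X' : T' -> R) : Prop :=
  [/\ measurable_fun setT X, measurable_fun setT X' &
      forall A : set R, measurable A -> P (X @^-1` A) = P' (X' @^-1` A)].

(* Main.v *)
Require Import Defs.
From HB Require Import structures.
From mathcomp Require Import all_boot all_order all_algebra.
From mathcomp Require Import all_classical all_reals all_analysis.
From mathcomp Require Import finmap measurable_realfun.
From mathcomp Require Import ring lra.
Import Order.TTheory GRing.Theory Num.Theory.
Import numFieldNormedType.Exports.
Local Open Scope classical_set_scope.
Local Open Scope ring_scope.
Set Implicit Arguments.
Unset Strict Implicit.
Unset Printing Implicit Defensive.

(** Write [a = m - alpha], let [X] have a density solving the equation, and put
    [Y = 1/X].  Multiplying the equation by [x^(-m-s)] and integrating over
    [x > 0], Tonelli and a Beta integral turn it into a recursion for moments,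
<<
      E[Y^(s+a)] = Gamma(s+a+alpha) / Gamma(s+a) * E[Y^s]     (s >= 0),
>>
    and everything rests on the laws on the half-line which satisfy this
    recursion ([is_moment_law]).

    There is at most one such law ([moment_law_unique]).  Its moments are
    log-convex in [s], so the argument of Bohr and Mollerup determines them
    ([moment_function_unique]).  At [s = n a] they may grow like [n!^alpha],
    which can be too fast for a law to be determined by them, but for an integer
    [j >= alpha] the moments of [Y^(a/j)] grow at most like [C^k k!], and a law
    with such moments is determined by them ([determinacy]): the Laplace transform
    is known near 0 by Taylor expansion, then on the whole half-line by further
    expansions, and the law of [exp(-l Y^(a/j))] is that of a bounded variable
    with known moments.

    Both infinite products give such a law.  The partial products, with factors
    of mean 1, form an L^2-bounded martingale; they converge along the sparse
    sequence [(k+1)^4] because their L^1 increments are summable there, and in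
    between because, where all the Beta variables lie between 0 and 1,
    a partial product is a nondecreasing normalising constant times a
    nonincreasing product ([rprod_cvg_ae]).  Moments pass to the limit, and
    the recursion appears as a telescoping product of Gamma quotients: with
    step [a] for the first product ([first_product_law]), with step 1 for the
    second one, which is then raised to the power [1/a] ([second_product_law]).
    Uniqueness of the law then gives the identities in law.

    It remains to solve the equation.  It is the fixed-point equation
    [f x = E[K(x, X)]] for the kernel [K = kernel alpha m], which shows at once
    that the law of [X] determines [f].  Conversely start from a variable [Y]
    obeying the recursion, for instance the first product over independent Beta
    variables built from the binary digits of a uniform variable
    ([beta_sequence_exists]).  The function [x |-> E[K(x, 1/Y)]] is a probability
    density, and the inverse of a variable with this density obeys the same
    recursion, hence has the law of [Y]; so the function is a fixed point.  It is
    finite everywhere, not only almost everywhere, because iterating the kernel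
    makes it bounded in the relevant range ([candidate_iterated]).  When
    [m <= alpha] the integral of [K(x, v)] over [x] is at least 2 for every
    [v > 0], and integrating the equation gives [1 >= 2] ([no_solution]). *)

(** * Measures with a density and substitutions *)

Section measures.
Context d (T : measurableType d) (R : realType).
Local Open Scope ereal_scope.

Lemma pushforward_exists d' (T' : measurableType d')
    (mu : {measure set T -> \bar R}) (phi : T -> T') :
  measurable_fun setT phi ->
  exists nu : {measure set T' -> \bar R},
    (forall A, nu A = mu (phi @^-1` A)) /\
    (forall h : T' -> \bar R, measurable_fun setT h -> (forall y, 0 <= h y) ->
      \int[nu]_y h y = \int[mu]_x h (phi x)).
Proof.
move=> mphi.
unshelve eexists (pushforward mu phi); first exact: mphi.
by split => // h mh h0; rewrite ge0_integral_pushforward// preimage_setT.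
Qed.

Import HBNNSimple.

(** The monotone class induction for non-negative measurable functions, from
    their approximation by simple functions. *)
Lemma ge0_measurable_ind (Q : (T -> \bar R) -> Prop) :
  (forall A, measurable A -> Q (fun x => (\1_A x)%:E)) ->
  (forall (c : R) (f : T -> \bar R), (0 <= c)%R -> measurable_fun setT f -> (forall x, 0 <= f x) ->
    Q f -> Q (fun x => c%:E * f x)) ->
  (forall f g : T -> \bar R, measurable_fun setT f -> (forall x, 0 <= f x) ->
    measurable_fun setT g -> (forall x, 0 <= g x) ->
    Q f -> Q g -> Q (fun x => f x + g x)) ->
  (forall (f_ : nat -> T -> \bar R) (f : T -> \bar R),
    (forall n, measurable_fun setT (f_ n)) -> (forall n x, 0 <= f_ n x) ->
    (forall x, nondecreasing_seq (f_ ^~ x)) ->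
    (forall x, f_ n x @[n --> \oo] --> f x) ->
    (forall n, Q (f_ n)) -> Q f) ->
  forall f : T -> \bar R, measurable_fun setT f -> (forall x, 0 <= f x) -> Q f.
Proof.
move=> Q1 QZ QD Qlim f mf f0.
pose h := nnsfun_approx measurableT mf.
refine (Qlim (fun n => EFin \o h n) f _ _ _ _ _).
- by move=> n; apply/measurable_EFinP.
- by move=> n x; rewrite /= lee_fin.
- by move=> x a b ab; rewrite lee_fin; exact/lefP/nd_nnsfun_approx.
- by move=> x; exact: cvg_nnsfun_approx.
move=> n.
have -> : EFin \o h n = (fun x => (\sum_(y <- enum_fset (fset_set (range (h n))))
    (y * \1_(h n @^-1` [set y]) x)%:E)).
  by apply/funext => x /=; rewrite [in LHS]fimfunE fsbig_finite//= sumEFin.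
have : {subset enum_fset (fset_set (range (h n))) <= [pred y | (0 <= y)%R]}.
  by move=> y; rewrite -/(y \in fset_set (range (h n))) in_fset_set// => /set_mem[t _ <-]; rewrite inE.
have Qt r : (0 <= r)%R -> Q (fun x => (r * \1_(h n @^-1` [set r]) x)%:E).
  move=> r0.
  have -> : (fun x => (r * \1_(h n @^-1` [set r]) x)%:E) =
            (fun x => r%:E * (\1_(h n @^-1` [set r]) x)%:E).
    by apply/funext => x; rewrite EFinM.
  apply: QZ => //; last by apply: Q1.
  exact/measurable_EFinP.
have mt r : measurable_fun setT (fun x => (r * \1_(h n @^-1` [set r]) x)%:E).
  by apply/measurable_EFinP; exact: measurable_funM.
elim: (enum_fset _) => [|y s IH] ys.
  have -> : (fun x => \sum_(y <- [::]) (y * \1_(h n @^-1` [set y]) x)%:E) =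
    (fun x : T => (\1_set0 x)%:E).
    by apply/funext => x; rewrite big_nil indic0.
  exact: Q1.
have y0 : (0 <= y)%R by have := ys y; rewrite !inE eqxx => /(_ isT).
have s0 : {subset s <= [pred y | (0 <= y)%R]}.
  by move=> z zs; apply: ys; rewrite inE zs orbT.
have -> : (fun x => \sum_(y <- y :: s) (y * \1_(h n @^-1` [set y]) x)%:E) =
   (fun x => (y * \1_(h n @^-1` [set y]) x)%:E +
     \sum_(y <- s) (y * \1_(h n @^-1` [set y]) x)%:E).
  by apply/funext => x; rewrite big_cons.
apply: QD; [exact: mt| | | |exact: Qt|exact: IH].
- by move=> x; rewrite lee_fin mulr_ge0.
- exact: emeasurable_sum.
- move=> x; rewrite big_seq; apply: sume_ge0 => z /s0; rewrite inE => z0.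
  by rewrite lee_fin mulr_ge0.
Qed.

Lemma density_measure_exists (mu : {measure set T -> \bar R}) (g : T -> \bar R) :
  measurable_fun setT g -> (forall x, 0 <= g x) ->
  exists nu : {measure set T -> \bar R},
    (forall A, measurable A -> nu A = \int[mu]_(x in A) g x) /\
    (forall h : T -> \bar R, measurable_fun setT h -> (forall y, 0 <= h y) ->
      \int[nu]_x h x = \int[mu]_x (h x * g x)).
Proof.
move=> mg g0.
pose nu (A : set T) := \int[mu]_(x in A) g x.
have nu0 : nu set0 = 0 by rewrite /nu integral_set0.
have nu_ge0 A : 0 <= nu A by rewrite /nu integral_ge0.
have nu_sa : semi_sigma_additive nu.
  move=> /= F mF tF mUF; rewrite /nu; apply: cvg_toP.
    apply: ereal_nondecreasing_is_cvgn => m n mn.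
    by apply: lee_sum_nneg_natr => // k _ _; apply: integral_ge0.
  by rewrite ge0_integral_bigcup//=; exact: measurable_funTS.
pose nu' : {measure set T -> \bar R} := HB.pack nu
  (isMeasure.Build _ _ _ nu nu0 nu_ge0 nu_sa).
exists nu'; split => //.
apply: ge0_measurable_ind.
- move=> A mA; rewrite integral_indic// setIT /= /nu integral_mkcond.
  by apply: eq_integral => x _; rewrite epatch_indic muleC.
- move=> c f c0 mf f0 IH; rewrite ge0_integralZl_EFin// IH.
  rewrite -ge0_integralZl_EFin//.
  + by apply: eq_integral => x _; rewrite muleA.
  + by move=> x _; rewrite mule_ge0.
  + exact: emeasurable_funM.
- move=> f h mf f0 mh h0 If Ih; rewrite ge0_integralD// If Ih -ge0_integralD//.
  + by apply: eq_integral => x _; rewrite ge0_muleDl.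
  + by move=> x _; rewrite mule_ge0.
  + exact: emeasurable_funM.
  + by move=> x _; rewrite mule_ge0.
  + exact: emeasurable_funM.
- move=> f_ f mf f0 ndf cf IH.
  have f00 x : 0 <= f x.
    by rewrite -(cvg_lim _ (cf x))//; apply: lime_ge; [apply/cvg_ex; exists (f x)|exact: nearW].
  have L1 : \int[nu']_x f_ n x @[n --> \oo] --> \int[nu']_x f x.
    have := @cvg_monotone_convergence _ _ _ nu' setT measurableT f_ mf
      (fun n x _ => f0 n x) (fun x _ => ndf x).
    by under eq_integral do rewrite (cvg_lim _ (cf _))//.
  have L2 : \int[mu]_x (f_ n x * g x) @[n --> \oo] --> \int[mu]_x (f x * g x).
    have := @cvg_monotone_convergence _ _ _ mu setT measurableT
      (fun n x => f_ n x * g x) _ _ _.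
    move=> H.
    have {}H := H (fun n => emeasurable_funM (mf n) mg) (fun n x _ => mule_ge0 (f0 n x) (g0 x)).
    have E x : limn (fun n => f_ n x * g x) = f x * g x.
      apply/cvg_lim => //.
      have [fx0|fx0] := eqVneq (f x) 0.
        rewrite (_ : (fun n => _) = cst 0); first by rewrite fx0 mul0e; exact: cvg_cst.
        apply/funext => n /=; suff -> : f_ n x = 0 by rewrite mul0e.
        apply/eqP; rewrite eq_le f0 andbT -fx0 -(cvg_lim _ (cf x))//.
        by rewrite (cvg_lim _ (ereal_nondecreasing_cvgn (ndf x)))//; apply: ereal_sup_ubound; exists n.
      have [->|gx0] := eqVneq (g x) 0.
        by rewrite mule0; under eq_fun do rewrite mule0; exact: cvg_cst.
      apply: cvgeM; [|exact: cf|exact: cvg_cst].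
      by apply: neq0_mule_def; rewrite mule_eq0 negb_or fx0 gx0.
    under eq_integral do rewrite -E.
    apply: H => x _ n m nm; apply: lee_wpmul2r => //; exact: ndf.
  apply: (cvg_unique _ L1) => //.
  by move: L2; under eq_fun do rewrite -IH.
Qed.
End measures.

Lemma prob_integral_cst d (T : measurableType d) (R : realType) (P : probability T R) (c : R) :
  (\int[P]_(w in setT) c%:E = c%:E)%E.
Proof.
transitivity (c%:E * P setT)%E; first exact: integral_cst.
by rewrite (probability_setT P) mule1.
Qed.

Section affine.
Variable R : realType.
Local Notation mu := (@lebesgue_measure R).
Local Open Scope ereal_scope.

(** Both substitutions come from uniqueness of Lebesgue measure: the pushforward of
    the measure under the affine map has the right values on half-open intervals. *)
Lemma ge0_integral_shift (f : R -> \bar R) (c : R) :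
  measurable_fun setT f -> (forall x, 0 <= f x) ->
  \int[mu]_x f (x + c)%R = \int[mu]_x f x.
Proof.
move=> mf f0.
have mphi : measurable_fun setT (fun x : R => x + c)%R by exact: measurable_funD.
have [nu [nuE nuI]] := @pushforward_exists _ _ R _ (measurableTypeR R) mu _ mphi.
rewrite -nuI//; apply: eq_measure_integral => A mA _; apply/esym.
apply: lebesgue_measure_unique => // _ [[a b] _ <-] /=; rewrite nuE.
have -> : (fun x : R => x + c)%R @^-1` `]a, b] = `](a - c)%R, (b - c)%R]%classic.
  by apply/seteqP; split => x /=; rewrite !in_itv/= ltrBlDr lerBrDr.
rewrite lebesgue_measure_itv/= (lebesgue_measure_itv `](a - c)%R, (b - c)%R])/= !lte_fin ltrD2r.
by case: ifPn => // _; rewrite -!EFinD; congr EFin; ring.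
Qed.

Lemma ge0_integral_scale (f : R -> \bar R) (c : R) : (0 < c)%R ->
  measurable_fun setT f -> (forall x, 0 <= f x) ->
  \int[mu]_x f (c * x)%R = (c^-1)%:E * \int[mu]_x f x.
Proof.
move=> c0 mf f0.
have mphi : measurable_fun setT (fun x : R => c * x)%R by exact: measurable_funM.
have [nu [nuE nuI]] := @pushforward_exists _ _ R _ (measurableTypeR R) mu _ mphi.
have ci0 : (0 <= c^-1)%R by rewrite invr_ge0 ltW.
rewrite -nuI//.
have cm (A : set (measurableTypeR R)) : measurable A -> mu A = c%:E * nu A.
  move=> mA.
  have := @lebesgue_measure_unique _ (mscale (NngNum (ltW c0)) nu) _ A mA.
  rewrite /mscale/=; apply.
  move=> _ [[a b] _ <-] /=; rewrite /mscale /= nuE.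
  have -> : (fun x : R => c * x)%R @^-1` `]a, b] = `](a / c)%R, (b / c)%R]%classic.
    by apply/seteqP; split => x /=; rewrite !in_itv/= ltr_pdivrMr// ler_pdivlMr// mulrC.
  rewrite lebesgue_measure_itv/= (lebesgue_measure_itv `](a / c)%R, (b / c)%R])/= !lte_fin.
  rewrite ltr_pM2r ?invr_gt0//.
  case: ifPn => // _; last by rewrite mule0.
  by rewrite -!EFinD -EFinM; congr EFin; field; rewrite gt_eqF.
have -> : \int[mu]_x f x = c%:E * \int[nu]_x f x.
  rewrite -[RHS](@ge0_integral_mscale _ _ R nu setT measurableT (NngNum (ltW c0)) f)//.
  by apply: eq_measure_integral => A mA _; rewrite /mscale/= cm.
by rewrite muleA -EFinM mulVf ?gt_eqF// mul1e.
Qed.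

Lemma tonelli d1 d2 (T1 : measurableType d1) (T2 : measurableType d2)
    (m1 : {sigma_finite_measure set T1 -> \bar R})
    (m2 : {sigma_finite_measure set T2 -> \bar R}) (f : T1 -> T2 -> \bar R) :
  measurable_fun setT (fun z : T1 * T2 => f z.1 z.2) -> (forall x y, 0 <= f x y) ->
  \int[m1]_x \int[m2]_y f x y = \int[m2]_y \int[m1]_x f x y.
Proof.
by move=> mf f0; exact: (@fubini_tonelli _ _ _ _ _ m1 m2 (fun z => f z.1 z.2)).
Qed.

Lemma ge0_integral_mulc d (T : measurableType d) (m : {measure set T -> \bar R})
    (c : R) (f : T -> R) : (0 <= c)%R -> measurable_fun setT f ->
  (forall x, (0 <= f x)%R) ->
  \int[m]_x (c * f x)%:E = c%:E * \int[m]_x (f x)%:E.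
Proof.
move=> c0 mf f0; under eq_integral do rewrite EFinM.
by rewrite ge0_integralZl_EFin//; [move=> x _; rewrite lee_fin|exact/measurable_EFinP].
Qed.

End affine.

(** * Powers on the half-line *)

Section positive_power.
Variable R : realType.
Implicit Types s x c : R.

(** The power [x^s] cut off at [x > 0].  With this convention integrals over
    intervals become integrals over the line, and shifts and scalings need no change of
    bounds.  In contrast to [x `^ s], it vanishes for all [x <= 0], even if [s = 0]. *)
Definition ppow s x : R := if 0 < x then x `^ s else 0.

Lemma ppow_ge0 s x : 0 <= ppow s x.
Proof. by rewrite /ppow; case: ifP => // _; exact: powR_ge0. Qed.

Lemma ppowE s x : 0 < x -> ppow s x = x `^ s.
Proof. by rewrite /ppow => ->. Qed.

Lemma ppow_le0 s x : x <= 0 -> ppow s x = 0.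
Proof. by rewrite /ppow leNgt => /negbTE ->. Qed.

Lemma ppow_scale s c x : 0 < c -> ppow s (c * x) = c `^ s * ppow s x.
Proof.
move=> c0; rewrite /ppow pmulr_rgt0//; case: ifPn => x0; last by rewrite mulr0.
by rewrite powRM ?ltW.
Qed.

Lemma gt0_powRD x r s : 0 < x -> x `^ (r + s) = x `^ r * x `^ s.
Proof. by move=> x0; rewrite powRD// (gt_eqF x0) implybT. Qed.

Lemma ppowD r s x : ppow (r + s) x = ppow r x * ppow s x.
Proof.
rewrite /ppow; case: ifPn => x0; last by rewrite mul0r.
exact: gt0_powRD.
Qed.

Lemma measurable_ppow s : measurable_fun setT (ppow s).
Proof.
apply: (@measurable_fun_ifT _ _ _ _ (fun x => x `^ s) (cst 0) (fun x => 0 < x)) => //.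
exact: measurable_fun_ltr.
Qed.

Lemma measurable_ppowT d (T : measurableType d) s (f : T -> R) :
  measurable_fun setT f -> measurable_fun setT (fun y => ppow s (f y)).
Proof. by move=> mf; apply: measurableT_comp => //; exact: measurable_ppow. Qed.

End positive_power.

Lemma measurable_expRT (R : realType) d (T : measurableType d) (f : T -> R) :
  measurable_fun setT f -> measurable_fun setT (fun y => expR (f y)).
Proof. by move=> mf; exact: measurableT_comp. Qed.

Lemma measurable_EFinT (R : realType) d (T : measurableType d) (f : T -> R) :
  measurable_fun setT f -> measurable_fun setT (fun y => (f y)%:E).
Proof. by move=> mf; apply/measurable_EFinP. Qed.

Lemma measurable_oppT (R : realType) d (T : measurableType d) (f : T -> R) :
  measurable_fun setT f -> measurable_fun setT (fun y => - f y).
Proof. exact: measurableT_comp. Qed.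

Lemma measurable_powRT (R : realType) s d (T : measurableType d) (f : T -> R) :
  measurable_fun setT f -> measurable_fun setT (fun y => f y `^ s).
Proof. by move=> mf; apply: (measurableT_comp (measurable_powR s)). Qed.

Ltac mtac := repeat first
  [ assumption | exact: measurable_cst | exact: measurable_id
  | exact: measurable_fst | exact: measurable_snd
  | apply: measurable_EFinT
  | apply: measurable_ppowT | apply: measurable_expRT | apply: measurable_powRT
  | apply: emeasurable_funM | apply: measurable_funM
  | apply: measurable_funB | apply: measurable_funD
  | apply: measurable_oppT ].

(** * Gamma and Beta integrals *)

Section Gamma_theory.
Variable R : realType.
Local Notation mu := (@lebesgue_measure R).
Implicit Types s p q x : R.

Let solve_scaled (x k : R) (I B : \bar R) : x != 0 ->
  (k%:E * B = x^-1%:E * I)%E -> I = ((x * k)%:E * B)%E.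
Proof.
by move=> x0 E; rewrite EFinM -muleA E muleA -EFinM mulfV// mul1e.
Qed.

Let cancel_mid (G A B C E : R) : A != 0 ->
  G^-1 * (B * A * E) * (C * A^-1) = C / G * (B * E).
Proof.
move=> A0; rewrite -[RHS]mul1r -(mulfV A0); ring.
Qed.

(** Euler's two integrals with values in the extended reals, so that Tonelli applies
    before finiteness is known. *)
Definition gint s : \bar R := (\int[mu]_x (ppow (s - 1) x * expR (- x))%:E)%E.
Definition bint p q : \bar R :=
  (\int[mu]_u (ppow (p - 1) (1 - u) * ppow (q - 1) u)%:E)%E.

Lemma gint_ge0 s : (0 <= gint s)%E.
Proof.
by apply: integral_ge0 => x _; rewrite lee_fin mulr_ge0 ?ppow_ge0 ?expR_ge0.
Qed.

Lemma bint_ge0 p q : (0 <= bint p q)%E.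
Proof. by apply: integral_ge0 => x _; rewrite lee_fin mulr_ge0 ?ppow_ge0. Qed.

(** Substitute [u = x u']. *)
Lemma convolution_ppow p q x :
  (\int[mu]_u (ppow (p - 1) (x - u) * ppow (q - 1) u)%:E =
   (ppow (p + q - 1) x)%:E * bint p q)%E.
Proof.
have [x0|x0] := ltP 0 x; last first.
  rewrite ppow_le0// mul0e integral0_eq// => u _.
  have [u0|u0] := ltP 0 u; last by rewrite (ppow_le0 _ u0) mulr0.
  by rewrite ppow_le0 ?mul0r// subr_le0 (le_trans x0)// ltW.
pose f u := (ppow (p - 1) (x - u) * ppow (q - 1) u)%:E.
have mf : measurable_fun setT f by mtac.
have f0 u : (0 <= f u)%E by rewrite lee_fin mulr_ge0 ?ppow_ge0.
have := ge0_integral_scale x0 mf f0.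
have -> : (fun u => f (x * u)) =
   (fun u => (x `^ (p + q - 2) * (ppow (p - 1) (1 - u) * ppow (q - 1) u))%:E).
  apply/funext => u; rewrite /f -[X in X - x * u]mulr1 -mulrBr !ppow_scale//.
  have -> : p + q - 2 = (p - 1) + (q - 1) by ring.
  by rewrite (gt0_powRD (p - 1) (q - 1) x0); congr EFin; ring.
rewrite ge0_integral_mulc; last 3 first.
- exact: powR_ge0.
- by mtac.
- by move=> u; rewrite mulr_ge0 ?ppow_ge0.
move=> E; rewrite -[LHS]/(\int[mu]_u f u)%E.
have xN0 : x != 0 by rewrite gt_eqF.
refine (etrans (solve_scaled xN0 E) _); congr (_%:E * _)%E.
have -> : p + q - 1 = 1 + (p + q - 2) by ring.
by rewrite (ppowE _ x0) (gt0_powRD 1 (p + q - 2) x0) powRr1// ltW.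
Qed.

(** The classical computation of the product of two Gamma integrals: the substitution
    [x = u + y] makes a convolution appear. *)
Lemma gint_mul p q : (gint p * gint q = bint p q * gint (p + q))%E.
Proof.
transitivity (\int[mu]_u \int[mu]_x
   (ppow (q - 1) u * ppow (p - 1) (x - u) * expR (- x))%:E)%E.
  rewrite muleC /gint -ge0_integralZr//; last 3 first.
  - by mtac.
  - by move=> x _; rewrite lee_fin mulr_ge0 ?ppow_ge0 ?expR_ge0.
  - exact: gint_ge0.
  apply: eq_integral => u _.
  rewrite -(@ge0_integral_shift _ _ (- u)); last 2 first.
  - by mtac.
  - by move=> x; rewrite lee_fin mulr_ge0 ?ppow_ge0 ?expR_ge0.
  rewrite -ge0_integral_mulc; last 3 first.
  - by rewrite mulr_ge0 ?ppow_ge0 ?expR_ge0.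
  - by mtac.
  - by move=> x; rewrite mulr_ge0 ?ppow_ge0 ?expR_ge0.
  apply: eq_integral => x _; congr EFin.
  by rewrite opprD opprK expRD (expRN u); field; rewrite expR_eq0.
rewrite tonelli; last 2 first.
- by mtac.
- by move=> x y; rewrite lee_fin !mulr_ge0 ?ppow_ge0 ?expR_ge0.
rewrite muleC -ge0_integralZr//; last 3 first.
- by mtac.
- by move=> x _; rewrite lee_fin mulr_ge0 ?ppow_ge0 ?expR_ge0.
- exact: bint_ge0.
apply: eq_integral => x _.
rewrite EFinM -muleAC -convolution_ppow muleC -ge0_integral_mulc ?expR_ge0//; last 2 first.
- by mtac.
- by move=> u; rewrite mulr_ge0 ?ppow_ge0.
by apply: eq_integral => u _; congr EFin; ring.
Qed.

(** By the fundamental theorem of calculus between [1/n] and [1]; it starts the recursion for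
    Gamma, as [gint_mul] at [p = 1] then reads Gamma(s+1) = s Gamma(s). *)
Lemma bint1 s : 0 < s -> (bint 1 s = (s^-1)%:E)%E.
Proof.
move=> s0.
have -> : (bint 1 s = \int[mu]_(x in `]0%R, 1%R[) (x `^ (s - 1))%:E)%E.
  rewrite [RHS]integral_mkcond; apply: eq_integral => x _.
  rewrite patchE subrr; have [x0|x0] := ltP 0 x; last first.
    by rewrite memNset ?(ppow_le0 _ x0) ?mulr0//= in_itv/= ltNge x0.
  have [x1|x1] := ltP x 1; last first.
    by rewrite memNset ?(@ppow_le0 _ 0) ?mul0r ?subr_le0//= in_itv/= (ltNge x) x1 andbF.
  by rewrite mem_set/= ?in_itv/= ?x0//; rewrite !ppowE ?subr_gt0// powRr0 mul1r.
rewrite integral_itv_bndo_bndc; last first.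
  by apply/measurable_EFinP/measurable_funTS; exact: measurable_powR.
pose F n := `[(n.+1%:R^-1 : R), 1]%classic.
have UF : \bigcup_n F n = `]0, 1]%classic.
  apply/seteqP; split => [x [n _]|x]; rewrite /F /= !in_itv/= => /andP[].
    by move=> nx ->; rewrite andbT (lt_le_trans _ nx)// invr_gt0.
  move=> x0 x1; exists (Num.truncn x^-1) => //=; rewrite in_itv/= x1 andbT.
  by rewrite invf_ple ?posrE//; apply/ltW; exact: truncnS_gt.
rewrite -UF.
have L1 : (\int[mu]_(x in F n) (x `^ (s - 1))%:E @[n --> \oo] -->
  \int[mu]_(x in \bigcup_n F n) (x `^ (s - 1))%:E)%E.
  apply: ge0_nondecreasing_set_cvg_integral => //.
  - apply/nondecreasing_seqP => n; apply/subsetPset => x; rewrite /F /= !in_itv/=.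
    move=> /andP[nx ->]; rewrite andbT (le_trans _ nx)// lef_pV2 ?posrE// ler_nat//.
  - by move=> n; exact: measurable_itv.
  - by move=> n; apply/measurable_EFinP/measurable_funTS; exact: measurable_powR.
  - by move=> n x _; rewrite lee_fin powR_ge0.
apply: (cvg_unique _ L1) => //.
have I n : (\int[mu]_(x in F n.+1) (x `^ (s - 1))%:E =
   (s^-1 - (n.+2%:R^-1) `^ s / s)%:E)%E.
  have a0 : 0 < n.+2%:R^-1 :> R by rewrite invr_gt0.
  have dF (x : R) : 0 < x -> is_derive x 1 (fun x => x `^ s / s) (x `^ (s - 1)).
    move=> x0.
    have -> : (fun x => x `^ s / s) = s^-1 *: (fun x : R => x `^ s).
      by apply/funext => y; rewrite /= mulrC.
    have -> : x `^ (s - 1) = s^-1 *: (s * x `^ (s - 1)).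
      by rewrite /GRing.scale/= mulKf ?gt_eqF.
    exact: is_deriveZ (is_derive1_powR _ x0).
  have cF (x : R) : 0 < x -> {for x, continuous (fun x : R => x `^ s / s)}.
    move=> x0; apply: differentiable_continuous; apply/derivable1_diffP.
    by have [] := dF _ x0.
  rewrite (@continuous_FTC2 _ _ (fun x => x `^ s / s)).
  - by rewrite powR1 mul1r -EFinB.
  - by rewrite invf_lt1// ltr1n.
  - apply/subspace_continuousP => x /=; rewrite in_itv/= => /andP[ax _].
    have x0 : 0 < x by exact: lt_le_trans ax.
    apply: cvg_within_filter; apply: differentiable_continuous; apply/derivable1_diffP.
    by have [] := is_derive1_powR (s - 1) x0.
  - split => [x||].
    + by rewrite in_itv/= => /andP[ax _]; have [] := dF x (lt_trans a0 ax).
    + by apply/cvg_at_right_filter/cF.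
    + by apply/cvg_at_left_filter/cF.
  - move=> x; rewrite in_itv/= => /andP[ax _].
    by rewrite derive1E; have [_ ->] := dF x (lt_trans a0 ax).
have L2 : (\int[mu]_(x in F n.+1) (x `^ (s - 1))%:E @[n --> \oo] --> (s^-1)%:E)%E.
  under eq_fun do rewrite I.
  apply: cvg_EFin; first exact: nearW.
  rewrite -[X in _ --> X]subr0; apply: cvgB; first exact: cvg_cst.
  rewrite -[X in _ --> X](mul0r s^-1); apply: cvgM; last exact: cvg_cst.
  have /cvg_at_rightP := @powR_cvg0 R s s0; apply; split => [n|]; first by rewrite invr_gt0.
  by have := @cvg_harmonic R; rewrite -cvg_shiftS.
by move: L2; rewrite (cvg_shiftS (fun n => \int[mu]_(x in F n) (x `^ (s - 1))%:E)%E).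
Qed.

Lemma gint1 : (gint 1 = 1)%E.
Proof.
transitivity (\int[mu]_x (exponential_pdf 1 x)%:E)%E; last exact: integral_exponential_pdf.
have -> : (gint 1 = \int[mu]_(x in `]0%R, +oo[) (exponential_pdf 1 x)%:E)%E.
  rewrite [RHS]integral_mkcond; apply: eq_integral => x _.
  rewrite patchE subrr; have [x0|x0] := ltP 0 x; last first.
    by rewrite memNset ?(ppow_le0 _ x0) ?mul0r//= in_itv/= ltNge x0.
  rewrite mem_set/= ?in_itv/= ?x0// ppowE// powRr0 mul1r.
  by rewrite exponential_pdfE ?ltW//= mul1r mulN1r.
rewrite integral_itv_obnd_cbnd; last first.
  by apply/measurable_EFinP/measurable_funTS; exact: measurable_exponential_pdf.
rewrite integral_mkcond; apply: eq_integral => x _; rewrite patchE.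
have [x0|x0] := leP 0 x; first by rewrite mem_set//= in_itv/= x0.
by rewrite memNset ?lt0_exponential_pdf//= in_itv/= leNgt x0.
Qed.

Lemma gintS s : 0 < s -> (gint (s + 1) = s%:E * gint s)%E.
Proof.
move=> s0; have := gint_mul 1 s.
rewrite gint1 mul1e bint1// addrC => ->.
by rewrite muleA -EFinM mulfV ?gt_eqF// mul1e.
Qed.

(** For [x < 1] the integrand is compared with that of [bint 1 t]
    and, for [x >= 1], with that of [gint 1]; then induction by [gintS]. *)
Lemma gint_lty s : 0 < s -> (gint s < +oo)%E.
Proof.
have H n t : 0 < t <= n.+1%:R -> (gint t < +oo)%E.
  elim: n t => [|n IH] t /andP[t0 tn]; last first.
    have [t1|t1] := leP t n.+1%:R; first by apply: IH; rewrite t0 t1.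
    have t10 : 0 < t - 1 by rewrite subr_gt0 (le_lt_trans _ t1)// ler1n.
    rewrite -[t](subrK 1) gintS// lte_mul_pinfty ?lee_fin ?ltW//.
    by apply: IH; rewrite t10/= lerBlDr natr1.
  apply: (@le_lt_trans _ _ (bint 1 t + gint 1)%E); last first.
    by rewrite bint1// gint1 lte_add_pinfty ?ltry.
  rewrite /bint /gint -ge0_integralD//; last 4 first.
  - by move=> x _; rewrite lee_fin mulr_ge0 ?ppow_ge0.
  - by mtac.
  - by move=> x _; rewrite lee_fin mulr_ge0 ?ppow_ge0 ?expR_ge0.
  - by mtac.
  apply: ge0_le_integral => //.
  - by move=> x _; rewrite lee_fin mulr_ge0 ?ppow_ge0 ?expR_ge0.
  - by mtac.
  - by apply: emeasurable_funD; mtac.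
  move=> x _; rewrite -EFinD lee_fin !subrr.
  have [x0|x0] := ltP 0 x; last by rewrite !(ppow_le0 _ x0) !mul0r !mulr0 addr0.
  rewrite !(ppowE _ x0) powRr0 mul1r; have [x1|x1] := ltP x 1.
    rewrite ppowE ?subr_gt0// powRr0 mul1r ler_wpDr ?expR_ge0//.
    by rewrite ler_piMr ?powR_ge0// expR_le1 oppr_le0 ltW.
  rewrite ppow_le0 ?subr_le0// mul0r add0r ler_piMl ?expR_ge0//.
  have : x `^ (t - 1) <= x `^ 0 by rewrite ler_powR// subr_le0.
  by rewrite powRr0.
move=> s0; apply: (H (Num.truncn s)); rewrite s0/=; apply/ltW; exact: truncnS_gt.
Qed.

Lemma GammaE s : (Gamma s = fine (gint s)).
Proof.
rewrite /Gamma /Rintegral; congr fine; rewrite integral_mkcond.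
apply: eq_integral => x _; rewrite patchE; have [x0|x0] := ltP 0 x.
  by rewrite mem_set/= ?in_itv/= ?x0// ppowE.
by rewrite memNset ?(ppow_le0 _ x0) ?mul0r//= in_itv/= ltNge x0.
Qed.

Lemma EFin_Gamma s : 0 < s -> (Gamma s)%:E = gint s.
Proof.
by move=> s0; rewrite GammaE fineK// ge0_fin_numE ?gint_ge0 ?gint_lty.
Qed.

Lemma GammaS s : 0 < s -> Gamma (s + 1) = s * Gamma s.
Proof.
move=> s0; apply: EFin_inj; rewrite EFinM !EFin_Gamma ?gintS//.
by rewrite addr_gt0.
Qed.

Lemma Gamma1 : Gamma 1 = 1 :> R.
Proof. by apply: EFin_inj; rewrite EFin_Gamma// gint1. Qed.

Lemma Gamma_gt0 s : 0 < s -> 0 < Gamma s.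
Proof.
move=> s0;
rewrite -lte_fin EFin_Gamma//.
pose c := (2 `^ `|s - 1|)^-1 * expR (- 2).
have c0 : 0 < c by rewrite mulr_gt0 ?invr_gt0 ?powR_gt0 ?expR_gt0.
apply: (@lt_le_trans _ _ (\int[mu]_(x in `[1%R, 2%R]) c%:E)%E).
  rewrite integral_cst//= lebesgue_measure_itv/= lte_fin ltr1n.
  by rewrite -EFinB -EFinM lte_fin mulr_gt0//; lra.
apply: (@le_trans _ _ (\int[mu]_(x in `[1%R, 2%R]) (ppow (s - 1) x * expR (- x))%:E)%E); last first.
  apply: ge0_subset_integral => //; first by mtac.
  by move=> x _; rewrite lee_fin mulr_ge0 ?ppow_ge0 ?expR_ge0.
apply: ge0_le_integral => //.
- by move=> x _; rewrite lee_fin ltW.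
- by apply/measurable_funTS; mtac.
move=> x; rewrite /= in_itv/= => /andP[x1 x2]; rewrite lee_fin.
have x0 : 0 < x by exact: lt_le_trans x1.
apply: ler_pM; rewrite ?invr_ge0 ?powR_ge0 ?expR_ge0//; last by rewrite ler_expR lerN2.
rewrite ppowE//; apply: (@le_trans _ _ (x `^ (- `|s - 1|))).
  by rewrite powRN lef_pV2 ?posrE ?powR_gt0// ge0_ler_powR ?nnegrE// ltW.
by rewrite ler_powR// lerNl; apply: le_trans (ler_norm _) _; rewrite normrN.
Qed.

Lemma gint_scale s v : 0 < s -> 0 < v ->
  (\int[mu]_x (ppow (s - 1) x * expR (- (v * x)))%:E = (Gamma s * v `^ (- s))%:E)%E.
Proof.
move=> s0 v0; rewrite EFinM EFin_Gamma// /gint.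
pose f x := (ppow (s - 1) x * expR (- x))%:E.
have mf : measurable_fun setT f by mtac.
have f0 u : (0 <= f u)%E by rewrite lee_fin mulr_ge0 ?ppow_ge0 ?expR_ge0.
have E := ge0_integral_scale v0 mf f0.
have -> : (fun x => (ppow (s - 1) x * expR (- (v * x)))%:E) =
   (fun x => (v `^ (1 - s))%:E * f (v * x)%R)%E.
  apply/funext => x; rewrite /f ppow_scale// -EFinM !mulrA -gt0_powRD//.
  by have -> : 1 - s + (s - 1) = 0 by [ring]; rewrite powRr0 mul1r.
rewrite ge0_integralZl_EFin ?powR_ge0//; last first.
  by apply: measurableT_comp => //; exact: measurable_funM.
rewrite E muleA -EFinM muleC; congr (_ * _%:E)%E.
rewrite -(powR_inv1 (ltW v0)) -gt0_powRD//; congr (_ `^ _); ring.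
Qed.

Lemma bintE p q : 0 < p -> 0 < q ->
  bint p q = (Gamma p * Gamma q / Gamma (p + q))%:E.
Proof.
move=> p0 q0; have pq0 : 0 < p + q by exact: addr_gt0.
have := gint_mul p q; rewrite -!EFin_Gamma// -EFinM => /esym E.
have G0 := Gamma_gt0 pq0.
rewrite EFinM -E -muleA -EFinM mulfV ?gt_eqF// mule1//.
Qed.

Lemma convolution_kernel p q v x : 0 < p -> 0 < q ->
  (\int[mu]_u (ppow (p - 1) (x - u) * ppow (q - 1) (u - v))%:E =
  (Gamma p * Gamma q / Gamma (p + q) * ppow (p + q - 1) (x - v))%:E)%E.
Proof.
move=> p0 q0; rewrite -(@ge0_integral_shift _ _ v); last 2 first.
- by mtac.
- by move=> u; rewrite lee_fin mulr_ge0 ?ppow_ge0.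
under eq_integral do rewrite addrK opprD addrA addrAC.
by rewrite convolution_ppow bintE// muleC.
Qed.

(** After the shift by [v], write [(x+v)^(-(p+q))] as a Gamma integral over an auxiliary variable and
    integrate in [x] first. *)
Lemma Riesz_tail p q v : 0 < p -> 0 < q -> 0 < v ->
  (\int[mu]_x (ppow (- (p + q)) x * ppow (q - 1) (x - v))%:E =
  (Gamma p * Gamma q / Gamma (p + q) * v `^ (- p))%:E)%E.
Proof.
move=> p0 q0 v0; have pq0 : 0 < p + q by exact: addr_gt0.
have G0 := Gamma_gt0 pq0.
transitivity (\int[mu]_x \int[mu]_l
   ((Gamma (p + q))^-1 * (ppow (q - 1) x * (ppow (p + q - 1) l * expR (- ((x + v) * l)))))%:E)%E.
  rewrite -(@ge0_integral_shift _ _ v); last 2 first.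
  - by mtac.
  - by move=> u; rewrite lee_fin mulr_ge0 ?ppow_ge0.
  apply: eq_integral => x _; rewrite addrK.
  rewrite ge0_integral_mulc; last 3 first.
  - by rewrite invr_ge0 ltW.
  - by mtac.
  - by move=> l; rewrite !mulr_ge0 ?ppow_ge0 ?expR_ge0.
  rewrite ge0_integral_mulc; last 3 first.
  - exact: ppow_ge0.
  - by mtac.
  - by move=> l; rewrite !mulr_ge0 ?ppow_ge0 ?expR_ge0.
  have [x0|x0] := ltP 0 x; last by rewrite (ppow_le0 _ x0) mulr0 mul0e mule0.
  have xv : 0 < x + v by rewrite addr_gt0.
  rewrite gint_scale// -!EFinM (ppowE _ xv); congr EFin.
  by field; rewrite gt_eqF.
rewrite tonelli; last 2 first.
- by mtac.
- by move=> x y; rewrite lee_fin !mulr_ge0 ?ppow_ge0 ?expR_ge0// invr_ge0 ltW.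
transitivity (\int[mu]_l
  (Gamma q / Gamma (p + q) * (ppow (p - 1) l * expR (- (v * l))))%:E)%E.
  apply: eq_integral => l _.
  have [l0|l0] := ltP 0 l; last first.
    rewrite (ppow_le0 (p - 1) l0) mul0r mulr0 integral0_eq// => x _.
    by rewrite (ppow_le0 (p + q - 1) l0) mul0r !mulr0.
  under eq_integral => x _.
    rewrite (_ : _ * _ = ((Gamma (p + q))^-1 * (ppow (p + q - 1) l * expR (- (v * l)))) *
      (ppow (q - 1) x * expR (- (l * x)))); last first.
      by rewrite mulrDl opprD expRD (mulrC x l); ring.
    over.
  rewrite ge0_integral_mulc; last 3 first.
  - by rewrite !mulr_ge0 ?ppow_ge0 ?expR_ge0// invr_ge0 ltW.
  - by mtac.
  - by move=> x; rewrite !mulr_ge0 ?ppow_ge0 ?expR_ge0.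
  rewrite gint_scale// -EFinM !ppowE//; congr EFin.
  have -> : p + q - 1 = (p - 1) + q by ring.
  rewrite (gt0_powRD (p - 1) q l0) powRN cancel_mid//.
  by rewrite gt_eqF// powR_gt0.
rewrite ge0_integral_mulc; last 3 first.
- by apply: divr_ge0; apply: ltW; [exact: Gamma_gt0|exact: G0].
- by mtac.
- by move=> x; rewrite !mulr_ge0 ?ppow_ge0 ?expR_ge0.
rewrite (gint_scale p0 v0) -EFinM; congr EFin; ring.
Qed.

End Gamma_theory.

Lemma eq_ler (R : realType) (x y : R) : x = y -> x <= y.
Proof. by move=> ->. Qed.

Local Opaque Gamma.

Ltac gen := repeat match goal with
  | |- context [ln ?x] => generalize (ln x); intro
  | |- context [Gamma ?x] => generalize (Gamma x); intro
  | |- context [expR ?x] => generalize (expR x); intro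
  | |- context [ppow ?s ?x] => generalize (ppow s x); intro
  | |- context [powR ?s ?x] => generalize (powR s x); intro
  end.

Section real_inequalities.
Variable R : realType.

Lemma two_sided_diff (A B C D E : R) : A <= B - C -> B - C <= D ->
  A <= E - C -> E - C <= D -> - (D - A) <= B - E <= D - A.
Proof. by move=> *; apply/andP; split; lra. Qed.

Lemma scaled_lower (r l e : R) : 0 <= r -> r <= 1 -> 0 < e -> - e <= l -> - e <= r * l.
Proof.
move=> r0 r1 e0 el; have [l0|l0] := leP 0 l.
  by apply: (@le_trans _ _ 0); [rewrite oppr_le0 ltW|rewrite mulr_ge0].
by apply: (le_trans el); rewrite -[leLHS]mul1r ler_wnM2r// ltW.
Qed.

Lemma squeeze_norm (A B X e : R) : 0 < e -> - e <= A - B -> A <= X -> X <= B ->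
  `|X - B| <= e.
Proof. by move=> *; rewrite ler_norml; apply/andP; split; lra. Qed.

End real_inequalities.

(** * Log-convexity *)

Section log_convexity.
Variable R : realType.
Implicit Types (D : set R) (F g : R -> R).

(** Convexity of [ln F] in three-point form and without division. *)
Definition log_convex D F := forall s x t, D s -> D t -> s <= x <= t ->
  (t - s) * ln (F x) <= (t - x) * ln (F s) + (x - s) * ln (F t).

Lemma weighted_am_gm (u v theta : R) : 0 <= u -> 0 <= v -> 0 < theta < 1 ->
  u `^ theta * v `^ (1 - theta) <= theta * u + (1 - theta) * v.
Proof.
move=> u0 v0 /andP[t0 t1].
have t10 : 0 < 1 - theta by rewrite subr_gt0.
have := @conjugate_powR R (u `^ theta) (v `^ (1 - theta)) theta^-1 (1 - theta)^-1
  (powR_ge0 _ _) (powR_ge0 _ _).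
rewrite !invr_gt0 !invrK -!powRrM !mulfV ?gt_eqF// !powRr1//.
by move=> H; rewrite (mulrC theta) (mulrC (1 - theta)); apply: H => //; rewrite addrC subrK.
Qed.

(** Hölder's inequality, in the form of the weighted arithmetic-geometric inequality
    for the normalised functions [f s / F s] and [f t / F t]. *)
Lemma interpolation_log_convex d (T : measurableType d) (m : {measure set T -> \bar R})
    D F (f : R -> T -> R) :
  (forall s, D s -> measurable_fun setT (f s)) ->
  (forall s x, D s -> 0 <= f s x) ->
  (forall s, D s -> (\int[m]_x (f s x)%:E = (F s)%:E)%E) ->
  (forall s, D s -> 0 < F s) ->
  (forall s t x, D s -> D t -> s < x < t -> D x) ->
  (forall s t th x, D s -> D t -> s < t -> 0 < th < 1 ->
    f (th * s + (1 - th) * t) x <= f s x `^ th * f t x `^ (1 - th)) ->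
  log_convex D F.
Proof.
move=> mf f0 fF F0 Dc fc s x t Ds Dt /andP[]; rewrite le_eqVlt => /predU1P[<- _|sx].
  by rewrite subrr mul0r addr0.
rewrite le_eqVlt => /predU1P[<-|xt]; first by rewrite subrr mul0r add0r.
have ts : 0 < t - s by rewrite subr_gt0 (lt_trans sx).
pose th := (t - x) / (t - s).
have th0 : 0 < th by rewrite divr_gt0// subr_gt0.
have th1' : 1 - th = (x - s) / (t - s) by rewrite /th; field; rewrite gt_eqF.
have th1 : 0 < 1 - th by rewrite th1' divr_gt0// subr_gt0.
have xE : x = th * s + (1 - th) * t by rewrite th1' /th; field; rewrite gt_eqF.
have Dx : D x by apply: (Dc s t) => //; rewrite sx.
(* it suffices to bound F x by the geometric mean K, as th and 1 - th are the
     barycentric coordinates of x *)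
pose K := F s `^ th * F t `^ (1 - th).
have K0 : 0 < K by rewrite mulr_gt0 ?powR_gt0 ?F0.
have FK : F x <= K.
  have Fs := F0 _ Ds; have Ft := F0 _ Dt.
  have A0 : 0 <= K * th / F s by apply: divr_ge0; [apply: mulr_ge0|]; exact: ltW.
  have B0 : 0 <= K * (1 - th) / F t by apply: divr_ge0; [apply: mulr_ge0|]; exact: ltW.
  rewrite -lee_fin -fF//.
  have -> : K%:E = (\int[m]_y ((K * th / F s) * f s y + (K * (1 - th) / F t) * f t y)%:E)%E.
    under eq_integral do rewrite EFinD.
    rewrite ge0_integralD//; last 4 first.
    - by move=> y _; rewrite lee_fin; apply: mulr_ge0 => //; exact: f0.
    - by apply: measurable_EFinT; apply: measurable_funM => //; exact: mf.
    - by move=> y _; rewrite lee_fin; apply: mulr_ge0 => //; exact: f0.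
    - by apply: measurable_EFinT; apply: measurable_funM => //; exact: mf.
    rewrite ge0_integral_mulc; last 3 first.
    - by [].
    - exact: mf.
    - by move=> y; exact: f0.
    rewrite ge0_integral_mulc; last 3 first.
    - by [].
    - exact: mf.
    - by move=> y; exact: f0.
    rewrite !fF// -!EFinM -EFinD; congr EFin; field.
    by rewrite !gt_eqF.
  apply: ge0_le_integral => //.
  - by move=> y _; rewrite lee_fin f0.
  - by apply: measurable_EFinT; exact: mf.
  - by apply: measurable_EFinT; apply: measurable_funD; apply: measurable_funM => //; exact: mf.
  move=> y _; rewrite lee_fin {1}xE; apply: le_trans (fc s t th y Ds Dt (lt_trans sx xt) _) _.
    by rewrite th0/= -subr_gt0.
  have := @weighted_am_gm (f s y / F s) (f t y / F t) th.
  have As : 0 <= f s y / F s by apply: divr_ge0; [exact: f0|exact: ltW].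
  have At : 0 <= f t y / F t by apply: divr_ge0; [exact: f0|exact: ltW].
  move=> /(_ As At); rewrite th0 -(subr_gt0 th) th1 => /(_ isT).
  rewrite (powRM _ (f0 _ _ Ds)) ?invr_ge0 ?(ltW Fs)// (powRM _ (f0 _ _ Dt)) ?invr_ge0 ?(ltW Ft)// => H.
  have -> : f s y `^ th * f t y `^ (1 - th) =
    K * (f s y `^ th * (F s)^-1 `^ th * (f t y `^ (1 - th) * (F t)^-1 `^ (1 - th))).
    rewrite -!(powR_inv1 (ltW _))// -!powRrM !mulN1r !powRN /K; field.
    by rewrite !gt_eqF ?powR_gt0.
  by apply: le_trans (ler_wpM2l (ltW K0) H) _; apply: eq_ler; ring.
have : ln (F x) <= th * ln (F s) + (1 - th) * ln (F t).
  rewrite -!ln_powR -lnM ?posrE ?powR_gt0 ?F0//.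
  by rewrite ler_ln ?posrE ?F0.
move=> /(ler_wpM2l (ltW ts)) /le_trans; apply.
by apply: eq_ler; rewrite th1' /th; field; rewrite gt_eqF.
Qed.

Section shift.
Variables (D : set R) (F g : R -> R) (a : R).
Hypotheses (a0 : 0 < a) (F0 : forall s, D s -> 0 < F s)
  (cF : log_convex D F) (DS : forall s t, D s -> s <= t -> D t)
  (Fa : forall s, D s -> F (s + a) = g s * F s).

Lemma log_shift (s : R) : D s -> ln (F (s + a)) = ln (g s) + ln (F s).
Proof.
move=> Ds; have Fs := F0 Ds.
have Dsa : D (s + a) by apply: (DS Ds); rewrite lerDl ltW.
have gs : 0 < g s by have := F0 Dsa; rewrite Fa// pmulr_lgt0.
by rewrite Fa// lnM ?posrE.
Qed.

(** The increment of [ln F] between [x] and [x+r] is compared with its increments between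
    [x] and [x+a] here, [x-a] and [x] below, which the recursion gives by [g]. *)
Lemma log_convex_upper (x r : R) : D x -> 0 <= r <= a ->
  a * (ln (F (x + r)) - ln (F x)) <= r * ln (g x).
Proof.
move=> Dx /andP[r0 ra].
have Dxa : D (x + a) by apply: (DS Dx); rewrite lerDl ltW.
have := @cF x (x + r) (x + a) Dx Dxa.
rewrite lerDl r0 lerD2l ra => /(_ isT).
have -> : x + a - x = a by ring.
have -> : x + a - (x + r) = a - r by ring.
have -> : x + r - x = r by ring.
by rewrite log_shift//; lra.
Qed.

Lemma log_convex_lower (x r : R) : D (x - a) -> 0 <= r ->
  r * ln (g (x - a)) <= a * (ln (F (x + r)) - ln (F x)).
Proof.
move=> Dx r0.
have Dxr : D (x + r).
  by apply: (DS Dx); rewrite lerD2l (le_trans _ r0)// oppr_le0 ltW.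
have := @cF (x - a) x (x + r) Dx Dxr.
rewrite lerDl r0 gerBl ltW// => /(_ isT).
have -> : x + r - (x - a) = a + r by ring.
have -> : x + r - x = r by ring.
have -> : x - (x - a) = a by ring.
by have := log_shift Dx; rewrite subrK => ->; lra.
Qed.
End shift.

End log_convexity.

(** * Asymptotics of the Gamma function *)

Section Gamma_asymptotics.
Variable R : realType.
Local Notation mu := (@lebesgue_measure R).

Lemma ppow_interpolate (s t th x : R) : 0 < th < 1 ->
  ppow (th * s + (1 - th) * t) x = ppow s x `^ th * ppow t x `^ (1 - th).
Proof.
move=> /andP[th0 th1]; have [x0|x0] := ltP 0 x.
  by rewrite !ppowE// gt0_powRD// (mulrC th) (mulrC (1 - th)) !powRrM.
by rewrite !ppow_le0// powR0 ?gt_eqF// mul0r.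
Qed.

Lemma Gamma_log_convex : log_convex [set s : R | 0 < s] (@Gamma R).
Proof.
apply: (@interpolation_log_convex R _ (measurableTypeR R) mu [set s : R | 0 < s] (@Gamma R)
  (fun (s : R) (x : R) => ppow (s - 1) x * expR (- x))) => /=.
- by move=> s _; mtac.
- by move=> s x _; rewrite mulr_ge0 ?ppow_ge0 ?expR_ge0.
- by move=> s s0; rewrite EFin_Gamma.
- by move=> s; exact: Gamma_gt0.
- by move=> s t x s0 _ /andP[sx _]; exact: lt_trans sx.
- move=> s t th x _ _ _ th01.
  have -> : th * s + (1 - th) * t - 1 = th * (s - 1) + (1 - th) * (t - 1) by ring.
  rewrite ppow_interpolate// (powRM _ (ppow_ge0 _ _) (expR_ge0 _)) (powRM _ (ppow_ge0 _ _) (expR_ge0 _)).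
  rewrite {1}(_ : expR (- x) = expR (- x) `^ th * expR (- x) `^ (1 - th)); last first.
    by rewrite -gt0_powRD ?expR_gt0// subrKC powRr1// expR_ge0.
  by rewrite mulrACA.
Qed.

Lemma Gamma_ratio_bounds (x r : R) : 1 < x -> 0 <= r <= 1 ->
  r * ln (x - 1) <= ln (Gamma (x + r)) - ln (Gamma x) <= r * ln x.
Proof.
move=> x1 r01; apply/andP; split.
- have := @log_convex_lower R [set s : R | 0 < s] (@Gamma R) id 1 ltr01
    (fun s => @Gamma_gt0 R s) Gamma_log_convex
    (fun s t s0 st => lt_le_trans s0 st) (fun s s0 => GammaS s0) x r.
  by rewrite mul1r; apply; [rewrite /= subr_gt0|case/andP: r01].
- have := @log_convex_upper R [set s : R | 0 < s] (@Gamma R) id 1 ltr01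
    (fun s => @Gamma_gt0 R s) Gamma_log_convex
    (fun s t s0 st => lt_le_trans s0 st) (fun s s0 => GammaS s0) x r.
  by rewrite mul1r; apply => //=; apply: lt_trans x1.
Qed.

Lemma cvg_affine (p c : R) : 0 < c -> p + c * n%:R @[n --> \oo] --> +oo.
Proof.
move=> c0; apply/cvgryPge => A; near=> n.
rewrite -lerBlDl -ler_pdivrMl//; near: n; exact: nbhs_infty_ger.
Unshelve. all: by end_near. Qed.

Lemma cvg_natSM (a : R) : 0 < a -> n.+1%:R * a @[n --> \oo] --> +oo.
Proof.
move=> a0; rewrite (_ : (fun n => _) = fun n => a + a * n%:R); first exact: cvg_affine.
by apply/funext => n; rewrite -natr1; ring.
Qed.

Lemma cvg_ratio_shift (u : nat -> R) (c : R) : u n @[n --> \oo] --> +oo ->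
  (u n + c) / u n @[n --> \oo] --> (1 : R).
Proof.
move=> uoo.
have ui : (u n)^-1 @[n --> \oo] --> (0 : R) by apply/gtr0_cvgV0 => //; near=> n; near: n; exact: cvgry_gt.
have : 1 + c * (u n)^-1 @[n --> \oo] --> (1 + c * 0 : R).
  by apply: cvgD; [exact: cvg_cst|apply: cvgM; [exact: cvg_cst|exact: ui]].
rewrite mulr0 addr0; apply: cvg_trans; apply: near_eq_cvg.
near=> n.
have : u n != 0 by rewrite gt_eqF//; near: n; exact: cvgry_gt.
by move=> un0; field.
Unshelve. all: by end_near. Qed.

Lemma cvg_ln1 (v : nat -> R) : v n @[n --> \oo] --> (1 : R) ->
  ln (v n) @[n --> \oo] --> (0 : R).
Proof.
by move=> v1; rewrite -(@ln1 R); apply: continuous_cvg => //; exact: continuous_ln.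
Qed.

(** For [r <= 1] this is a squeeze by log-convexity; the recursion for Gamma
    reduces larger [r] to that case. *)
Lemma ln_Gamma_ratio_cvg (u : nat -> R) (r : R) : 0 <= r -> u n @[n --> \oo] --> +oo ->
  ln (Gamma (u n + r)) - ln (Gamma (u n)) - r * ln (u n) @[n --> \oo] --> (0 : R).
Proof.
move=> r0 uoo.
have [k] : exists k, r <= k.+1%:R.
  by exists (Num.truncn r); apply/ltW; exact: truncnS_gt.
elim: k r r0 => [|k IH] r r0 rk; last first.
  have [r1|r1] := leP r 1.
    by apply: IH => //; apply: (le_trans r1); rewrite ler1n.
  have r10 : 0 <= r - 1 by rewrite subr_ge0 ltW.
  have {}IH := IH (r - 1) r10.
  have : ln (Gamma (u n + (r - 1))) - ln (Gamma (u n)) - (r - 1) * ln (u n) +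
    ln ((u n + (r - 1)) / u n) @[n --> \oo] --> (0 + 0 : R).
    apply: cvgD; first apply: IH.
      by rewrite lerBlDr natr1.
    by apply: cvg_ln1; exact: cvg_ratio_shift.
  rewrite addr0; apply: cvg_trans; apply: near_eq_cvg; near=> n.
  have un0 : 0 < u n by near: n; exact: cvgry_gt.
  have unr : 0 < u n + (r - 1) by exact: ltr_pwDl.
  have -> : u n + r = u n + (r - 1) + 1 by ring.
  rewrite GammaS// ln_div ?posrE// lnM ?posrE ?Gamma_gt0//.
  by gen; ring.
apply/cvgrPdist_le => /= e e0.
have L : ln ((u n + (- 1)) / u n) @[n --> \oo] --> (0 : R).
  by apply: cvg_ln1; exact: cvg_ratio_shift.
have /cvgrPdist_le/(_ e e0) Le := L.
near=> n.
have un1 : 1 < u n by near: n; exact: cvgry_gt.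
have un0 : 0 < u n by exact: lt_trans un1.
have Len : `|0 - ln ((u n + (- 1)) / u n)| <= e by near: n.
have /andP[lo hi] := @Gamma_ratio_bounds (u n) r un1 (introT andP (conj r0 rk)).
move: Len; rewrite !sub0r !normrN ln_div ?posrE ?subr_gt0// ler_norml => /andP[Len _].
have := scaled_lower r0 rk e0 Len; rewrite mulrBr => rL.
exact: squeeze_norm rL lo hi.
Unshelve. all: by end_near. Qed.

Lemma Gamma_ratio_cvg (u : nat -> R) (r : R) : 0 <= r -> u n @[n --> \oo] --> +oo ->
  Gamma (u n + r) / (Gamma (u n) * u n `^ r) @[n --> \oo] --> (1 : R).
Proof.
move=> r0 uoo; rewrite -(@expR0 R).
have : expR (ln (Gamma (u n + r)) - ln (Gamma (u n)) - r * ln (u n)) @[n --> \oo]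
    --> expR (0 : R).
  apply: continuous_cvg; first exact: continuous_expR.
  exact: ln_Gamma_ratio_cvg.
apply: cvg_trans; apply: near_eq_cvg; near=> n.
have un0 : 0 < u n by near: n; exact: cvgry_gt.
have unr : 0 < u n + r by exact: ltr_pwDl.
have G1 := Gamma_gt0 unr; have G2 := Gamma_gt0 un0.
have u3 : 0 < u n `^ r by exact: powR_gt0.
rewrite -(ln_powR (u n) r) expRB expRB (lnK G1) (lnK G2) (lnK u3).
by rewrite invfM mulrA.
Unshelve. all: by end_near. Qed.

End Gamma_asymptotics.

(** * Functions satisfying the moment recursion *)

Section moment_recursion.
Variables (R : realType) (a alpha : R).
Hypotheses (a0 : 0 < a) (alpha0 : 0 < alpha).

Implicit Types (s r x : R) (n : nat).

Definition ratio s : R := Gamma (s + a + alpha) / Gamma (s + a).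

Lemma ratio_gt0 s : 0 <= s -> 0 < ratio s.
Proof.
move=> s0; have sa : 0 < s + a by exact: ltr_wpDl.
by apply: divr_gt0; apply: Gamma_gt0 => //; exact: addr_gt0.
Qed.

Lemma ratio_cvg : ratio (n%:R * a) / (n.+1%:R * a) `^ alpha @[n --> \oo] --> (1 : R).
Proof.
have uoo := cvg_natSM a0.
have := Gamma_ratio_cvg (ltW alpha0) uoo; apply: cvg_trans; apply: near_eq_cvg.
near=> n; rewrite /ratio.
have -> : n%:R * a + a = n.+1%:R * a by rewrite -natr1; ring.
by rewrite invfM mulrA.
Unshelve. all: by end_near. Qed.

Lemma ratio_bound : exists2 C : R, 0 < C & forall n : nat, ratio (n%:R * a) <= C * (n.+1%:R) `^ alpha.
Proof.
have [M [_ HM]] := cvg_seq_bounded (cvgP _ ratio_cvg).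
have aa : 0 < a `^ alpha by exact: powR_gt0.
exists ((`|M| + 1) * a `^ alpha) => [|n]; first by rewrite mulr_gt0// ltr_wpDl.
have := HM (`|M| + 1) (ltr_pwDr ltr01 (ler_norm _)) n I.
have na : 0 < n.+1%:R * a by rewrite mulr_gt0.
rewrite /= ger0_norm; last first.
  by rewrite divr_ge0 ?powR_ge0// ltW// ratio_gt0// mulr_ge0// ltW.
rewrite ler_pdivrMr ?powR_gt0// powRM ?(ltW a0)// => H; apply: (le_trans H).
by apply: eq_ler; ring.
Qed.

Variable F : R -> R.
(** What is retained of [s |-> E[Y^s]]; log-convexity makes these properties
    characteristic, as in the theorem of Bohr and Mollerup. *)
Definition is_moment_function := [/\ F 0 = 1, (forall s, 0 <= s -> 0 < F s),
  log_convex [set s : R | 0 <= s] F &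
  forall s, 0 <= s -> F (s + a) = ratio s * F s].

End moment_recursion.

Section moment_unique.
Variables (R : realType) (a alpha : R).
Hypotheses (a0 : 0 < a) (alpha0 : 0 < alpha).

Local Opaque ratio.
Implicit Types (s r x : R) (n : nat).

Lemma moment_shift (F G : R -> R) : is_moment_function a alpha F ->
  is_moment_function a alpha G -> forall s (n : nat), 0 <= s ->
  ln (F (s + n%:R * a)) - ln (G (s + n%:R * a)) = ln (F s) - ln (G s).
Proof.
move=> [_ F0 _ Fa] [_ G0 _ Ga] s n s0; elim: n => [|n IH]; first by rewrite mul0r addr0.
have sn : 0 <= s + n%:R * a by rewrite addr_ge0// mulr_ge0// ltW.
have rs := ratio_gt0 a0 alpha0 sn; have Fs := F0 _ sn; have Gs := G0 _ sn.
rewrite -natr1 mulrDl mul1r addrA (Fa _ sn) (Ga _ sn) (lnM rs Fs) (lnM rs Gs) -IH.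
by gen; ring.
Qed.

Lemma moment_function_bounds (F : R -> R) : is_moment_function a alpha F ->
  forall r (n : nat), 0 <= r <= a ->
  r * ln (ratio a alpha (n%:R * a)) <=
    a * (ln (F (r + n.+1%:R * a)) - ln (F (n.+1%:R * a)))
    <= r * ln (ratio a alpha (n.+1%:R * a)).
Proof.
move=> [_ F0 cF Fa] r n /andP[r0 ra].
have na : 0 <= n%:R * a by rewrite mulr_ge0// ltW.
have na1 : 0 <= n.+1%:R * a by rewrite mulr_ge0// ltW.
have DS (s t : R) : [set s : R | 0 <= s] s -> s <= t -> [set s : R | 0 <= s] t.
  by move=> /= s0; exact: le_trans.
rewrite (addrC r); apply/andP; split.
- have := @log_convex_lower R _ F (ratio a alpha) a a0 F0 cF DS Fa (n.+1%:R * a) r.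
  have -> : n.+1%:R * a - a = n%:R * a by rewrite -natr1; ring.
  exact.
- apply: (@log_convex_upper R _ F (ratio a alpha) a a0 F0 cF DS Fa (n.+1%:R * a) r) => //.
  by rewrite r0.
Qed.

(** For [0 <= r <= a] the difference [D] of the logarithms at [r] equals the one at
    [r + (n+1) a], where log-convexity encloses both logarithms in the same interval.
    Its length [e n] tends to 0 because [ratio] has power growth. *)
Lemma moment_function_unique (F G : R -> R) : is_moment_function a alpha F ->
  is_moment_function a alpha G -> forall s, 0 <= s -> F s = G s.
Proof.
move=> mF mG.
have base r : 0 <= r <= a -> F r = G r.
  move=> ra; have /andP[r0 _] := ra.
  have [F00 F0 _ _] := mF; have [G00 G0 _ _] := mG.
  apply: ln_inj; rewrite ?posrE ?F0 ?G0//; apply/eqP; rewrite -subr_eq0; apply/eqP.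
  set D := ln (F r) - ln (G r).
  pose e n := r / a * (ln (ratio a alpha (n.+1%:R * a)) - ln (ratio a alpha (n%:R * a))).
  have De n : `|D| <= e n.
    have Dn : D = ln (F (r + n.+1%:R * a)) - ln (G (r + n.+1%:R * a)) by rewrite moment_shift.
    have E0 : ln (F (n.+1%:R * a)) = ln (G (n.+1%:R * a)).
      apply/eqP; rewrite -subr_eq0 -[n.+1%:R * a]add0r moment_shift//.
      by rewrite F00 G00 subrr.
    have /andP[f1 f2] := moment_function_bounds mF n ra.
    have /andP[g1 g2] := moment_function_bounds mG n ra.
    rewrite Dn /e -(ler_pM2l a0) -{1}(gtr0_norm a0) -normrM.
    have -> : a * (r / a * (ln (ratio a alpha (n.+1%:R * a)) - ln (ratio a alpha (n%:R * a)))) =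
      r * ln (ratio a alpha (n.+1%:R * a)) - r * ln (ratio a alpha (n%:R * a)).
      by gen; field; rewrite gt_eqF.
    move: f1 f2 g1 g2; rewrite E0 ler_norml !mulrBr => f1 f2 g1 g2.
    exact: two_sided_diff f1 f2 g1 g2.
  have e0 : e n @[n --> \oo] --> (0 : R).
    rewrite -(mulr0 (r / a)); apply: cvgM; first exact: cvg_cst.
    pose l (n : nat) : R := ln (ratio a alpha (n%:R * a) / (n.+1%:R * a) `^ alpha).
    have l0 : l n @[n --> \oo] --> (0 : R) by apply: cvg_ln1; exact: ratio_cvg.
    have l1 : l n.+1 @[n --> \oo] --> (0 : R) by rewrite (cvg_shiftS l).
    pose q (n : nat) : R := ln ((n.+1%:R * a + a) / (n.+1%:R * a)).
    have q0 : q n @[n --> \oo] --> (0 : R).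
      apply: cvg_ln1; apply: cvg_ratio_shift; exact: cvg_natSM.
    have : l n.+1 - l n + alpha * q n @[n --> \oo] --> (0 - 0 + alpha * 0 : R).
      by apply: cvgD; [apply: cvgB => //|apply: cvgM => //; exact: cvg_cst].
    rewrite subrr mulr0 addr0; apply: cvg_trans; apply: near_eq_cvg; near=> n.
    have nn k : 0 < k.+1%:R * a by rewrite mulr_gt0.
    have n0 k : 0 <= k%:R * a by rewrite mulr_ge0// ltW.
    have p1 := powR_gt0 alpha (nn n); have p2 := powR_gt0 alpha (nn n.+1).
    have g1 := ratio_gt0 a0 alpha0 (n0 n); have g2 := ratio_gt0 a0 alpha0 (n0 n.+1).
    rewrite /l /q; have -> : n.+1%:R * a + a = n.+2%:R * a by rewrite -(natr1 n.+1); ring.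
    rewrite (ln_div g1 p1) (ln_div g2 p2) (ln_div (nn n.+1) (nn n)) !ln_powR.
    by gen; ring.
  apply/eqP; rewrite -normr_eq0 eq_le normr_ge0 andbT.
  have L : (fun _ : nat => `|D|) @ \oo --> `|D| by exact: cvg_cst.
  by apply: (ler_cvg_to L e0); exact: nearW.
have step (n : nat) : forall s, 0 <= s <= n.+1%:R * a -> F s = G s.
  elim: n => [|n IH] s /andP[s0 sn]; first by apply: base; rewrite s0 -[a]mul1r.
  have [sa|sa] := leP s a; first by apply: base; rewrite s0.
  have sa0 : 0 <= s - a by rewrite subr_ge0 ltW.
  have [_ _ _ Fa] := mF; have [_ _ _ Ga] := mG.
  rewrite -[s](subrK a) Fa// Ga// IH// sa0/= lerBlDr (le_trans sn)//.
  by rewrite -(natr1 n.+1) mulrDl mul1r.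
move=> s s0; apply: (step (Num.truncn (s / a))); rewrite s0/=.
by rewrite -ler_pdivrMr//; apply/ltW; exact: truncnS_gt.
Unshelve. all: by end_near. Qed.

Lemma moment_growth (F : R -> R) : is_moment_function a alpha F ->
  exists2 C : R, 0 < C & forall n : nat, F (n%:R * a) <= C ^+ n * (n`!%:R) `^ alpha.
Proof.
move=> [F00 F0 _ Fa]; have [C C0 HC] := ratio_bound a0 alpha0; exists C => //.
elim => [|n IH]; first by rewrite mul0r F00 expr0 fact0 powR1 mulr1.
have n0 : 0 <= n%:R * a by rewrite mulr_ge0// ltW.
rewrite -natr1 mulrDl mul1r Fa// factS natrM powRM// exprS.
apply: (@le_trans _ _ ((C * n.+1%:R `^ alpha) * (C ^+ n * n`!%:R `^ alpha))).
  by apply: ler_pM => //; rewrite ltW// ?(ratio_gt0 a0 alpha0)// F0.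
by apply: eq_ler; ring.
Qed.

End moment_unique.

(** * Determinacy by moments of factorial growth *)

Section exp_remainder.
Variable R : realType.
Implicit Types (x : R) (K : nat).

Fixpoint texp K x : R := if K is K'.+1 then texp K' x + (- x) ^+ K' / K'`!%:R else 0.

Lemma fact_cancel K x : K.+1%:R^-1 / K`!%:R * (K.+1%:R * x) = x / K`!%:R.
Proof. by rewrite mulrACA mulVf ?pnatr_eq0// mul1r mulrC. Qed.

Lemma is_derive_texp K x : is_derive x 1 (texp K.+1) (- texp K x).
Proof.
elim: K => [|K IH].
  have -> : texp 1 = cst 1.
    by apply/funext => y; rewrite /= add0r expr0 fact0 divr1.
  by rewrite oppr0; exact: is_derive_cst.
have -> : texp K.+2 = texp K.+1 + (K.+1`!%:R^-1 *: (fun y => (- y) ^+ K.+1)).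
  by apply/funext => y; congr (_ + _); exact: mulrC.
have H : is_derive x 1 (fun y : R => (- y) ^+ K.+1) (- (K.+1%:R * (- x) ^+ K)).
  have := @is_deriveX R R (-%R) K.+1 x 1 (- 1) _.
  have -> : (-%R : R -> R) ^+ K.+1 = (fun y => (- y) ^+ K.+1).
    by apply/funext => y; rewrite fctE.
  by move=> H; apply: (is_derive_eq (H _)); rewrite /GRing.scale/= mulrN1 mulr_natl.
have := is_deriveD (IH) (is_deriveZ K.+1`!%:R^-1 H).
move=> H2; apply: is_derive_eq H2 _.
rewrite /= opprD; congr (_ + _); rewrite /GRing.scale/= factS natrM invfM mulrN; congr (- _).
exact: fact_cancel.
Qed.

(** The signed Taylor remainder of [exp(-x)]: each one is the primitive of the
    preceding one, so all of them are non-negative and [rexp_bound] follows by induction. *)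
Definition rexp K x : R := (-1) ^+ K * (expR (- x) - texp K x).

Lemma is_derive_rexp K x : is_derive x 1 (rexp K.+1) (rexp K x).
Proof.
have -> : rexp K.+1 = (-1) ^+ K.+1 *: ((fun y => expR (- y)) - texp K.+1).
  by apply/funext => y; rewrite /rexp.
have H : is_derive x 1 (fun y : R => expR (- y)) (- expR (- x)).
  have := @is_derive1_comp R expR (-%R) x (expR (- x)) (- 1) _ _.
  by move=> H; apply: is_derive_eq; rewrite /= ?mulrN1.
have := is_deriveZ ((-1) ^+ K.+1) (is_deriveB H (is_derive_texp K x)).
move=> H2; apply: is_derive_eq H2 _.
by rewrite /rexp /GRing.scale/= exprS; ring.
Qed.

Lemma ge0_of_is_derive (f df : R -> R) x : 0 <= x -> f 0 = 0 ->
  (forall y : R, is_derive y 1 f (df y)) -> (forall y, 0 <= y -> 0 <= df y) -> 0 <= f x.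
Proof.
move=> x0 f00 fdf df0.
have [|c] := @MVT_segment R f df 0 x x0.
- apply: derivable_within_continuous => z _; by have [] := fdf z.
- by rewrite f00 !subr0 in_itv/= => /andP[c0 _] ->; rewrite mulr_ge0// df0.
Qed.

Lemma is_derive_pow K x :
  is_derive x 1 (fun y : R => y ^+ K.+1 / K.+1`!%:R) (x ^+ K / K`!%:R).
Proof.
have -> : (fun y : R => y ^+ K.+1 / K.+1`!%:R) = K.+1`!%:R^-1 *: (fun y => y ^+ K.+1).
  by apply/funext => y; rewrite /GRing.scale/= mulrC.
have := @is_deriveX R R id K.+1 x 1 1 _.
have -> : (id : R -> R) ^+ K.+1 = (fun y => y ^+ K.+1).
  by apply/funext => y; rewrite fctE.
move=> H; have := is_deriveZ K.+1`!%:R^-1 (H _).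
move=> H2; apply: is_derive_eq (H2 _) _.
rewrite /GRing.scale/= factS natrM invfM mulr1.
exact: fact_cancel.
Qed.

Lemma texpS0 K : texp K.+1 0 = 1.
Proof.
elim: K => [|K IH]; first by rewrite /= add0r expr0 fact0 divr1.
by rewrite /= in IH *; rewrite IH oppr0 expr0n/= mul0r addr0.
Qed.

Lemma rexp_bound K x : 0 <= x -> 0 <= rexp K x <= x ^+ K / K`!%:R.
Proof.
elim: K x => [|K IH] x x0.
  rewrite /rexp expr0 fact0 divr1 mul1r /= subr0 expR_ge0/= expR_le1.
  by rewrite oppr_le0.
have r0 : rexp K.+1 0 = 0 by rewrite /rexp texpS0 oppr0 expR0 subrr mulr0.
apply/andP; split.
  apply: (ge0_of_is_derive x0 r0 (is_derive_rexp K)) => y y0.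
  by have /andP[] := IH y y0.
rewrite -subr_ge0.
pose f (y : R) := y ^+ K.+1 / K.+1`!%:R - rexp K.+1 y.
apply: (@ge0_of_is_derive f (fun y => y ^+ K / K`!%:R - rexp K y) x x0).
- by rewrite /f r0 subr0 expr0n/= mul0r.
- by move=> y; apply: is_deriveB; [exact: is_derive_pow|exact: is_derive_rexp].
- by move=> y y0; rewrite subr_ge0; have /andP[] := IH y y0.
Qed.

Lemma expR_taylor K x : 0 <= x -> `|expR (- x) - texp K x| <= x ^+ K / K`!%:R.
Proof.
move=> x0; have /andP[r0 r1] := rexp_bound K x0.
have -> : expR (- x) - texp K x = (-1) ^+ K * rexp K x.
  by rewrite /rexp mulrA -expr2 sqrr_sign mul1r.
by rewrite normrM normrX normrN1 expr1n mul1r ger0_norm.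
Qed.

Lemma pow_le_expR K x : 0 <= x -> x ^+ K / K`!%:R <= expR x.
Proof.
case: K => [|K] x0; first by rewrite expr0 fact0 divr1 -(@expR0 R) ler_expR.
by apply: le_trans (expR_ge1Dxn K x0); rewrite lerDr.
Qed.

End exp_remainder.

Section factorial_bounds.

Lemma fact_mul_le i k : (i`! * k`! <= (i + k)`!)%N.
Proof.
rewrite -(@bin_fact (i + k) i) ?leq_addr// addKn leq_pmull//.
by rewrite bin_gt0 leq_addr.
Qed.

Lemma fact_exp_le n j : (n`! ^ j <= (j * n)`!)%N.
Proof.
elim: j => [|j IH]; first by rewrite expn0 mul0n.
rewrite expnS mulSn; apply: leq_trans (fact_mul_le _ _).
by rewrite leq_mul2l IH orbT.
Qed.

Lemma bin_le_exp2 n i : ('C(n, i) <= 2 ^ n)%N.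
Proof.
elim: n i => [|n IH] [|i]; rewrite ?bin0 ?bin0n ?expn_gt0//.
by rewrite binS expnS mul2n -addnn leq_add.
Qed.

Lemma fact_add_le k j : ((k + j)`! <= 2 ^ (k + j) * (k`! * j`!))%N.
Proof.
rewrite -(@bin_fact (k + j) k) ?leq_addr// addKn leq_mul2r bin_le_exp2 orbT//.
Qed.

End factorial_bounds.

Section laplace.
Context d (T : measurableType d) (R : realType).
Variables (w : T -> R).
Hypotheses (mw : measurable_fun setT w) (w0 : forall x, 0 <= w x).
Implicit Types (mu nu : {measure set T -> \bar R}) (i k K n : nat) (l h : R).

(** Up to sign, the i-th derivative at [l] of the Laplace transform of [w]. *)
Definition wint mu i l : R := \int[mu]_x (w x ^+ i * expR (- (l * w x))).

Definition finite_moments mu := forall i, (\int[mu]_x (w x ^+ i)%:E < +oo)%E.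

Lemma measurable_wint i l : measurable_fun setT (fun x => w x ^+ i * expR (- (l * w x))).
Proof.
apply: measurable_funM; first exact: measurable_funX.
by apply: measurable_expRT; apply: measurable_oppT; exact: measurable_funM.
Qed.

Lemma wint_ge0 mu i l : 0 <= wint mu i l.
Proof.
by apply: Rintegral_ge0 => x _; rewrite mulr_ge0 ?expR_ge0// exprn_ge0.
Qed.

Lemma exp_le1 l x : 0 <= l -> expR (- (l * w x)) <= 1.
Proof. by move=> l0; rewrite expR_le1 oppr_le0 mulr_ge0. Qed.

Lemma integrable_le mu (f : T -> R) i : finite_moments mu -> measurable_fun setT f ->
  (forall x, `|f x| <= w x ^+ i) -> mu.-integrable setT (EFin \o f).
Proof.
move=> fm mf fw; apply/integrableP; split; first exact/measurable_EFinP.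
apply: le_lt_trans (fm i); apply: ge0_le_integral => //.
- by apply: measurableT_comp => //; exact/measurable_EFinP.
- by apply/measurable_EFinP; exact: measurable_funX.
- by move=> x _; rewrite lee_fin.
Qed.

Lemma integrable_wint mu i l : finite_moments mu -> 0 <= l ->
  mu.-integrable setT (fun x => (w x ^+ i * expR (- (l * w x)))%:E).
Proof.
move=> fm l0; apply: (@integrable_le mu _ i) => //; first exact: measurable_wint.
move=> x; rewrite ger0_norm; last by rewrite mulr_ge0 ?expR_ge0// exprn_ge0.
by rewrite ler_piMr ?exprn_ge0// exp_le1.
Qed.

Lemma integrable_scale mu (c : R) (f : T -> R) :
  mu.-integrable setT (fun x => (f x)%:E) ->
  mu.-integrable setT (fun x => (c * f x)%:E).
Proof. by move=> mf; under eq_fun do rewrite EFinM; exact: integrableZl. Qed.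

Lemma integrable_sub mu (f g : T -> R) :
  mu.-integrable setT (fun x => (f x)%:E) -> mu.-integrable setT (fun x => (g x)%:E) ->
  mu.-integrable setT (fun x => (f x - g x)%:E).
Proof. by move=> mf mg; under eq_fun do rewrite EFinB; exact: integrableB. Qed.

Lemma wint_taylor_sum mu i K l h : finite_moments mu -> 0 <= l ->
  mu.-integrable setT
    (fun x => (w x ^+ i * expR (- (l * w x)) * texp K (h * w x))%:E) /\
  \int[mu]_x (w x ^+ i * expR (- (l * w x)) * texp K (h * w x)) =
  \sum_(k < K) (- h) ^+ k / k`!%:R * wint mu (i + k) l.
Proof.
move=> fm l0; elim: K => [|K [IH1 IH2]].
  rewrite big_ord0; split.
    by under eq_fun do rewrite /= mulr0; exact: integrable0.
  under eq_Rintegral do rewrite /= mulr0.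
  by rewrite Rintegral_cst// mul0r.
have E x : w x ^+ i * expR (- (l * w x)) * texp K.+1 (h * w x) =
   w x ^+ i * expR (- (l * w x)) * texp K (h * w x) +
   (- h) ^+ K / K`!%:R * (w x ^+ (i + K) * expR (- (l * w x))).
  have N : - (h * w x) = - h * w x by rewrite mulNr.
  by rewrite /= mulrDr N exprMn exprD; gen; ring.
have I2 : mu.-integrable setT (fun x => ((- h) ^+ K / K`!%:R * (w x ^+ (i + K) * expR (- (l * w x))))%:E).
  by apply: integrable_scale; exact: integrable_wint.
split.
  under eq_fun do rewrite E EFinD.
  exact: integrableD.
under eq_Rintegral do rewrite E.
rewrite RintegralD// IH2 big_ord_recr/=; congr (_ + _).
by rewrite RintegralZl//; exact: integrable_wint.
Qed.

Lemma wint_taylor mu i K l h : finite_moments mu -> 0 <= l -> 0 <= h ->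
  `|wint mu i (l + h) - \sum_(k < K) (- h) ^+ k / k`!%:R * wint mu (i + k) l|
    <= h ^+ K / K`!%:R * wint mu (i + K) l.
Proof.
move=> fm l0 h0; have [I1 <-] := wint_taylor_sum i K h fm l0.
have lh : 0 <= l + h by rewrite addr_ge0.
rewrite /wint -RintegralB//; last exact: integrable_wint.
have I2 : mu.-integrable setT (EFin \o (fun x => w x ^+ i * expR (- ((l + h) * w x)) -
    w x ^+ i * expR (- (l * w x)) * texp K (h * w x))).
  by apply: integrable_sub => //; exact: integrable_wint.
apply: (le_trans (le_normr_Rintegral measurableT I2)).
rewrite -RintegralZl//; last exact: integrable_wint.
apply: le_Rintegral => //.
- exact: integrable_norm.
- by apply: integrable_scale; exact: integrable_wint.
move=> x _.
have -> : w x ^+ i * expR (- ((l + h) * w x)) - w x ^+ i * expR (- (l * w x)) * texp K (h * w x)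
   = w x ^+ i * expR (- (l * w x)) * (expR (- (h * w x)) - texp K (h * w x)).
  rewrite (_ : - ((l + h) * w x) = - (l * w x) + - (h * w x)); last by ring.
  by rewrite expRD mulrBr mulrA.
have hw : 0 <= h * w x by rewrite mulr_ge0.
have W0 : 0 <= w x ^+ i * expR (- (l * w x)) by rewrite mulr_ge0 ?expR_ge0// exprn_ge0.
rewrite normrM (ger0_norm W0).
apply: le_trans (ler_wpM2l W0 (expR_taylor K hw)) _.
by apply: eq_ler; rewrite exprMn exprD; gen; ring.
Qed.

(** The two Laplace transforms have the same jet at [l]. *)
Definition agree mu nu l := forall i, wint mu i l = wint nu i l.

(** Taylor expansions at [l] with the same coefficients; the condition says that the
    remainders tend to 0. *)
Lemma agree_step mu nu l h : finite_moments mu -> finite_moments nu ->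
  0 <= l -> 0 <= h -> agree mu nu l ->
  (forall i, h ^+ K / K`!%:R * wint mu (i + K) l @[K --> \oo] --> (0 : R)) ->
  agree mu nu (l + h).
Proof.
move=> fm fn l0 h0 ag c i; apply/eqP; rewrite -subr_eq0 -normr_eq0 eq_le normr_ge0 andbT.
set D := `|_|.
have L : (fun _ : nat => D) @ \oo --> D by exact: cvg_cst.
have L2 : 2 * (h ^+ K / K`!%:R * wint mu (i + K) l) @[K --> \oo] --> (0 : R).
  by rewrite -[X in _ --> X](mulr0 2); apply: cvgM; [exact: cvg_cst|exact: c].
apply: (ler_cvg_to L L2); apply: nearW => K.
have t1 := wint_taylor i K fm l0 h0; have t2 := wint_taylor i K fn l0 h0.
move: t2; rewrite -ag; under eq_bigr do rewrite -ag.
move: t1; rewrite /D; set S := \sum_(_ < _) _; set e := _ * wint mu _ _.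
rewrite distrC => t1; rewrite distrC => t2.
have -> : wint mu i (l + h) - wint nu i (l + h) = (S - wint nu i (l + h)) - (S - wint mu i (l + h)) by ring.
by rewrite mulr_natl mulr2n; apply: (le_trans (ler_normB _ _)); rewrite lerD.
Qed.

Lemma agree_from_moments mu nu (C0 C h : R) :
  finite_moments mu -> finite_moments nu -> 0 < C0 -> 0 < C -> 0 <= h -> 2 * (C * h) < 1 ->
  (forall k, wint mu k 0 <= C0 * (C ^+ k * k`!%:R)) ->
  agree mu nu 0 -> agree mu nu h.
Proof.
move=> fm fn C00 C_0 h0 Ch1 bd ag; rewrite -[h]add0r; apply: agree_step => // i.
set q := 2 * (C * h).
have q0 : 0 <= q by rewrite !mulr_ge0// ltW.
pose B := C0 * (2 * C) ^+ i * i`!%:R.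
have L : B * q ^+ K @[K --> \oo] --> (0 : R).
  rewrite -[X in _ --> X](mulr0 B); apply: cvgM; first exact: cvg_cst.
  by apply: cvg_expr; rewrite ger0_norm.
apply: (squeeze_cvgr _ (cvg_cst 0) L); apply: nearW => K; apply/andP; split.
  by rewrite mulr_ge0 ?wint_ge0// divr_ge0// exprn_ge0.
have hK : 0 <= h ^+ K / K`!%:R by rewrite divr_ge0// exprn_ge0.
apply: le_trans (ler_wpM2l hK (bd _)) _.
have F : ((i + K)`!%:R : R) <= 2 ^+ (i + K) * (i`!%:R * K`!%:R).
  by rewrite -natrX -!natrM ler_nat fact_add_le.
have CC : 0 <= C0 * C ^+ (i + K) by rewrite mulr_ge0 ?exprn_ge0// ltW.
apply: (@le_trans _ _ (h ^+ K / K`!%:R * (C0 * C ^+ (i + K) * (2 ^+ (i + K) * (i`!%:R * K`!%:R))))).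
  by apply: ler_wpM2l => //; rewrite mulrA; exact: ler_wpM2l.
apply: eq_ler; rewrite /B /q !exprMn !exprD.
by field; rewrite pnatr_eq0 -lt0n fact_gt0.
Qed.

(** Away from 0 the step may be half of the distance to 0, whatever the moments, since
    [(l w)^K / K! <= exp(l w)] bounds the remainder by [2^(-K)] times
    the i-th moment. *)
Lemma agree_extend mu nu l h : finite_moments mu -> finite_moments nu ->
  0 < l -> 0 <= h -> 2 * h <= l -> agree mu nu l -> agree mu nu (l + h).
Proof.
move=> fm fn l0 h0 hl ag; have l0' := ltW l0; apply: agree_step => // i.
have L : (2^-1) ^+ K * wint mu i 0 @[K --> \oo] --> (0 : R).
  rewrite -[X in _ --> X](mul0r (wint mu i 0)); apply: cvgM; last exact: cvg_cst.
  by apply: cvg_expr; rewrite ger0_norm// invf_lt1// ltr1n.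
apply: (squeeze_cvgr _ (cvg_cst 0) L); apply: nearW => K; apply/andP; split.
  by rewrite mulr_ge0 ?wint_ge0// divr_ge0// exprn_ge0.
rewrite /wint -!RintegralZl//; last 2 first.
- exact: integrable_wint.
- exact: integrable_wint.
apply: le_Rintegral => //.
- by apply: integrable_scale; exact: integrable_wint.
- by apply: integrable_scale; exact: integrable_wint.
move=> x _; rewrite mul0r oppr0 expR0 mulr1 exprD.
have lw : 0 <= l * w x by rewrite mulr_ge0.
have wi : 0 <= w x ^+ i by rewrite exprn_ge0.
have := pow_le_expR K lw; rewrite -(ler_pM2r (expR_gt0 (- (l * w x)))) -expRD subrr expR0 => H.
have hl' : h <= 2^-1 * l by rewrite ler_pdivlMl.
have hK : h ^+ K <= (2^-1) ^+ K * l ^+ K.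
  by rewrite -exprMn; apply: lerXn2r => //; rewrite nnegrE// mulr_ge0.
have A0 : 0 <= w x ^+ i * w x ^+ K * expR (- (l * w x)) / K`!%:R.
  by rewrite divr_ge0// !mulr_ge0 ?expR_ge0// exprn_ge0.
apply: (@le_trans _ _ ((2^-1) ^+ K * l ^+ K * (w x ^+ i * w x ^+ K * expR (- (l * w x)) / K`!%:R))).
  by rewrite mulrAC -mulrA; apply: ler_wpM2r.
apply: (@le_trans _ _ ((2^-1) ^+ K * w x ^+ i * ((l * w x) ^+ K / K`!%:R * expR (- (l * w x))))).
  by apply: eq_ler; rewrite exprMn; gen; ring.
by apply: ler_piMr => //; rewrite mulr_ge0// exprn_ge0.
Qed.

Lemma agree_bounded mu nu h : finite_moments mu -> finite_moments nu ->
  (forall x, w x <= 1) -> 0 <= h -> agree mu nu 0 -> agree mu nu h.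
Proof.
move=> fm fn w1 h0 ag; rewrite -[h]add0r; apply: agree_step => // i.
have L : h ^+ K / K`!%:R * wint mu 0 0 @[K --> \oo] --> (0 : R).
  rewrite -[X in _ --> X](mul0r (wint mu 0 0)); apply: cvgM; last exact: cvg_cst.
  have := cvg_series_cvg_0 (@is_cvg_series_exp_coeff R h).
  by rewrite /exp_coeff.
apply: (squeeze_cvgr _ (cvg_cst 0) L); apply: nearW => K; apply/andP; split.
  by rewrite mulr_ge0 ?wint_ge0// divr_ge0// exprn_ge0.
apply: ler_wpM2l; first by rewrite divr_ge0// exprn_ge0.
apply: le_Rintegral => //.
- exact: integrable_wint.
- exact: integrable_wint.
by move=> x _; rewrite ler_wpM2r ?expR_ge0// expr0 exprn_ile1.
Qed.

End laplace.

Section bounded_convergence.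
Context d (T : measurableType d) (R : realType) (m : {measure set T -> \bar R}).
Hypothesis m1 : (m setT = 1)%E.

Lemma bounded_convergence (f_ : nat -> T -> R) (f : T -> R) :
  (forall n, measurable_fun setT (f_ n)) -> measurable_fun setT f ->
  (forall n x, 0 <= f_ n x <= 1) -> (forall x, f_ n x @[n --> \oo] --> f x) ->
  (\int[m]_x (f_ n x)%:E @[n --> \oo] --> \int[m]_x (f x)%:E)%E.
Proof.
move=> mf_ mf f01 cf.
have [//|||||_ _ +] := @dominated_convergence _ T R m setT measurableT
  (fun n x => (f_ n x)%:E) (fun x => (f x)%:E) (cst 1%E).
- by move=> n; apply/measurable_EFinP.
- exact/measurable_EFinP.
- by apply: aeW => x _; apply: cvg_EFin; [exact: nearW|exact: cf].
- apply/integrableP; split; first exact: measurable_cst.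
  by under eq_integral do rewrite /= normr1; rewrite integral_cst// m1 mule1 ltry.
- by apply: aeW => x n _; rewrite lee_fin ger0_norm; case/andP: (f01 n x).
by [].
Qed.

Lemma bounded_finite_moments (u : T -> R) :
  measurable_fun setT u -> (forall x, 0 <= u x <= 1) -> finite_moments u m.
Proof.
move=> mu_ u01 i; apply: (@le_lt_trans _ _ (\int[m]_x 1%:E)%E).
  apply: ge0_le_integral => //.
  - by move=> x _; rewrite lee_fin exprn_ge0//; case/andP: (u01 x).
  - by apply/measurable_EFinP; exact: measurable_funX.
  - by move=> x _; rewrite lee_fin; case/andP: (u01 x) => *; rewrite exprn_ile1.
by rewrite integral_cst// m1 mule1 ltry.
Qed.

End bounded_convergence.

Section determinacy.
Context d (T : measurableType d) (R : realType).
Variables (mu nu : {measure set T -> \bar R}).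
Hypotheses (mu1 : (mu setT = 1)%E) (nu1 : (nu setT = 1)%E).
Implicit Types (i k K n : nat) (l h x : R).

(** For [u >= 0], the pointwise limit of [exp(-(u/x)^N)]. *)
Definition softstep (x u : R) : R := if u < x then 1 else if u == x then expR (- 1) else 0.

Lemma softstep01 x u : 0 <= softstep x u <= 1.
Proof.
rewrite /softstep; case: ifP => _; first by rewrite ler01 lexx.
by case: ifP => _; rewrite ?lexx ?ler01// expR_ge0/= expR_le1 lerN10.
Qed.

Lemma measurable_softstep x (u : T -> R) : measurable_fun setT u ->
  measurable_fun setT (fun t => softstep x (u t)).
Proof.
move=> mu_; apply: measurable_fun_ifT => //; first exact: measurable_fun_ltr.
apply: measurable_fun_ifT => //; exact: measurable_fun_eqr.
Qed.

Lemma expR_pow_cvg (u x : R) : 0 <= u -> 0 < x ->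
  expR (- (x^-1 ^+ N.+1 * u ^+ N.+1)) @[N --> \oo] --> softstep x u.
Proof.
move=> u0 x0; have E N : x^-1 ^+ N.+1 * u ^+ N.+1 = (u / x) ^+ N.+1 by rewrite exprMn mulrC.
under eq_fun do rewrite E.
have ux0 : 0 <= u / x by rewrite divr_ge0// ltW.
rewrite /softstep; case: ltP => [ux|]; last rewrite le_eqVlt => /orP[/eqP xu|xu].
- have : expR (- (u / x) ^+ N.+1) @[N --> \oo] --> expR (- 0 : R).
    apply: continuous_cvg; first exact: continuous_expR.
    apply: cvgN; rewrite (cvg_shiftS (fun N => (u / x) ^+ N)).
    by apply: cvg_expr; rewrite ger0_norm// ltr_pdivrMr// mul1r.
  by rewrite oppr0 expR0.
- rewrite xu eqxx divff -?xu ?gt_eqF//.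
  by under eq_fun do rewrite expr1n; exact: cvg_cst.
- rewrite gt_eqF//.
  have q0 : 0 < u / x by rewrite divr_gt0// (lt_trans x0).
  have L : (u / x)^-1 ^+ N.+1 @[N --> \oo] --> (0 : R).
    rewrite (cvg_shiftS (fun N => (u / x)^-1 ^+ N)); apply: cvg_expr.
    by rewrite ger0_norm ?invr_ge0// invf_lt1// ltr_pdivlMr// mul1r.
  apply: (squeeze_cvgr _ (cvg_cst 0) L); apply: nearW => N; rewrite expR_ge0/=.
  rewrite exprVn expRN lef_pV2 ?posrE ?expR_gt0 ?exprn_gt0//.
  by apply: le_trans (expR_ge1Dx _); rewrite lerDr.
Qed.

(** The expectations of [exp(-(u/x)^N)] depend on the moments only, as [u^N] is
    bounded.  Letting [N] tend to infinity gives those of [softstep x u], and letting [x]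
    increase gives the probabilities of the events [u < x]. *)
Lemma bounded_determinacy (u : T -> R) : measurable_fun setT u ->
  (forall t, 0 <= u t <= 1) ->
  (forall n, (\int[mu]_t (u t ^+ n)%:E = \int[nu]_t (u t ^+ n)%:E)%E) ->
  forall x, 0 < x -> mu [set t | u t < x] = nu [set t | u t < x].
Proof.
move=> mu_ u01 mom.
have fm := bounded_finite_moments mu1 mu_ u01.
have fn := bounded_finite_moments nu1 mu_ u01.
have u0 t : 0 <= u t by case/andP: (u01 t).
have S x : 0 < x -> (\int[mu]_t (softstep x (u t))%:E = \int[nu]_t (softstep x (u t))%:E)%E.
  move=> x0.
  have H (m : {measure set T -> \bar R}) : (m setT = 1)%E ->
    (\int[m]_t (expR (- (x^-1 ^+ N.+1 * u t ^+ N.+1)))%:E @[N --> \oo] -->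
      \int[m]_t (softstep x (u t))%:E)%E.
    move=> m1; apply: bounded_convergence => //.
    - move=> N; apply: measurable_expRT; apply: measurable_oppT.
      by apply: measurable_funM => //; exact: measurable_funX.
    - exact: measurable_softstep.
    - move=> N t; rewrite expR_ge0/= expR_le1 oppr_le0 mulr_ge0 ?exprn_ge0// invr_ge0 ltW//.
    - by move=> t; exact: expR_pow_cvg.
  have E N : (\int[mu]_t (expR (- (x^-1 ^+ N.+1 * u t ^+ N.+1)))%:E =
      \int[nu]_t (expR (- (x^-1 ^+ N.+1 * u t ^+ N.+1)))%:E)%E.
    pose w t := u t ^+ N.+1.
    have mw : measurable_fun setT w by exact: measurable_funX.
    have w0 t : 0 <= w t by rewrite exprn_ge0.
    have w1 t : w t <= 1 by rewrite exprn_ile1//; case/andP: (u01 t).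
    have fw : finite_moments w mu by apply: bounded_finite_moments => // t; rewrite w0 w1.
    have fw' : finite_moments w nu by apply: bounded_finite_moments => // t; rewrite w0 w1.
    have h0 : 0 <= x^-1 ^+ N.+1 by rewrite exprn_ge0// invr_ge0 ltW.
    have := agree_bounded mw w0 fw fw' w1 h0 _ 0%N.
    rewrite /wint => H2.
    have I (m : {measure set T -> \bar R}) : finite_moments w m ->
        ((\int[m]_t (w t ^+ 0 * expR (- (x^-1 ^+ N.+1 * w t))))%:E =
        \int[m]_t (expR (- (x^-1 ^+ N.+1 * u t ^+ N.+1)))%:E)%E.
      move=> fwm; rewrite /Rintegral fineK; last first.
        by apply: integrable_fin_num => //; exact: integrable_wint.
      by apply: eq_integral => t _; rewrite expr0 mul1r.
    rewrite -I// -[RHS]I//; congr EFin; apply: H2 => i; rewrite /wint /Rintegral; congr fine.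
    under eq_integral do rewrite mul0r oppr0 expR0 mulr1 -exprM.
    by under [RHS]eq_integral do rewrite mul0r oppr0 expR0 mulr1 -exprM.
  have L1 := H _ mu1; have L2 := H _ nu1; apply: (cvg_unique _ L1) => //.
  by move: L2; under eq_fun do rewrite -E.
move=> x x0.
(* softstep increases to the indicator of u < x along thresholds strictly below x *)
pose xk k : R := x * (k.+1%:R / k.+2%:R).
have kk k : k.+1%:R / k.+2%:R < 1 :> R by rewrite ltr_pdivrMr// mul1r ltr_nat.
have xk0 k : 0 < xk k by rewrite mulr_gt0// divr_gt0.
have xkx k : xk k < x by rewrite gtr_pMr// kk.
have cxk : xk k @[k --> \oo] --> x.
  have : x * (1 - k.+2%:R^-1) @[k --> \oo] --> x * (1 - 0).
    apply: cvgM; first exact: cvg_cst.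
    apply: cvgB; first exact: cvg_cst.
    by have := @cvg_harmonic R; rewrite -cvg_shiftS.
  rewrite subr0 mulr1; apply: cvg_trans; apply: near_eq_cvg; apply: nearW => k.
  rewrite /xk; congr (x * _); have k2 : k.+2%:R != 0 :> R by rewrite pnatr_eq0.
  by rewrite -[in RHS](natr1 k.+1) in k2 *; field.
have mset : measurable [set t | u t < x].
  rewrite -[X in measurable X]setTI; have := mu_ measurableT `]-oo, x[%classic (measurable_itv _).
  by congr (measurable (_ `&` _)); apply/seteqP; split => t /=; rewrite in_itv.
have H (m : {measure set T -> \bar R}) : (m setT = 1)%E ->
  (\int[m]_t (softstep (xk k) (u t))%:E @[k --> \oo])%E --> m [set t | u t < x].
  move=> m1; have := @integral_indic _ T R m setT measurableT _ mset; rewrite setIT => <-.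
  apply: bounded_convergence => //.
  - by move=> k; exact: measurable_softstep.
  - by move=> k t; exact: softstep01.
  - move=> t; rewrite indicE; case: (ltP (u t) x) => utx.
      rewrite mem_set//; apply: cvg_near_cst.
      have : \forall k \near \oo, u t < xk k by apply: (cvgr_gt _ cxk).
      by apply: filterS => k; rewrite /softstep => ->.
    rewrite memNset/=; last by apply/negP; rewrite -leNgt.
    apply: cvg_near_cst; apply: nearW => k; rewrite /softstep.
    have xu : xk k < u t by exact: lt_le_trans (xkx k) utx.
    by rewrite ltNge (ltW xu)/= gt_eqF.
have L1 := H _ mu1; have L2 := H _ nu1; apply: (cvg_unique _ L1) => //.
by move: L2; under eq_fun do rewrite -S//.
Qed.

(** The Laplace transforms agree at all multiples of a small [l]: at [l] and [2 l] by
    expansion at 0, then step by step.  These values are the moments of the bounded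
    variable [exp(-l w)]. *)
Lemma determinacy (w : T -> R) (C0 C : R) : measurable_fun setT w -> (forall t, 0 <= w t) ->
  0 < C0 -> 0 < C -> finite_moments w mu ->
  (forall k, (\int[mu]_t (w t ^+ k)%:E <= (C0 * (C ^+ k * k`!%:R))%:E)%E) ->
  (forall k, (\int[mu]_t (w t ^+ k)%:E = \int[nu]_t (w t ^+ k)%:E)%E) ->
  forall c, 0 <= c -> mu [set t | c < w t] = nu [set t | c < w t].
Proof.
move=> mw w0 C00 C_0 fm bd mom.
have fn : finite_moments w nu by move=> k; rewrite -mom.
(* the expansion at 0 is valid up to 1 / (2 C), which exceeds 2 l *)
pose l : R := (8 * C)^-1.
have l0 : 0 < l by rewrite invr_gt0 mulr_gt0.
have I0 (m : {measure set T -> \bar R}) k : wint w m k 0 = \int[m]_t (w t ^+ k).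
  by apply: eq_Rintegral => t _; rewrite mul0r oppr0 expR0 mulr1.
have ag0 : agree w mu nu 0 by move=> k; rewrite !I0 /Rintegral mom.
have bd' k : wint w mu k 0 <= C0 * (C ^+ k * k`!%:R).
  rewrite I0 /Rintegral -lee_fin fineK//.
  by rewrite ge0_fin_numE ?fm// integral_ge0// => t _; rewrite lee_fin exprn_ge0.
have agn n : agree w mu nu (n%:R * l).
  case: n => [|n]; first by rewrite mul0r.
  elim: n => [|[|n] IH].
  - apply: (agree_from_moments mw w0 fm fn C00 C_0 _ _ bd' ag0); first by rewrite mulr_ge0// ltW.
    rewrite mul1r /l; have -> : 2 * (C * (8 * C)^-1) = 4^-1 by field; rewrite gt_eqF.
    by rewrite invf_lt1// ltr1n.
  - apply: (agree_from_moments mw w0 fm fn C00 C_0 _ _ bd' ag0); first by rewrite mulr_ge0// ltW.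
    rewrite /l; have -> : 2 * (C * (2 * (8 * C)^-1)) = 2^-1 by field; rewrite gt_eqF.
    by rewrite invf_lt1// ltr1n.
  - rewrite -natr1 mulrDl mul1r; apply: agree_extend => //.
    + by rewrite mulr_gt0.
    + exact: ltW.
    + by rewrite ler_pM2r// ler_nat.
move=> c c0.
pose u t := expR (- (l * w t)).
have mu_ : measurable_fun setT u.
  by apply: measurable_expRT; apply: measurable_oppT; exact: measurable_funM.
have u01 t : 0 <= u t <= 1 by rewrite expR_ge0/= expR_le1 oppr_le0 mulr_ge0// ltW.
have -> : [set t | c < w t] = [set t | u t < expR (- (l * c))].
  by apply/seteqP; split => t /=; rewrite ltr_expR ltrN2 ltr_pM2l.
apply: bounded_determinacy => //; last exact: expR_gt0.
move=> n; have := congr1 EFin (agn n 0%N); rewrite /wint /Rintegral.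
rewrite !fineK; [|apply: integrable_fin_num => //; apply: integrable_wint => //; by rewrite mulr_ge0// ltW..].
move=> H; transitivity (\int[mu]_x (w x ^+ 0 * expR (- (n%:R * l * w x)))%:E)%E.
  by apply: eq_integral => t _; rewrite expr0 mul1r -expRM_natl mulrN mulrA.
by rewrite H; apply: eq_integral => t _; rewrite expr0 mul1r -expRM_natl mulrN mulrA.
Qed.

End determinacy.

(** * Laws satisfying the moment recursion *)

Section measure_real_unique.
Variable R : realType.
Local Notation mT := (measurableTypeR R).

Lemma measure_eq_ray (mu nu : {measure set mT -> \bar R}) :
  (mu setT < +oo)%E ->
  (forall b : R, mu `]b, +oo[%classic = nu `]b, +oo[%classic) ->
  forall A : set R, measurable A -> mu A = nu A.
Proof.
move=> muoo H A mA.
have GE := RGenOInfty.measurableE R.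
have mA' : (RGenOInfty.G (R:=R)).-sigma.-measurable A by rewrite -GE.
apply: (@g_sigma_algebra_measure_unique _ R mT (@RGenOInfty.G R) _
  (fun n => `](- n%:R)%R, +oo[%classic) _ _ mu nu _ _ _ A mA').
- by move=> _ [x ->]; exact: measurable_itv.
- by move=> i; eexists; reflexivity.
- apply/seteqP; split => // x _; exists (Num.truncn `|x|).+1 => //=.
  by rewrite in_itv/= andbT ltrNl; apply: (le_lt_trans (ler_norm _)); rewrite normrN truncnS_gt.
- move=> _ _ [x ->] [y ->]; exists (Num.max x y).
  by apply/seteqP; split => z /=; rewrite !in_itv/= !andbT gt_max => /andP.
- by move=> _ [x ->]; exact: H.
- move=> n; apply: (@le_lt_trans _ _ (mu setT)); last by [].
  by apply: le_measure; [apply/mem_set; exact: measurable_itv|exact/mem_set|].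
Qed.

End measure_real_unique.

Section moment_laws.
Variables (R : realType) (a alpha : R).
Hypotheses (a0 : 0 < a) (alpha0 : 0 < alpha).
Local Notation mT := (measurableTypeR R).
Local Notation mu := (@lebesgue_measure R).

(** The power used for moments: [y^0] is 1 also at [y = 0]. *)
Definition mpow (s y : R) : R := if s == 0 then 1 else ppow s y.

Lemma mpow_ge0 s y : 0 <= mpow s y.
Proof. by rewrite /mpow; case: ifP => // _; exact: ppow_ge0. Qed.

Lemma mpow0 y : mpow 0 y = 1.
Proof. by rewrite /mpow eqxx. Qed.

Lemma mpowE s y : 0 < s -> mpow s y = ppow s y.
Proof. by move=> s0; rewrite /mpow gt_eqF. Qed.

Lemma measurable_mpow s : measurable_fun setT (mpow s).
Proof. by have [->|s0] := eqVneq s 0; rewrite /mpow ?eqxx ?(negbTE s0); [exact: measurable_cst|exact: measurable_ppow]. Qed.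

Lemma ppow_le1D (s t y : R) : 0 <= s -> s <= t -> ppow s y <= 1 + ppow t y.
Proof.
move=> s0 st; have [y0|y0] := ltP 0 y; last by rewrite !ppow_le0// addr0.
rewrite !ppowE//; have [y1|y1] := leP y 1.
  apply: (@le_trans _ _ 1); last by rewrite lerDl powR_ge0.
  by apply: (@le_trans _ _ (1 `^ s)); [rewrite ge0_ler_powR ?nnegrE// ltW|rewrite powR1].
by apply: (@le_trans _ _ (y `^ t)); [rewrite ler_powR// ltW|rewrite lerDr].
Qed.

Lemma mpow_le1D (s t y : R) : 0 <= s -> s <= t -> mpow s y <= 1 + mpow t y.
Proof.
move=> s0 st; have [->|sn] := eqVneq s 0; first by rewrite mpow0 lerDl mpow_ge0.
have s_gt0 : 0 < s by rewrite lt0r sn.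
by rewrite !mpowE ?(lt_le_trans s_gt0)// ppow_le1D.
Qed.

(** What the law of [1/X] satisfies.  Starting from the total mass 1, the recursion makes
    the moments of order [n a] finite. *)
Definition is_moment_law (nu : {measure set mT -> \bar R}) :=
  [/\ (nu setT = 1)%E, nu [set y : R | y < 0] = 0%E &
  forall s, 0 <= s -> (\int[nu]_y (mpow (s + a) y)%:E =
    (ratio a alpha s)%:E * \int[nu]_y (mpow s y)%:E)%E].

Section one_law.
Variable nu : {measure set mT -> \bar R}.
Hypothesis nuP : is_moment_law nu.

Let M s := (\int[nu]_y (mpow s y)%:E)%E.
Definition law_moment s := fine (\int[nu]_y (mpow s y)%:E)%E.

Lemma moment0 : M 0 = 1%E.
Proof.
have [nu1 _ _] := nuP; rewrite /M; under eq_integral do rewrite mpow0.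
by rewrite integral_cst// mul1e.
Qed.

Lemma moment_ge0 s : (0 <= M s)%E.
Proof. by apply: integral_ge0 => y _; rewrite lee_fin mpow_ge0. Qed.

Lemma moment_fin_nat n : M (n%:R * a) \is a fin_num.
Proof.
elim: n => [|n IH]; first by rewrite mul0r moment0.
have [_ _ fe] := nuP; rewrite -natr1 mulrDl mul1r /M fe; last by rewrite mulr_ge0// ltW.
by rewrite fin_numM.
Qed.

Lemma moment_le1D s t : 0 <= s -> s <= t -> (M s <= 1 + M t)%E.
Proof.
move=> s0 st; apply: (@le_trans _ _ (\int[nu]_y (1 + mpow t y)%:E)%E).
  apply: ge0_le_integral => //.
  - by move=> y _; rewrite lee_fin mpow_ge0.
  - by apply/measurable_EFinP; exact: measurable_mpow.
  - by apply/measurable_EFinP; apply: measurable_funD; [exact: measurable_cst|exact: measurable_mpow].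
  - by move=> y _; rewrite lee_fin mpow_le1D.
under eq_integral do rewrite EFinD; rewrite ge0_integralD//.
- by have [nu1 _ _] := nuP; rewrite integral_cst// nu1 mule1.
- by move=> y _; rewrite lee_fin mpow_ge0.
- by apply/measurable_EFinP; exact: measurable_mpow.
Qed.

Lemma moment_fin s : 0 <= s -> M s \is a fin_num.
Proof.
move=> s0; rewrite ge0_fin_numE ?moment_ge0//.
pose n := (Num.truncn (s / a)).+1.
have sn : s <= n%:R * a by rewrite -ler_pdivrMr// ltW// truncnS_gt.
by apply: (le_lt_trans (moment_le1D s0 sn)); rewrite lte_add_pinfty ?ltry// ltey_eq moment_fin_nat.
Qed.

Lemma law_momentE s : 0 <= s -> M s = (law_moment s)%:E.
Proof. by move=> s0; rewrite /law_moment fineK// moment_fin. Qed.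

(** A vanishing moment of positive order forces the law to sit at 0, and then the
    recursion at [s = 0] fails. *)
Lemma law_moment_gt0 s : 0 <= s -> 0 < law_moment s.
Proof.
move=> s0; have [->|sn] := eqVneq s 0; first by rewrite /law_moment -/(M 0) moment0.
have s_gt0 : 0 < s by rewrite lt0r sn.
rewrite lt0r -lee_fin -law_momentE// moment_ge0 andbT; apply/negP => /eqP Fs.
have : M s = 0%E by rewrite law_momentE// Fs.
rewrite /M => Ms.
have : (\int[nu]_(y in setT) `|(mpow s y)%:E| = 0)%E.
  by rewrite -[RHS]Ms; apply: eq_integral => y _; rewrite /= ger0_norm ?mpow_ge0.
have mms : measurable_fun setT (fun y : mT => (mpow s y)%:E).
  by apply/measurable_EFinP; exact: measurable_mpow.
move/(ae_eq_integral_abs nu measurableT mms) => H.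
have : M a = 0%E.
  rewrite /M; rewrite -[RHS](integral0 nu setT).
  apply: ae_eq_integral => //.
    by apply/measurable_EFinP; exact: measurable_mpow.
  apply: filterS H => y H _ /=; move: (H I) => /= -[].
  rewrite !mpowE// /ppow; case: ifP => // y0 /eqP.
  by rewrite gt_eqF// powR_gt0.
have [nu1 _ /(_ 0 (lexx _))] := nuP.
rewrite add0r -/(M a) -/(M 0) moment0 mule1 => -> /eqP.
by rewrite eqe gt_eqF// ratio_gt0.
Qed.

Lemma law_moment_is_moment_function : is_moment_function a alpha law_moment.
Proof.
split.
- by rewrite /law_moment -/(M 0) moment0.
- exact: law_moment_gt0.
- apply: (@interpolation_log_convex R _ mT nu [set s : R | 0 <= s] law_moment mpow) => /=.
  + by move=> s _; exact: measurable_mpow.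
  + by move=> s x _; exact: mpow_ge0.
  + by move=> s s0; rewrite -law_momentE.
  + exact: law_moment_gt0.
  + by move=> s t x s0 _ /andP[sx _]; exact: (le_trans s0 (ltW sx)).
  + move=> s t th x s0 t0 st /andP[th0 th1].
    have t_gt0 : 0 < t by exact: le_lt_trans st.
    have [->|sn] := eqVneq s 0; last first.
      have s_gt0 : 0 < s by rewrite lt0r sn.
      rewrite !mpowE ?addr_gt0 ?mulr_gt0 ?subr_gt0//.
      by rewrite ppow_interpolate// th0.
    have th1' : 0 < 1 - th by rewrite subr_gt0.
    rewrite mulr0 add0r mpow0 powR1 mul1r !mpowE ?mulr_gt0//.
    have [x0|x0] := ltP 0 x; last by rewrite !ppow_le0// powR_ge0.
    by rewrite !ppowE// mulrC powRrM.
- move=> s s0; apply: EFin_inj; have sa : 0 <= s + a by rewrite addr_ge0// ltW.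
  rewrite EFinM -(law_momentE sa) -(law_momentE s0).
  by have [_ _ fe] := nuP; exact: fe.
Qed.

End one_law.

Lemma root_pow (j k : nat) y : (0 < j)%N ->
  mpow (a / j%:R) y ^+ k = mpow (k%:R * (a / j%:R)) y.
Proof.
move=> j0; have aj : 0 < a / j%:R by rewrite divr_gt0// ltr0n.
case: k => [|k]; first by rewrite mul0r mpow0.
have kaj : 0 < k.+1%:R * (a / j%:R) by rewrite mulr_gt0.
rewrite !mpowE//; have [y0|y0] := ltP 0 y; last by rewrite !ppow_le0// expr0n.
by rewrite !ppowE// (mulrC k.+1%:R) (powRrM _ (a / j%:R)) powR_mulrn ?powR_ge0.
Qed.

(** With [n = k/j + 1], rounded down, one has [k a/j <= n a], and
    [n!^alpha <= n!^j <= (j n)! <= (k+j)!], which is at most [2^(k+j) k! j!]. *)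
Lemma root_moment_growth (F : R -> R) (j : nat) : is_moment_function a alpha F ->
  (forall s t, 0 <= s -> s <= t -> F s <= 1 + F t) ->
  (0 < j)%N -> alpha <= j%:R ->
  exists C0 C : R, [/\ 0 < C0, 0 < C &
    forall k, F (k%:R * (a / j%:R)) <= C0 * (C ^+ k * k`!%:R)].
Proof.
move=> mF Fle j0 aj; have [C C_gt0 HC] := moment_growth a0 alpha0 mF.
have C1 : 1 <= C + 1 by rewrite lerDr ltW.
exists (1 + (C + 1) * (2 ^ j * j`!)%:R), ((C + 1) * 2).
split; [by rewrite ltr_wpDr// mulr_ge0// addr_ge0// ltW|by rewrite mulr_gt0// addr_gt0|].
move=> k; pose n := (k %/ j).+1.
have jn : (j * n <= k + j)%N by rewrite mulnS addnC leq_add2r mulnC leq_divM.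
have kn : (k <= j * n)%N by rewrite mulnC ltnW// -ltn_divLR.
have nk : (n <= k.+1)%N by rewrite ltnS leq_div.
have j_gt0 : 0 < j%:R :> R by rewrite ltr0n.
have step : k%:R * (a / j%:R) <= n%:R * a.
  rewrite mulrCA mulrC ler_pM2r// ler_pdivrMr// -natrM ler_nat mulnC//.
have B1 : (n`!%:R : R) `^ alpha <= (2 ^ (k + j) * (k`! * j`!))%:R.
  apply: (@le_trans _ _ (n`!%:R `^ j%:R)).
    by rewrite ler_powR// ler1n fact_gt0.
  rewrite powR_mulrn// -natrX ler_nat.
  apply: (leq_trans (fact_exp_le _ _)); apply: (leq_trans _ (fact_add_le _ _)).
  exact: leq_fact.
have B2 : C ^+ n <= (C + 1) ^+ k.+1.
  apply: (@le_trans _ _ ((C + 1) ^+ n)); last exact: ler_weXn2l.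
  by rewrite lerXn2r ?nnegrE ?addr_ge0 ?ltW// ltrDl.
have B : F (n%:R * a) <= (C + 1) ^+ k.+1 * (2 ^ (k + j) * (k`! * j`!))%:R.
  by apply: (le_trans (HC n)); rewrite ler_pM ?exprn_ge0 ?powR_ge0// ltW.
apply: (le_trans (Fle _ _ _ step)); first by rewrite mulr_ge0// divr_ge0// ltW.
apply: (le_trans (lerD (lexx 1) B)).
rewrite mulrDl mul1r lerD//; last first.
  apply: eq_ler; rewrite expnD exprS exprMn !natrM !natrX.
  by move: (C + 1) ((C + 1) ^+ k) (2 ^+ k : R) (2 ^+ j : R) (k`!%:R : R) (j`!%:R : R) => *; ring.
rewrite -[leLHS]mulr1 ler_pM// ?ler1n ?fact_gt0// exprn_ege1//.
by rewrite -[leLHS]mulr1 ler_pM// ler1n.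
Qed.

(** Apply [determinacy] to [y^(a/j)] with [j >= alpha]; the events [y^(a/j) > c] are
    the rays, which generate the Borel sets. *)
Theorem moment_law_unique (mu1 mu2 : {measure set mT -> \bar R}) :
  is_moment_law mu1 -> is_moment_law mu2 ->
  forall A : set R, measurable A -> mu1 A = mu2 A.
Proof.
move=> P1 P2; have [m11 m10 _] := P1; have [m21 m20 _] := P2.
apply: measure_eq_ray => [|b]; first by rewrite m11 ltry.
have mray (c : R) : measurable (`]c, +oo[%classic : set mT) by exact: measurable_itv.
have [b0|b0] := ltP b 0.
  have one (m : {measure set mT -> \bar R}) : (m setT = 1)%E ->
      m [set y : R | y < 0] = 0%E -> m `]b, +oo[%classic = 1%E.
    move=> m1 m0; apply/eqP; rewrite eq_le; apply/andP; split.
      by rewrite -m1; apply: le_measure; [apply/mem_set; exact: mray|exact/mem_set|].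
    have mneg : measurable ([set y : R | y < 0] : set mT).
      rewrite (_ : [set y : R | y < 0] = `]-oo, 0[%classic); first exact: measurable_itv.
      by apply/seteqP; split => y /=; rewrite in_itv.
    rewrite -m1 -[leRHS]add0e -m0; apply: (le_trans _ (measureU2 _ _ _)) => //.
    apply: le_measure; [exact/mem_set|by apply/mem_set; apply: measurableU => //; exact: mray|].
    move=> y _ /=; rewrite in_itv/= andbT; have [y0|y0] := ltP y 0; [by left|right].
    exact: lt_le_trans b0 y0.
  by rewrite !one.
pose j := (Num.truncn alpha).+1.
have j0 : (0 < j)%N by [].
have aj : alpha <= j%:R by rewrite ltW// truncnS_gt.
have ajr : 0 < a / j%:R by rewrite divr_gt0// ltr0n.
have mF1 := law_moment_is_moment_function P1; have mF2 := law_moment_is_moment_function P2.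
have Fle s t : 0 <= s -> s <= t -> law_moment mu1 s <= 1 + law_moment mu1 t.
  move=> s0 st; have t0 := le_trans s0 st.
  rewrite -lee_fin EFinD -!law_momentE//; exact: moment_le1D.
have [C0 [C [C00 C_0 HC]]] := root_moment_growth mF1 Fle j0 aj.
have kaj k : 0 <= k%:R * (a / j%:R) by rewrite mulr_ge0// ltW.
have E (m : {measure set mT -> \bar R}) k : is_moment_law m ->
    (\int[m]_y (mpow (a / j%:R) y ^+ k)%:E = (law_moment m (k%:R * (a / j%:R)))%:E)%E.
  by move=> mP; rewrite -law_momentE//; apply: eq_integral => y _; rewrite root_pow.
have := @determinacy _ mT R mu1 mu2 m11 m21 (mpow (a / j%:R)) C0 C (measurable_mpow _)
  (mpow_ge0 _) C00 C_0 _ _ _ (ppow (a / j%:R) b) (ppow_ge0 _ _).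
have -> : `]b, +oo[%classic = [set t | ppow (a / j%:R) b < mpow (a / j%:R) t].
  apply/seteqP; split => t /=; rewrite in_itv/= andbT mpowE//.
    move=> bt; rewrite (ppowE _ (le_lt_trans b0 bt)).
    have [b_gt0|b_le0] := ltP 0 b; last by rewrite ppow_le0// powR_gt0// (le_lt_trans b0).
    by rewrite ppowE// gt0_ltr_powR// ?nnegrE// ltW// (lt_trans b_gt0).
  have [t0|t0] := ltP 0 t; last by rewrite (ppow_le0 _ t0) ltNge ppow_ge0.
  rewrite (ppowE _ t0); have [b_gt0|b_le0] := ltP 0 b; last by rewrite (le_lt_trans b_le0).
  rewrite ppowE// => H; rewrite ltNge; apply/negP => tb.
  by move: H; rewrite ltNge ge0_ler_powR// ?nnegrE ltW.
apply.
- by move=> k; rewrite E// ltry.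
- by move=> k; rewrite E// lee_fin.
- by move=> k; rewrite !E//; congr EFin; exact: (moment_function_unique a0 alpha0 mF1 mF2).
Qed.
End moment_laws.

(** * Products of independent variables *)

Section integrals_against_variable.
Context d (T : measurableType d) (R : realType) (P : {measure set T -> \bar R}).
Local Notation mT := (measurableTypeR R).

(** The pushforwards under [X] of the measures with densities [G1] and [G2] coincide.
    This is how an indicator of [X] is replaced by a function of [X]. *)
Lemma integral_eq_on_preimages (X : T -> R) (G1 G2 : T -> R) :
  measurable_fun setT X -> measurable_fun setT G1 -> measurable_fun setT G2 ->
  (forall x, 0 <= G1 x) -> (forall x, 0 <= G2 x) ->
  (forall A : set R, measurable A ->
    (\int[P]_x (\1_A (X x) * G1 x)%:E = \int[P]_x (\1_A (X x) * G2 x)%:E)%E) ->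
  forall h : R -> R, measurable_fun setT h -> (forall y, 0 <= h y) ->
    (\int[P]_x (h (X x) * G1 x)%:E = \int[P]_x (h (X x) * G2 x)%:E)%E.
Proof.
move=> mX m1 m2 G10 G20 H h mh h0.
have E (G : T -> R) : measurable_fun setT G -> (forall x, 0 <= G x) ->
  exists nu : {measure set mT -> \bar R}, forall h : R -> R, measurable_fun setT h ->
    (forall y, 0 <= h y) -> (\int[nu]_y (h y)%:E = \int[P]_x (h (X x) * G x)%:E)%E.
  move=> mG G0.
  have [nu1 [_ N1]] := @density_measure_exists _ T R P (EFin \o G)
    (measurable_EFinT mG) G0.
  have [nu2 [_ N2]] := @pushforward_exists _ T R _ mT nu1 X mX.
  exists nu2 => k mk k0; rewrite N2//; last by apply/measurable_EFinP.
  rewrite N1//.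
  - by apply/measurable_EFinP; apply: measurableT_comp.
  - by move=> y; rewrite lee_fin.
have [n1 N1] := E _ m1 G10; have [n2 N2] := E _ m2 G20.
rewrite -N1// -N2//; apply: (@eq_measure_integral _ mT) => A mA _.
have I (n : {measure set mT -> \bar R}) : (\int[n]_y (\1_A y)%:E = n A)%E.
  by rewrite integral_indic// setIT.
by rewrite -!I N1 ?N2 ?H//; exact: measurable_indic.
Qed.

End integrals_against_variable.

Lemma measurable_bigprod d (T : measurableType d) (R : realType) (I : Type) (s : seq I)
    (p : pred I) (f : I -> T -> R) : (forall i, measurable_fun setT (f i)) ->
  measurable_fun setT (fun x => \prod_(i <- s | p i) f i x).
Proof.
move=> mf; elim: s => [|i s IH].
  by under eq_fun do rewrite big_nil; exact: measurable_cst.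
by under eq_fun do rewrite big_cons; case: (p i) => //; exact: measurable_funM.
Qed.

Section independent_product.
Context d (T : measurableType d) (R : realType) (P : probability T R).
Variable B : nat -> {RV P >-> R}.
Hypothesis indB : mutually_independent B.

Lemma indicator_product (N : nat) (A : nat -> set R) :
  (forall i, measurable (A i)) ->
  (\int[P]_x (\prod_(i < N) \1_(A i) (B i x))%:E =
   (\prod_(i < N) fine (P (B i @^-1` A i)))%:E)%E.
Proof.
move=> mA; have := indB (iota_uniq 0 N) mA.
have mBA i : measurable (B i @^-1` A i).
  by rewrite -[X in measurable X]setTI; exact: measurable_funP.
have E x : \prod_(i < N) \1_(A i) (B i x) =
    \1_(\bigcap_(i in [set` iota 0 N]) (B i @^-1` A i)) x :> R.
  rewrite -(big_mkord xpredT (fun i => \1_(A i) (B i x) : R)) /index_iota subn0 indicE.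
  have [xA|xA] := boolP (x \in _).
    move: xA => /set_mem xA; rewrite big_seq big1//= => i iN.
    by rewrite indicE mem_set//; exact: (xA i).
  apply/eqP; rewrite prodf_seq_eq0; apply/negPn/negP => /hasPn H; move/negP: xA; apply.
  apply/mem_set => i /= iN; have := H i iN.
  by rewrite /= indicE; case: (boolP (B i x \in A i)) => [/set_mem//|_]; rewrite eqxx.
under eq_integral do rewrite E.
rewrite integral_indic ?setIT//; last first.
  by apply: bigcap_measurableType => // i _; exact: mBA.
move=> indP; apply: (etrans indP); rewrite -prodEFin -(big_mkord xpredT (fun i => (fine (P (B i @^-1` A i)))%:E)) /index_iota subn0.
by apply: eq_bigr => i _; rewrite fineK// fin_num_measure.
Qed.

Lemma preimage_measurable i (A : set R) : measurable A -> measurable (B i @^-1` A).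
Proof. by move=> mA; rewrite -[X in measurable X]setTI; exact: measurable_funP. Qed.

Lemma integral_indic_preimage i (A : set R) : measurable A ->
  (\int[P]_x (\1_A (B i x))%:E = (fine (P (B i @^-1` A)))%:E)%E.
Proof.
move=> mA; have mBA := @preimage_measurable i A mA.
rewrite fineK ?fin_num_measure//; transitivity (\int[P]_x (\1_(B i @^-1` A) x)%:E)%E => //.
by rewrite integral_indic// setIT.
Qed.

Definition slot (k : nat) (g : R -> R) (f : nat -> R -> R) (i : nat) := if i == k then g else f i.

(** Independence is the case where all the functions are indicators; the induction
    frees one index after the other, by [integral_eq_on_preimages]. *)
Lemma mixed_product (N k : nat) (f : nat -> R -> R) (e : nat -> R) :
  (forall i, measurable_fun setT (f i)) -> (forall i y, 0 <= f i y) ->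
  (forall i, (\int[P]_x (f i (B i x))%:E = (e i)%:E)%E) ->
  (forall i, (k <= i)%N -> exists2 A, measurable A & f i = \1_A) ->
  (\int[P]_x (\prod_(i < N) f i (B i x))%:E = (\prod_(i < N) e i)%:E)%E.
Proof.
elim: k f e => [|k IH] f e mf f0 fe fi.
  have /choice[A HA] : forall i, exists A, measurable A /\ f i = \1_A.
    by move=> i; have [A mA fA] := fi i (leq0n i); exists A.
  have := indicator_product N (fun i => (HA i).1).
  under eq_integral do under eq_bigr do rewrite -(HA _).2.
  move=> ->; congr EFin; apply: eq_bigr => i _; apply: EFin_inj.
  by rewrite -fe (HA i).2 integral_indic_preimage//; exact: (HA i).1.
have IHA A : measurable A -> (\int[P]_x (\prod_(i < N) slot k \1_A f i (B i x))%:E =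
    (\prod_(i < N) (if i == k :> nat then fine (P (B k @^-1` A)) else e i))%:E)%E.
  move=> mA; apply: (IH _ (fun i => if i == k then fine (P (B k @^-1` A)) else e i)).
  - by move=> i; rewrite /slot; case: eqP => // _; exact: measurable_indic.
  - by move=> i y; rewrite /slot; case: eqP.
  - by move=> i; rewrite /slot; case: eqP => // ->; exact: integral_indic_preimage.
  - move=> i; rewrite /slot; case: eqP => [_ _|ik ki]; first by exists A.
    by apply: fi; rewrite ltn_neqAle ki eq_sym andbT; exact/eqP.
have [kN|kN] := ltnP k N; last first.
  have ne (i : 'I_N) : (i == k :> nat) = false.
    by apply/negP => /eqP ik; move: (ltn_ord i); rewrite ik ltnNge kN.
  have := IHA setT measurableT; rewrite /slot.
  under eq_integral do under eq_bigr do rewrite ne.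
  by under [in RHS]eq_bigr do rewrite ne.
pose k' := Ordinal kN.
have e0 i : 0 <= e i by rewrite -lee_fin -fe; apply: integral_ge0 => x _; rewrite lee_fin.
pose G1 x := \prod_(i < N | i != k') f i (B i x).
pose c := \prod_(i < N | i != k') e i.
have c0 : 0 <= c by apply: prodr_ge0.
have mfB i : measurable_fun setT (fun x => f i (B i x)) by apply: measurableT_comp.
have mG1 : measurable_fun setT G1 by apply: measurable_bigprod.
have G10 x : 0 <= G1 x by apply: prodr_ge0.
have H := @integral_eq_on_preimages _ T R P (B k) G1 (cst c) _ mG1 (measurable_cst _) G10 (fun _ => c0).
have mulc (g : R -> R) : measurable_fun setT g -> (forall y, 0 <= g y) ->
    (\int[P]_x (g (B k x) * cst c x)%:E = \int[P]_x (g (B k x))%:E * c%:E)%E.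
  move=> mg g0; under eq_integral do rewrite mulrC.
  rewrite ge0_integral_mulc//= 1?muleC//.
  by apply: measurableT_comp.
under eq_integral do rewrite (bigD1 k')//=.
have mBk : measurable_fun setT (B k) by exact: measurable_funP.
have -> : (\prod_(i < N) e i)%:E = ((e k)%:E * c%:E)%E by rewrite (bigD1 k').
rewrite -fe -(mulc (f k) (mf k) (f0 k)).
apply: (H mBk _ (f k) (mf k) (f0 k)) => A mA.
rewrite mulc// integral_indic_preimage//.
have := IHA A mA.
rewrite (bigD1 k')//= eqxx /slot => E.
transitivity (\int[P]_x (\prod_(i < N) (if i == k :> nat then \1_A else f i) (B i x))%:E)%E.
  apply: eq_integral => x _; rewrite [in RHS](bigD1 k')//= eqxx; congr (_ * _)%:E.
  apply: eq_bigr => i ik; rewrite ifF//; apply/negbTE; apply: contra ik => /eqP ik.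
  by apply/eqP/val_inj.
rewrite E EFinM; congr (_ * (_)%:E)%E.
apply: eq_bigr => i ik; rewrite ifF//; apply/negbTE; apply: contra ik => /eqP ik.
by apply/eqP/val_inj.
Qed.

Lemma independent_product (N : nat) (f : nat -> R -> R) (e : nat -> R) :
  (forall i, measurable_fun setT (f i)) -> (forall i y, 0 <= f i y) ->
  (forall i, (\int[P]_x (f i (B i x))%:E = (e i)%:E)%E) ->
  (\int[P]_x (\prod_(i < N) f i (B i x))%:E = (\prod_(i < N) e i)%:E)%E.
Proof.
move=> mf f0 fe.
have := @mixed_product N N (fun i => if (i < N)%N then f i else \1_setT)
  (fun i => if (i < N)%N then e i else fine (P (B i @^-1` setT))).
under eq_integral do under eq_bigr do rewrite ltn_ord.
move=> ->.
- by congr EFin; apply: eq_bigr => i _; rewrite ltn_ord.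
- by move=> i; case: ifP.
- by move=> i y; case: ifP.
- by move=> i; case: ifP => // _; rewrite integral_indic_preimage.
- by move=> i; rewrite leqNgt => /negbTE ->; exists setT.
Qed.

End independent_product.

(** * Moments of products of Beta variables *)

Section density_expectation.
Context d (T : measurableType d) (R : realType) (P : probability T R).
Local Notation mu := (@lebesgue_measure R).
Local Notation mT := (measurableTypeR R).

Lemma density_expectation (X : {RV P >-> R}) (D : set R) (g g1 : R -> R) :
  has_density_on X D g -> measurable_fun setT g1 -> (forall x, 0 <= g1 x) ->
  (forall x, D x -> g1 x = g x) -> (forall x, ~ D x -> g1 x = 0) ->
  forall h : R -> R, measurable_fun setT h -> (forall x, 0 <= h x) ->
    (\int[P]_w (h (X w))%:E = \int[mu]_x (h x * g1 x)%:E)%E.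
Proof.
move=> dX mg g0 gD gN h mh h0.
have [nu [nuA nuI]] := @density_measure_exists _ mT R mu (EFin \o g1) (measurable_EFinT mg) g0.
have mX : measurable_fun setT X by exact: measurable_funP.
have [nu' [nu'A nu'I]] := @pushforward_exists _ T R _ mT P X mX.
rewrite -(nu'I (EFin \o h)) ?nuI//; last by apply: measurable_EFinT.
transitivity (\int[nu]_x (h x)%:E)%E; last by rewrite nuI//; exact: measurable_EFinT.
apply: (@eq_measure_integral _ mT R setT nu nu') => A mA _.
rewrite nu'A nuA//; transitivity (distribution P X A) => //; rewrite dX//.
rewrite integral_mkcondr; apply: eq_integral => x _.
rewrite patchE; case: ifPn => /= [/set_mem xD|xD]; first by rewrite gD.
by rewrite gN// => /mem_set; exact/negP.
Qed.

Definition beta_moment (p q s : R) : R := Gamma (p + s) * Gamma (p + q) / (Gamma p * Gamma (p + q + s)).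

Lemma beta_ae (X : {RV P >-> R}) (p q : R) : is_beta X p q -> {ae P, forall w, 0 < X w < 1}.
Proof.
move=> bX.
have mI : measurable (`]0, 1[%classic : set R) by exact: measurable_itv.
exists (X @^-1` (~` `]0, 1[)); split.
- by rewrite -[X in measurable X]setTI; apply: measurable_funP => //; exact: measurableC.
- transitivity (distribution P X (~` `]0, 1[)) => //.
  by rewrite bX ?setICl ?integral_set0//; exact: measurableC.
- by move=> w /= H; rewrite in_itv/= => ?; exact: H.
Qed.

Lemma beta_expectation (X : {RV P >-> R}) (p q s : R) : 0 < p -> 0 < q -> 0 <= s -> is_beta X p q ->
  (\int[P]_w (ppow s (X w))%:E = (beta_moment p q s)%:E)%E.
Proof.
move=> p0 q0 s0 bX.
have pq0 : 0 < p + q by exact: addr_gt0.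
have ps0 : 0 < p + s by exact: ltr_pwDl.
have Gp := Gamma_gt0 p0; have Gq := Gamma_gt0 q0; have Gpq := Gamma_gt0 pq0.
have Gps := Gamma_gt0 ps0.
pose K := Gamma (p + q) / (Gamma p * Gamma q).
have K0 : 0 <= K by exact: (ltW (divr_gt0 Gpq (mulr_gt0 Gp Gq))).
rewrite (@density_expectation X `]0, 1[ (beta_density p q)
  (fun x => K * (ppow (p - 1) x * ppow (q - 1) (1 - x))))//; last first.
- by move=> x; exact: ppow_ge0.
- exact: measurable_ppow.
- move=> x /=; rewrite in_itv/= => /negP; rewrite negb_and -!leNgt => /orP[x0|x1].
    by rewrite ppow_le0// mul0r mulr0.
  by rewrite (@ppow_le0 _ (q - 1)) ?mulr0// subr_le0.
- move=> x /=; rewrite in_itv/= => /andP[x0 x1].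
  by rewrite /beta_density !ppowE ?subr_gt0// mulrA.
- by move=> x; apply: mulr_ge0 => //; apply: mulr_ge0; exact: ppow_ge0.
- by mtac.
transitivity (\int[mu]_x (K * (ppow (q - 1) (1 - x) * ppow (p + s - 1) x))%:E)%E.
  apply: eq_integral => x _; rewrite (_ : p + s - 1 = s + (p - 1)) 1?(ppowD s); last by ring.
  by move: (ppow (p - 1) x) (ppow s x) (ppow (q - 1) (1 - x)) => *; congr EFin; ring.
rewrite ge0_integral_mulc//; last first.
- by move=> x; rewrite mulr_ge0// ppow_ge0.
- by mtac.
have := bintE q0 ps0; rewrite /bint => ->.
have -> : q + (p + s) = p + q + s by ring.
have pqs0 : 0 < p + q + s by exact: ltr_pwDl.
have /gt_eqF/negbT Gpqs := Gamma_gt0 pqs0.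
rewrite -EFinM /K /beta_moment; congr EFin.
move: Gp Gq => /gt_eqF/negbT Gp /gt_eqF/negbT Gq.
move: Gp Gq Gpqs; set g1 := Gamma p; set g2 := Gamma q; set g3 := Gamma (p + q + s).
set g4 := Gamma (p + q); set g5 := Gamma (p + s).
by move: g1 g2 g3 g4 g5 => g1 g2 g3 g4 g5 n1 n2 n3; field; apply/and3P.
Qed.

End density_expectation.

Section beta_products.
Variables (R : realType) (p0 c q : R).
Hypotheses (p0_gt0 : 0 < p0) (c_gt0 : 0 < c) (q_gt0 : 0 < q).
Implicit Types (n N M k : nat) (s t : R).

(** The first parameters of the Beta variables: an arithmetic progression with step
    [c], the second parameter being the constant [q]. *)
Definition par n : R := p0 + c * n%:R.
(** The inverse of the mean of Beta([par n], q), so that [gain n * B n] has mean 1. *)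
Definition gain n : R := (par n + q) / par n.
(** The moment of order [s] of the normalised partial product of length [N]. *)
Definition product_moment N s := \prod_(i < N) (gain i `^ s * beta_moment (par i) q s).
Definition scale N : R := \prod_(i < N) gain i.

Lemma par_gt0 n : 0 < par n.
Proof. by rewrite ltr_wpDr// mulr_ge0// ltW. Qed.

Lemma par_ge n : Num.min p0 c * n.+1%:R <= par n.
Proof.
rewrite -natr1 mulrDr mulr1 addrC /par lerD//; first by rewrite ge_min lexx.
by rewrite ler_wpM2r// ge_min lexx orbT.
Qed.

Lemma gain_ge1 n : 1 <= gain n.
Proof. by rewrite /gain mulrDl divff ?gt_eqF ?par_gt0// lerDl divr_ge0// ltW// par_gt0. Qed.

Lemma gain_gt0 n : 0 < gain n.
Proof. exact: lt_le_trans ltr01 (gain_ge1 n). Qed.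

Lemma beta_moment_gt0 n s : 0 <= s -> 0 < beta_moment (par n) q s.
Proof.
move=> s0; have pn := par_gt0 n.
have pq : 0 < par n + q by rewrite addr_gt0.
by rewrite /beta_moment divr_gt0// mulr_gt0//; apply: Gamma_gt0 => //; rewrite ltr_pwDl.
Qed.

Lemma product_moment_gt0 N s : 0 <= s -> 0 < product_moment N s.
Proof.
by move=> s0; apply: prodr_gt0 => i _; rewrite mulr_gt0 ?powR_gt0 ?gain_gt0 ?beta_moment_gt0.
Qed.

Lemma beta_moment0 n : beta_moment (par n) q 0 = 1.
Proof.
have pn := par_gt0 n; have pq : 0 < par n + q by rewrite addr_gt0.
by rewrite /beta_moment !addr0 divff// gt_eqF// mulr_gt0//; apply: Gamma_gt0.
Qed.

Lemma product_moment0 N : product_moment N 0 = 1.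
Proof. by rewrite /product_moment big1// => i _; rewrite powRr0 beta_moment0 mulr1. Qed.

Lemma beta_momentS n s : 0 <= s ->
  beta_moment (par n) q (s + 1) = beta_moment (par n) q s * ((par n + s) / (par n + q + s)).
Proof.
move=> s0; have pn := par_gt0 n; have pq : 0 < par n + q by rewrite addr_gt0.
have ps : 0 < par n + s by rewrite ltr_pwDl.
have pqs : 0 < par n + q + s by rewrite ltr_pwDl.
rewrite /beta_moment !addrA !GammaS//.
have := Gamma_gt0 pn; have := Gamma_gt0 pqs; move: ps pqs.
move=> /gt_eqF/negbT + /gt_eqF/negbT + /gt_eqF/negbT + /gt_eqF/negbT.
set g1 := Gamma (par n + q); set g2 := Gamma (par n); set g3 := Gamma (par n + s); set g4 := Gamma (par n + q + s).
move: g1 g2 g3 g4 => g1 g2 g3 g4.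
by move: (par n + s) (par n + q + s) => *; field; rewrite ?mulf_neq0//; apply/and3P.
Qed.

Lemma mean1 n : gain n `^ 1 * beta_moment (par n) q 1 = 1.
Proof.
rewrite powRr1 ?ltW ?gain_gt0// -[X in beta_moment _ _ X]add0r beta_momentS// beta_moment0 mul1r !addr0.
have pn := par_gt0 n; have pq : 0 < par n + q by rewrite addr_gt0.
by rewrite /gain mulrA divfK ?gt_eqF// divff// gt_eqF.
Qed.

(** The variance of [gain n * B n]. *)
Definition variance n := q / (par n * (par n + q + 1)).

Lemma second_moment n : gain n `^ 2 * beta_moment (par n) q 2 = 1 + variance n.
Proof.
have pn := par_gt0 n; have pq : 0 < par n + q by rewrite addr_gt0.
have pq1 : 0 < par n + q + 1 by rewrite addr_gt0.
have -> : 2 = 1 + 1 :> R by ring.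
rewrite beta_momentS// gt0_powRD ?gain_gt0//.
have := mean1 n; rewrite mulrACA => ->.
rewrite mul1r powRr1 ?ltW ?gain_gt0// /gain /variance.
move: pn pq pq1; move: (par n) => x x0 xq xq1; field.
by rewrite !gt_eqF.
Qed.

Lemma variance_ge0 n : 0 <= variance n.
Proof.
have pn := par_gt0 n.
have pq1 : 0 < par n + q + 1 by apply: addr_gt0 => //; exact: addr_gt0.
by rewrite /variance divr_ge0 ?mulr_ge0 ?(ltW pn) ?(ltW pq1)// ltW.
Qed.

Definition var_const := 2 * q / Num.min p0 c ^+ 2.

Lemma var_const_gt0 : 0 < var_const.
Proof. by rewrite /var_const divr_gt0 ?mulr_gt0 ?exprn_gt0 ?lt_min ?p0_gt0. Qed.

(** A telescoping majorant: [variance n] is of order [1/n^2]. *)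
Lemma variance_le n : variance n <= var_const * (n.+1%:R^-1 - n.+2%:R^-1).
Proof.
have pn := par_gt0 n; have dp := par_ge n.
have m0 : 0 < Num.min p0 c by rewrite lt_min p0_gt0.
move: m0 dp; rewrite /variance /var_const; move: (Num.min p0 c) (par n) pn => m x x0 m0 dp.
have := ler0n R n; rewrite -[n.+2%:R]natr1 -[n.+1%:R]natr1 in dp *.
move: (n%:R : R) dp => z dp z0.
have z1 : 0 < z + 1 by rewrite ltr_wpDl.
have z2 : 0 < z + 1 + 1 by rewrite addr_gt0.
have xq : 0 < x + q + 1 by apply: addr_gt0 => //; exact: addr_gt0.
have -> : 2 * q / m ^+ 2 * ((z + 1)^-1 - (z + 1 + 1)^-1) =
    q / ((m * (z + 1)) * (m * ((z + 1 + 1) / 2))).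
  by field; rewrite !gt_eqF.
rewrite ler_wpM2l ?(ltW q_gt0)// lef_pV2 ?posrE ?mulr_gt0 ?invr_gt0//.
have mz1 : 0 <= m * (z + 1) by rewrite mulr_ge0// ltW.
have mz2 : 0 <= m * ((z + 1 + 1) / 2) by rewrite mulr_ge0 ?divr_ge0// ltW.
apply: ler_pM => //.
apply: (@le_trans _ _ (m * (z + 1))).
  rewrite ler_wpM2l ?(ltW m0)// ler_pdivrMr// mulr_natr mulr2n lerD2l lerDr; exact: z0.
by apply: (le_trans dp); rewrite -addrA lerDl addr_ge0 ?(ltW q_gt0).
Qed.

Lemma second_moment_le N : product_moment N 2 <= expR var_const.
Proof.
apply: (@le_trans _ _ (expR (var_const * (1 - N.+1%:R^-1)))); last first.
  by rewrite ler_expR -[leRHS]mulr1 ler_wpM2l ?(ltW var_const_gt0)//.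
elim: N => [|N IH]; first by rewrite /product_moment big_ord0 invr1 subrr mulr0 expR0.
rewrite /product_moment big_ord_recr/= second_moment.
have -> : var_const * (1 - N.+2%:R^-1) =
    var_const * (1 - N.+1%:R^-1) + var_const * (N.+1%:R^-1 - N.+2%:R^-1) by ring.
rewrite expRD ler_pM//.
- by rewrite ltW// product_moment_gt0.
- by rewrite addr_ge0// variance_ge0.
- by apply: (le_trans (expR_ge1Dx _)); rewrite ler_expR variance_le.
Qed.

Definition incr_const := expR var_const * var_const.

Lemma second_moment_increment N M : (N <= M)%N ->
  product_moment M 2 - product_moment N 2 <= incr_const * (N.+1%:R^-1 - M.+1%:R^-1).
Proof.
move=> /subnKC <-; elim: (M - N)%N => [|k IH]; first by rewrite addn0 !subrr mulr0.
rewrite addnS; move: (N + k)%N IH => L IH.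
have -> : product_moment L.+1 2 = product_moment L 2 + product_moment L 2 * variance L.
  by rewrite /product_moment big_ord_recr/= second_moment; ring.
have S : product_moment L 2 * variance L <= incr_const * (L.+1%:R^-1 - L.+2%:R^-1).
  rewrite /incr_const -mulrA; apply: ler_pM; rewrite ?variance_ge0 ?variance_le ?second_moment_le//.
  by rewrite ltW// product_moment_gt0.
rewrite addrAC; apply: (le_trans (lerD IH S)); apply: eq_ler; ring.
Qed.

Lemma scale_gt0 N : 0 < scale N.
Proof. by apply: prodr_gt0 => i _; exact: gain_gt0. Qed.

Lemma scale_nd N M : (N <= M)%N -> scale N <= scale M.
Proof.
move=> /subnKC <-; elim: (M - N)%N => [|k IH]; first by rewrite addn0.
rewrite addnS /scale big_ord_recr/=; apply: (le_trans IH).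
by rewrite ler_peMr ?gain_ge1// ltW// scale_gt0.
Qed.

(** From [1 + x <= exp x]; the normalising constants vary slowly. *)
Lemma scale_le N M : (N <= M)%N ->
  scale M <= expR (q / Num.min p0 c * ((M - N)%N%:R / N.+1%:R)) * scale N.
Proof.
move=> /subnKC => E; rewrite -{1}E; elim: (M - N)%N => [|k IH].
  by rewrite addn0 mul0r mulr0 expR0 mul1r.
rewrite addnS /scale big_ord_recr/= -/(scale _).
rewrite -[k.+1%:R]natr1 mulrDl mulrDr expRD mulrAC.
apply: ler_pM => //; [exact/ltW/scale_gt0|exact/ltW/gain_gt0|].
apply: le_trans (expR_ge1Dx _).
rewrite /gain mulrDl divff ?gt_eqF ?par_gt0// lerD2l.
have m0 : 0 < Num.min p0 c by rewrite lt_min p0_gt0.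
rewrite mul1r -mulrA -invfM ler_wpM2l ?(ltW q_gt0)// lef_pV2 ?posrE ?par_gt0 ?mulr_gt0//.
by apply: le_trans (par_ge _); rewrite ler_wpM2l ?(ltW m0)// ler_nat ltnS leq_addr.
Qed.

Lemma prod_par N t : 0 <= t ->
  \prod_(i < N) (par i + t) = c ^+ N * (Gamma ((p0 + t) / c + N%:R) / Gamma ((p0 + t) / c)).
Proof.
move=> t0; have u0 : 0 < (p0 + t) / c by rewrite divr_gt0// ltr_pwDl.
have /gt_eqF/negbT Gu := Gamma_gt0 u0.
elim: N => [|N IH]; first by rewrite big_ord0 expr0 addr0 divff// mulr1.
have uN : 0 < (p0 + t) / c + N%:R by rewrite ltr_pwDl.
rewrite big_ord_recr/= IH -[N.+1%:R]natr1 addrA GammaS// exprSr /par.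
have -> : p0 + c * N%:R + t = c * ((p0 + t) / c + N%:R) by field; rewrite gt_eqF.
set g1 := Gamma ((p0 + t) / c + N%:R); set g2 := Gamma ((p0 + t) / c).
by move: g1 g2 ((p0 + t) / c + N%:R) (c ^+ N) => g1 g2 g3 g4; ring.
Qed.

(** The Gamma quotient, of order [N^(q/c)], which appears in [scale] and in the
    moments. *)
Definition quot x N := Gamma (x + q / c + N%:R) / Gamma (x + N%:R).

Lemma cvg_shiftN (x : R) : x + N%:R @[N --> \oo] --> +oo.
Proof. by have := @cvg_affine R x 1 ltr01; under eq_fun do rewrite mul1r. Qed.

Lemma quot_cvg x : quot x N / (x + N%:R) `^ (q / c) @[N --> \oo] --> (1 : R).
Proof.
have qc : 0 <= q / c by rewrite divr_ge0// ltW.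
have := Gamma_ratio_cvg qc (cvg_shiftN x).
apply: cvg_trans; apply: near_eq_cvg; apply: nearW => N.
by rewrite /quot (addrAC x) invfM mulrA.
Qed.

Lemma cvg_powR1 (v : nat -> R) r : v N @[N --> \oo] --> (1 : R) -> v N `^ r @[N --> \oo] --> (1 : R).
Proof.
move=> v1; rewrite -(@expR0 R).
have : expR (r * ln (v N)) @[N --> \oo] --> expR (r * 0).
  apply: continuous_cvg; first exact: continuous_expR.
  by apply: cvgM; [exact: cvg_cst|exact: cvg_ln1].
rewrite mulr0; apply: cvg_trans; apply: near_eq_cvg; near=> N.
have v0 : 0 < v N by near: N; apply: (cvgr_gt _ v1).
by rewrite /powR gt_eqF.
Unshelve. all: by end_near. Qed.

Lemma scaleE N : scale N =
  quot (p0 / c) N * (Gamma (p0 / c) / Gamma ((p0 + q) / c)).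
Proof.
have := prod_par N (ltW q_gt0); have := prod_par N (lexx 0).
under eq_bigr do rewrite addr0; rewrite addr0 /scale /gain => E0 Eq.
rewrite prodf_div Eq E0 /quot -mulrDl.
have cN : c ^+ N != 0 by rewrite expf_neq0// gt_eqF.
have u0 : 0 < p0 / c by rewrite divr_gt0.
have uq : 0 < (p0 + q) / c by rewrite divr_gt0// addr_gt0.
have /gt_eqF/negbT g0 := Gamma_gt0 u0.
have /gt_eqF/negbT gq := Gamma_gt0 uq.
have /gt_eqF/negbT g0N := Gamma_gt0 (ltr_pwDl u0 (ler0n _ N)).
move: cN g0 gq g0N; set x1 := c ^+ N; set x2 := Gamma (p0 / c); set x3 := Gamma ((p0 + q) / c).
set x4 := Gamma (p0 / c + N%:R); set x5 := Gamma ((p0 + q) / c + N%:R).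
by move: x1 x2 x3 x4 x5 => x1 x2 x3 x4 x5 n1 n2 n3 n4; field; apply/and4P.
Qed.

Lemma quot_gt0 x N : 0 < x -> 0 < quot x N.
Proof.
move=> x0; rewrite /quot divr_gt0//; apply: Gamma_gt0; last by rewrite ltr_pwDl.
by rewrite ltr_pwDl// addr_gt0// divr_gt0.
Qed.

Definition unit_const s : R := Gamma (p0 / c) / Gamma ((p0 + q) / c) *
  (Gamma ((p0 + q + s) / c) / Gamma ((p0 + s) / c)).

(** The factor that takes order [s] to order [s+1] is rational in [par i], so its
    product is a quotient of Gamma functions. *)
Lemma product_momentS N s : 0 <= s -> product_moment N (s + 1) =
  quot (p0 / c) N / quot ((p0 + s) / c) N * unit_const s * product_moment N s.
Proof.
move=> s0.
have qs0 : 0 <= q + s by rewrite addr_ge0// ltW.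
have -> : product_moment N (s + 1) = scale N *
    (\prod_(i < N) (par i + s) / \prod_(i < N) (par i + (q + s))) * product_moment N s.
  rewrite -prodf_div /scale -!big_split/=; apply: eq_bigr => i _.
  rewrite beta_momentS// gt0_powRD ?gain_gt0// powRr1 ?(ltW (gain_gt0 i))// addrA.
  by move: (gain i `^ s) (beta_moment (par i) q s) (gain i) (par i + s) (par i + q + s) => *; ring.
congr (_ * _).
rewrite scaleE !prod_par// /unit_const [quot ((p0 + s) / c) N]/quot.
have -> : (p0 + s) / c + q / c = (p0 + q + s) / c by rewrite -mulrDl addrAC.
have -> : p0 + (q + s) = p0 + q + s by ring.
have cN : c ^+ N != 0 by rewrite expf_neq0// gt_eqF.
have u0 : 0 < (p0 + s) / c by rewrite divr_gt0// ltr_pwDl.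
have uq : 0 < (p0 + q + s) / c by rewrite divr_gt0// ltr_pwDl// addr_gt0.
have /gt_eqF/negbT g0 := Gamma_gt0 u0.
have /gt_eqF/negbT gq := Gamma_gt0 uq.
have /gt_eqF/negbT g0N := Gamma_gt0 (ltr_pwDl u0 (ler0n _ N)).
have /gt_eqF/negbT gqN := Gamma_gt0 (ltr_pwDl uq (ler0n _ N)).
move: cN g0 gq g0N gqN; set x1 := c ^+ N; set x2 := Gamma ((p0 + s) / c).
set x3 := Gamma ((p0 + q + s) / c); set x4 := Gamma ((p0 + s) / c + N%:R).
set x5 := Gamma ((p0 + q + s) / c + N%:R); set x6 := quot _ _.
set x7 := Gamma (p0 / c) / Gamma ((p0 + q) / c).
by move: x1 x2 x3 x4 x5 x6 x7 => x1 x2 x3 x4 x5 x6 x7 n1 n2 n3 n4 n5; field; apply/and5P.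
Qed.

Lemma powR_div (x y r : R) : 0 < x -> 0 < y -> (x / y) `^ r = x `^ r / y `^ r.
Proof.
move=> x0 y0; have /gt_eqF/negbT yr := powR_gt0 r y0.
by apply: (mulIf yr); rewrite -(powRM _ (divr_ge0 (ltW x0) (ltW y0)) (ltW y0)) (divfK yr) divfK ?gt_eqF.
Qed.

Lemma quot_ratio_cvg (x y : R) : 0 < x -> 0 < y -> quot x N / quot y N @[N --> \oo] --> (1 : R).
Proof.
move=> x0 y0.
have H : (quot x N / (x + N%:R) `^ (q / c)) / (quot y N / (y + N%:R) `^ (q / c)) *
    ((y + N%:R + (x - y)) / (y + N%:R)) `^ (q / c) @[N --> \oo] --> (1 / 1 * 1 : R).
  apply: cvgM; last by apply: cvg_powR1; exact: cvg_ratio_shift (cvg_shiftN y).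
  apply: cvgM; first exact: quot_cvg.
  by apply: cvgV; [rewrite oner_eq0|exact: quot_cvg].
move: H; rewrite divr1 mulr1; apply: cvg_trans; apply: near_eq_cvg; apply: nearW => N.
have xN : 0 < x + N%:R by rewrite ltr_pwDl.
have yN : 0 < y + N%:R by rewrite ltr_pwDl.
have -> : y + N%:R + (x - y) = x + N%:R by ring.
rewrite powR_div//.
have := powR_gt0 (q / c) xN; have := powR_gt0 (q / c) yN; have := quot_gt0 N y0.
move: (quot x N) (quot y N) (_ `^ _) (_ `^ _) => a1 a2 a3 a4 p1 p2 p3.
by field; rewrite !gt_eqF.
Qed.

Definition shift_const s : R := (Gamma (p0 / c) / Gamma ((p0 + q) / c)) `^ c / c `^ q *
  (Gamma (p0 + q + s) / Gamma (p0 + s)).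

Definition shift_ratio s N := scale N `^ c *
  (Gamma (par N + s) / Gamma (par N + s + q)) * (Gamma (p0 + q + s) / Gamma (p0 + s)).

(** Since [par i + c = par i.+1], the Gamma functions telescope when the order
    grows by [c]. *)
Lemma product_moment_shift N s : 0 <= s ->
  product_moment N (s + c) = shift_ratio s N * product_moment N s.
Proof.
move=> s0.
have g0 : Gamma (p0 + s) != 0 by rewrite gt_eqF//; apply: Gamma_gt0; rewrite ltr_pwDl.
have gq : Gamma (p0 + q + s) != 0.
  by rewrite gt_eqF//; apply: Gamma_gt0; rewrite ltr_pwDl// addr_gt0.
elim: N => [|N IH].
  rewrite /shift_ratio /scale /product_moment !big_ord0 powR1 /par mulr0 addr0 (addrAC p0 s).
  move: g0 gq; set x1 := Gamma (p0 + s); set x2 := Gamma (p0 + q + s).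
  by move: x1 x2 => x1 x2 n1 n2; field; apply/andP.
rewrite /product_moment big_ord_recr/= -/(product_moment N (s + c)) IH.
rewrite [in RHS]big_ord_recr/= -/(product_moment N s) /shift_ratio.
have -> : scale N.+1 = scale N * gain N by rewrite /scale big_ord_recr.
rewrite powRM ?(ltW (gain_gt0 N)) ?(ltW (scale_gt0 N))// gt0_powRD ?gain_gt0// /beta_moment.
have -> : par N + (s + c) = par N.+1 + s by rewrite /par -natr1; ring.
have -> : par N + q + (s + c) = par N.+1 + s + q by rewrite /par -natr1; ring.
have -> : par N + q + s = par N + s + q by ring.
have pn := par_gt0 N; have pn1 := par_gt0 N.+1.
have /gt_eqF/negbT h1 := Gamma_gt0 (ltr_pwDl pn s0).
have /gt_eqF/negbT h2 := Gamma_gt0 (ltr_pwDl (ltr_pwDl pn s0) (ltW q_gt0)).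
have /gt_eqF/negbT h3 := Gamma_gt0 pn.
have /gt_eqF/negbT h4 := Gamma_gt0 (ltr_pwDl (ltr_pwDl pn1 s0) (ltW q_gt0)).
move: g0 gq h1 h2 h3 h4; set x1 := Gamma (p0 + s); set x2 := Gamma (p0 + q + s).
set x3 := Gamma (par N + s); set x4 := Gamma (par N + s + q); set x5 := Gamma (par N).
set x6 := Gamma (par N.+1 + s + q); set x7 := Gamma (par N.+1 + s); set x8 := Gamma (par N + q).
move: x1 x2 x3 x4 x5 x6 x7 x8 (scale N `^ c) (gain N `^ s) (gain N `^ c) (product_moment N s).
move=> x1 x2 x3 x4 x5 x6 x7 x8 y1 y2 y3 y4 n1 n2 n3 n4 n5 n6.
by field; repeat (apply/andP; split).
Qed.

Lemma shift_recursion s : 0 <= s -> shift_ratio s N @[N --> \oo] --> shift_const s.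
Proof.
move=> s0; rewrite /shift_ratio /shift_const.
apply: cvgM; last exact: cvg_cst.
pose K := Gamma (p0 / c) / Gamma ((p0 + q) / c).
have u0 : 0 < p0 / c by rewrite divr_gt0.
have uq : 0 < (p0 + q) / c by rewrite divr_gt0// addr_gt0.
have K0 : 0 < K by exact: divr_gt0 (Gamma_gt0 u0) (Gamma_gt0 uq).
have ps : par N + s @[N --> \oo] --> +oo.
  by have := @cvg_affine R (p0 + s) c c_gt0; under eq_fun do rewrite addrAC.
have H : (quot (p0 / c) N / (p0 / c + N%:R) `^ (q / c)) `^ c *
   (Gamma (par N + s + q) / (Gamma (par N + s) * (par N + s) `^ q))^-1 *
   ((par N + s + - s) / (par N + s)) `^ q * (K `^ c / c `^ q) @[N --> \oo] -->
   (1 * 1^-1 * 1 * (K `^ c / c `^ q) : R).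
  apply: cvgM; last exact: cvg_cst.
  apply: cvgM; last by apply: cvg_powR1; exact: cvg_ratio_shift.
  apply: cvgM; first by apply: cvg_powR1; exact: quot_cvg.
  by apply: cvgV; [rewrite oner_eq0|exact: (Gamma_ratio_cvg (ltW q_gt0))].
move: H; rewrite invr1 !mul1r; apply: cvg_trans; apply: near_eq_cvg; apply: nearW => N.
have pn := par_gt0 N; have psN : 0 < par N + s by rewrite ltr_pwDl.
have uN : 0 < p0 / c + N%:R by rewrite ltr_pwDl.
have parE : par N = c * (p0 / c + N%:R) by rewrite /par; field; rewrite gt_eqF.
have quot0 := quot_gt0 N u0.
have parq : par N `^ q = c `^ q * (p0 / c + N%:R) `^ q.
  by rewrite -(powRM _ (ltW c_gt0) (ltW uN)) -parE.
rewrite addrK scaleE -/K; move: (quot (p0 / c) N) quot0 => Q quot0.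
rewrite (powRM _ (ltW quot0) (ltW K0)).
rewrite (powR_div _ quot0 (powR_gt0 _ uN)) (powR_div _ pn psN) -powRrM divfK ?gt_eqF//.
rewrite parq.
have := powR_gt0 q psN; have := powR_gt0 q uN; have := powR_gt0 q c_gt0.
have := Gamma_gt0 psN; have := Gamma_gt0 (ltr_pwDl psN (ltW q_gt0)).
set x1 := Gamma (par N + s); set x2 := Gamma (par N + s + q).
move: x1 x2 (_ `^ q) (_ `^ q) (_ `^ q) (_ `^ c) (_ `^ c) => x1 x2 x3 x4 x5 x6 x7 *.
by field; rewrite !gt_eqF.
Qed.

Lemma unit_recursion s : 0 <= s ->
  quot (p0 / c) N / quot ((p0 + s) / c) N * unit_const s @[N --> \oo] --> unit_const s.
Proof.
move=> s0; rewrite -[X in _ --> X]mul1r; apply: cvgM; last exact: cvg_cst.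
by apply: quot_ratio_cvg; rewrite divr_gt0// ltr_pwDl.
Qed.

End beta_products.

(** * Almost sure convergence of products of Beta variables *)

Section sequences.
Variable R : realType.

(** Between two consecutive indices of the subsequence the product [D N * b N] is
    enclosed, up to the factor [r k], by its values at the ends. *)
Lemma monotone_sandwich (D b r : nat -> R) (n_ : nat -> nat) (z : R) :
  (forall N, 0 < D N) -> (forall N M, (N <= M)%N -> D N <= D M) ->
  (forall N, 0 <= b N) -> (forall N M, (N <= M)%N -> b M <= b N) ->
  (forall k, (n_ k < n_ k.+1)%N) ->
  (forall k, D (n_ k.+1) <= r k * D (n_ k)) -> r k @[k --> \oo] --> (1 : R) ->
  D (n_ k) * b (n_ k) @[k --> \oo] --> z -> D N * b N @[N --> \oo] --> z.
Proof.
move=> D0 Dle b0 ble nlt Dr r1 uz.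
have r0 k : 0 < r k.
  have := lt_le_trans (D0 _) (Dr k); rewrite pmulr_lgt0 //.
have up : r k * (D (n_ k) * b (n_ k)) @[k --> \oo] --> z.
  by rewrite -[X in _ --> X]mul1r; apply: cvgM.
have lo : (r k)^-1 * (D (n_ k.+1) * b (n_ k.+1)) @[k --> \oo] --> z.
  rewrite -[X in _ --> X]mul1r; apply: cvgM.
    by rewrite -invr1; apply: cvgV => //; rewrite oner_eq0.
  by rewrite (cvg_shiftS (fun k => D (n_ k) * b (n_ k))).
apply/cvgrPdist_lt => e e0.
have [K _ HK] : \forall k \near \oo, r k * (D (n_ k) * b (n_ k)) < z + e /\
    z - e < (r k)^-1 * (D (n_ k.+1) * b (n_ k.+1)).
  near=> k; split; near: k.
  - by apply: (cvgr_lt _ up); rewrite ltrDl.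
  - by apply: (cvgr_gt _ lo); rewrite gtrBl.
exists (n_ K) => // N /= KN.
have [k Kk /andP[kN Nk]] : exists2 k, (K <= k)%N & (n_ k <= N <= n_ k.+1)%N.
  elim: N KN => [|N IH]; first by rewrite leqn0 => /eqP K0; exists K; rewrite // K0 /=.
  rewrite leq_eqVlt => /predU1P[<-|KN].
    by exists K => //; rewrite leqnn ltnW.
  have [k Kk /andP[kN]] := IH KN; rewrite leq_eqVlt => /predU1P[Nk|Nk].
    by exists k.+1; rewrite ?(leqW Kk)// Nk leqnSn/= -Nk; have := nlt k.+1; rewrite -Nk.
  by exists k => //; rewrite Nk (leqW kN).
have [H1 H2] := HK k Kk.
rewrite ltr_distlC; apply/andP; split.
  apply: (lt_le_trans H2); rewrite ler_pdivrMl// mulrA.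
  apply: ler_pM; [exact: ltW|exact: b0| |exact: ble].
  by apply: (le_trans (Dr k)); rewrite ler_wpM2l ?(ltW (r0 k))// Dle.
apply: (le_lt_trans _ H1); rewrite mulrA.
apply: ler_pM; [exact: ltW|exact: b0| |exact: ble].
by apply: (le_trans _ (Dr k)); rewrite Dle.
Unshelve. all: by end_near. Qed.

(** The sum of the absolute increments has a finite integral, so it is finite almost
    everywhere. *)
Lemma ae_cvg_summable d (T : measurableType d) (P : {measure set T -> \bar R})
    (f : nat -> T -> R) (e : nat -> R) (S : R) :
  (forall k, measurable_fun setT (f k)) ->
  (forall k, (\int[P]_x (`|f k.+1 x - f k x|)%:E <= (e k)%:E)%E) ->
  (forall n, \sum_(0 <= k < n) e k <= S) ->
  {ae P, forall x, cvgn (f ^~ x)}.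
Proof.
move=> mf fe eS.
pose g k x := (`|f k.+1 x - f k x|)%:E.
have g0 k x : (0 <= g k x)%E by rewrite lee_fin.
have mg k : measurable_fun setT (g k).
  apply: measurable_EFinT; apply: measurableT_comp => //; exact: measurable_funB.
have gS : (\int[P]_x (\sum_(0 <= k <oo) g k x) <= S%:E)%E.
  rewrite integral_nneseries//; apply: lime_le.
    by apply: is_cvg_nneseries => n _ _; apply: integral_ge0.
  apply: nearW => n; apply: (@le_trans _ _ (\sum_(0 <= k < n) (e k)%:E)%E).
    by apply: lee_sum => k _; exact: fe.
  by rewrite sumEFin lee_fin.
have ig : P.-integrable setT (fun x => \sum_(0 <= k <oo) g k x)%E.
  apply/integrableP; split.
    by apply: ge0_emeasurable_sum => // k x _ _; exact: g0.
  under eq_integral do rewrite gee0_abs ?nneseries_ge0//.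
  by apply: (le_lt_trans gS); rewrite ltry.
apply: filterS (integrable_ae measurableT ig) => x /(_ I) gx.
have fE : f ^~ x = (fun n => f 0 x + series (fun k => f k.+1 x - f k x) n).
  apply/funext => n; rewrite /series/=; elim: n => [|n IH]; first by rewrite big_geq// addr0.
  by rewrite big_nat_recr//= addrA -IH addrC subrK.
rewrite fE; apply: is_cvgD; first exact: is_cvg_cst.
apply: normed_cvg; apply: nondecreasing_is_cvgn.
  apply: nondecreasing_series => k _ _; exact: normr_ge0.
exists (fine (\sum_(0 <= k <oo) g k x)%E) => _ [n _ <-].
rewrite -lee_fin fineK// /series/= -sumEFin.
exact: nneseries_lim_ge.
Qed.

End sequences.

Lemma cvg_inv_succ (R : realType) (C : R) : C / k.+1%:R @[k --> \oo] --> (0 : R).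
Proof. by rewrite -(mulr0 C); apply: cvgM; [exact: cvg_cst|exact: cvg_harmonic]. Qed.

Lemma cvg_expR_inv_succ (R : realType) (a b : R) :
  expR (a * (b / k.+1%:R)) @[k --> \oo] --> (1 : R).
Proof.
rewrite -[X in _ --> X](@expR0 R).
have : expR (a * (b / k.+1%:R)) @[k --> \oo] --> expR (a * 0).
  apply: continuous_cvg; first exact: continuous_expR.
  by apply: cvgM; [exact: cvg_cst|exact: cvg_inv_succ].
by rewrite mulr0.
Qed.

Section random_product.
Context d (T : measurableType d) (R : realType) (P : probability T R).
Variables (B : nat -> {RV P >-> R}) (p0 c q : R).
Hypotheses (p0_gt0 : 0 < p0) (c_gt0 : 0 < c) (q_gt0 : 0 < q).
Hypothesis indB : mutually_independent B.
Hypothesis betaB : forall n, is_beta (B n) (par p0 c n) q.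
Implicit Types (N M k i : nat) (s : R) (w : T).

Local Notation g := (gain p0 c q).
Local Notation Pi := (product_moment p0 c q).

(** The power of order [s] of the i-th normalised variable.  The cut-off at
    non-positive values matters only on a null set and makes the factor non-negative
    everywhere. *)
Definition factor s i w : R := g i `^ s * ppow s (B i w).
Definition rprod N w : R := \prod_(i < N) factor 1 i w.

Lemma factor_ge0 s i w : 0 <= factor s i w.
Proof. by rewrite mulr_ge0 ?powR_ge0 ?ppow_ge0. Qed.

Lemma measurable_factor s i : measurable_fun setT (factor s i).
Proof.
apply: measurable_funM; first exact: measurable_cst.
by apply: measurable_ppowT; exact: measurable_funP.
Qed.

Lemma rprod_ge0 N w : 0 <= rprod N w.
Proof. by apply: prodr_ge0 => i _; exact: factor_ge0. Qed.

Lemma measurable_rprod N : measurable_fun setT (rprod N).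
Proof. by apply: measurable_bigprod => i; exact: measurable_factor. Qed.

Lemma factor_product_expectation N (s : nat -> R) : (forall i, 0 <= s i) ->
  (\int[P]_w (\prod_(i < N) factor (s i) i w)%:E =
    (\prod_(i < N) (g i `^ s i * beta_moment (par p0 c i) q (s i)))%:E)%E.
Proof.
move=> s0; apply: (independent_product indB N (f := fun i x => g i `^ s i * ppow (s i) x)
  (e := fun i => g i `^ s i * beta_moment (par p0 c i) q (s i))).
- by move=> i; apply: measurable_funM; [exact: measurable_cst|exact: measurable_ppow].
- by move=> i y; rewrite mulr_ge0 ?powR_ge0 ?ppow_ge0.
- move=> i; rewrite ge0_integral_mulc ?powR_ge0//.
  + by rewrite (@beta_expectation _ _ _ _ _ (par p0 c i) q)// par_gt0.
  + by apply: measurable_ppowT; exact: measurable_funP.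
  + by move=> w; exact: ppow_ge0.
Qed.

Lemma ppowM s (x y : R) : 0 <= x -> 0 <= y -> ppow s (x * y) = ppow s x * ppow s y.
Proof.
rewrite le_eqVlt => /predU1P[<- _|x0]; first by rewrite mul0r ppow_le0// mul0r.
rewrite le_eqVlt => /predU1P[<-|y0]; first by rewrite mulr0 ppow_le0// mulr0.
by rewrite !ppowE ?mulr_gt0// powRM// ltW.
Qed.

Lemma ppow_factor s i w : ppow s (factor 1 i w) = factor s i w.
Proof.
have g0 := gain_gt0 p0_gt0 c_gt0 q_gt0 i.
rewrite /factor powRr1 ?(ltW g0)// ppow_scale//; congr (_ * _).
have [b0|b0] := ltP 0 (B i w); last by rewrite !(@ppow_le0 _ _ (B i w))// ppow_le0.
by rewrite (@ppowE _ 1) // powRr1 ?ltW.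
Qed.

Lemma ppow_rprod s N w : ppow s (rprod N w) = \prod_(i < N) factor s i w.
Proof.
rewrite /rprod; elim: N => [|N IH]; first by rewrite !big_ord0 ppowE// powR1.
rewrite !big_ord_recr/= ppowM ?IH ?ppow_factor// ?factor_ge0//.
by apply: prodr_ge0 => i _; exact: factor_ge0.
Qed.

Lemma rprod_expectation s N : 0 <= s -> (\int[P]_w (ppow s (rprod N w))%:E = (Pi N s)%:E)%E.
Proof.
move=> s0; under eq_integral do rewrite ppow_rprod.
exact: (factor_product_expectation N (fun=> s0)).
Qed.

Lemma factor_sqr i w : factor 1 i w * factor 1 i w = factor 2 i w.
Proof.
have -> : 2 = 1 + 1 :> R by ring.
by rewrite /factor mulrACA -ppowD -gt0_powRD// gain_gt0.
Qed.

Lemma rprod_cross N M w : (N <= M)%N ->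
  rprod N w * rprod M w = \prod_(i < M) factor (if (i < N)%N then 2 else 1) i w.
Proof.
move=> NM; rewrite /rprod (big_ord_widen _ (fun i => factor 1 i w) NM) big_mkcond -big_split/=.
by apply: eq_bigr => i _; case: ifP => _; rewrite ?mul1r// factor_sqr.
Qed.

Lemma rprod_cross_expectation N M : (N <= M)%N ->
  (\int[P]_w (rprod N w * rprod M w)%:E = (Pi N 2)%:E)%E.
Proof.
move=> NM; under eq_integral do rewrite rprod_cross//.
rewrite (factor_product_expectation M (s := fun i => if (i < N)%N then 2 else 1)) => [|i]; last by case: ifP.
rewrite /product_moment (big_ord_widen _ (fun i => g i `^ 2 * beta_moment (par p0 c i) q 2) NM).
rewrite [in RHS]big_mkcond; congr EFin; apply: eq_bigr => i _.
by case: ifP => // _; exact: mean1.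
Qed.

(** Orthogonality of martingale increments: the factors have mean 1, so the mixed
    moment is the second moment of the shorter product. *)
Lemma rprod_increment N M : (N <= M)%N ->
  (\int[P]_w ((rprod M w - rprod N w) ^+ 2)%:E = (Pi M 2 - Pi N 2)%:E)%E.
Proof.
move=> NM; pose I := (\int[P]_w ((rprod M w - rprod N w) ^+ 2)%:E)%E.
have mM := measurable_rprod M; have mN := measurable_rprod N.
have mc : measurable_fun setT (fun w => rprod N w * rprod M w) by exact: measurable_funM.
have mcE : measurable_fun setT (fun w => (rprod N w * rprod M w)%:E) by exact: measurable_EFinT.
have mmE : measurable_fun setT (fun w => (rprod M w * rprod M w)%:E).
  by apply: measurable_EFinT; exact: measurable_funM.
have mnE : measurable_fun setT (fun w => (rprod N w * rprod N w)%:E).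
  by apply: measurable_EFinT; exact: measurable_funM.
have mdE : measurable_fun setT (fun w => ((rprod M w - rprod N w) ^+ 2)%:E).
  by apply: measurable_EFinT; apply: measurable_funX; exact: measurable_funB.
have cross0 K L w : (0 <= (rprod K w * rprod L w)%:E)%E by rewrite lee_fin mulr_ge0 ?rprod_ge0.
have sq0 w : (0 <= ((rprod M w - rprod N w) ^+ 2)%:E)%E by rewrite lee_fin sqr_ge0.
have : (I + ((Pi N 2)%:E + (Pi N 2)%:E) = (Pi M 2)%:E + (Pi N 2)%:E)%E.
  rewrite -{1 2}(rprod_cross_expectation NM) -(rprod_cross_expectation (leqnn M)).
  rewrite -(rprod_cross_expectation (leqnn N)) /I -!ge0_integralD//=.
  - apply: eq_integral => w _; rewrite -!EFinD; congr EFin.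
    by move: (rprod M w) (rprod N w) => x y; ring.
  - by move=> w _; rewrite adde_ge0 ?cross0.
  - exact: emeasurable_funD.
rewrite -!EFinD -/I => H.
have If : I \is a fin_num.
  have I0 : (0 <= I)%E by apply: integral_ge0 => w _; exact: sq0.
  by rewrite ge0_fin_numE//; move: H; case: (I) => // x _; rewrite ltry.
move: H; rewrite -(fineK If) -EFinD => H; have {}H := EFin_inj H; congr EFin.
by move: H; move: (fine I) (Pi N 2) (Pi M 2) => x y z H; lra.
Qed.

Lemma rprod_abs_increment N M (e : R) : (N <= M)%N -> 0 < e ->
  (\int[P]_w (`|rprod M w - rprod N w|)%:E <= ((e + (Pi M 2 - Pi N 2) / e) / 2)%:E)%E.
Proof.
move=> NM e0.
have md : measurable_fun setT (fun w => rprod M w - rprod N w).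
  by apply: measurable_funB; exact: measurable_rprod.
have c0 : 0 <= (2 * e)^-1 by rewrite invr_ge0 mulr_ge0// ltW.
apply: (@le_trans _ _ (\int[P]_w ((e / 2)%:E + ((2 * e)^-1 * (rprod M w - rprod N w) ^+ 2)%:E))%E).
  apply: ge0_le_integral => //.
  - by apply: measurable_EFinT; exact: measurableT_comp.
  - apply: emeasurable_funD; first exact: measurable_cst.
    by apply: measurable_EFinT; apply: measurable_funM; [exact: measurable_cst|exact: measurable_funX].
  - move=> w _; rewrite -EFinD lee_fin -(real_normK (num_real (rprod M w - rprod N w))).
    move: `|_| => x.
    (* x <= (e + x^2 / e) / 2, by completing the square *)
    have -> : e / 2 + (2 * e)^-1 * x ^+ 2 = x + (2 * e)^-1 * (x - e) ^+ 2.
      by field; rewrite gt_eqF.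
    by rewrite lerDl mulr_ge0// sqr_ge0.
rewrite ge0_integralD//.
- rewrite prob_integral_cst ge0_integral_mulc//; last by move=> w; rewrite sqr_ge0.
    by rewrite rprod_increment// -EFinM -EFinD lee_fin; apply: eq_ler; field; rewrite gt_eqF.
  exact: measurable_funX.
- by move=> w _; rewrite lee_fin divr_ge0// ltW.
- by move=> w _; rewrite lee_fin mulr_ge0// sqr_ge0.
- by apply: measurable_EFinT; apply: measurable_funM; [exact: measurable_cst|exact: measurable_funX].
Qed.

(** Sparse enough for the increments of the martingale to be summable in L^1, and dense
    enough for consecutive values of [scale] to have ratio tending to 1. *)
Definition sub_index k := (k.+1 ^ 4)%N.

Lemma sub_index_lt k : (sub_index k < sub_index k.+1)%N.
Proof. by rewrite ltn_exp2r. Qed.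

Lemma sub_index_gap k : ((sub_index k.+1 - sub_index k)%N%:R : R) <= 15 * k.+1%:R ^+ 3.
Proof.
rewrite natrB ?(ltnW (sub_index_lt k))// /sub_index !natrX -[k.+2%:R]natr1.
have : 1 <= k.+1%:R :> R by rewrite ler1n.
move: (k.+1%:R : R) => x x1.
have x2 : x <= x ^+ 2 by rewrite expr2 ler_peMl// (le_trans ler01).
have x3 : x ^+ 2 <= x ^+ 3 by rewrite [leRHS]exprS ler_peMl// sqr_ge0.
have -> : (x + 1) ^+ 4 - x ^+ 4 = 4 * x ^+ 3 + 6 * x ^+ 2 + 4 * x + 1 by ring.
by move: (x ^+ 3) (x ^+ 2) x2 x3 => y z *; lra.
Qed.

Lemma inv_sqr_le k : (k.+1%:R ^+ 2)^-1 <= 2 * (k.+1%:R^-1 - k.+2%:R^-1) :> R.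
Proof.
have z0 := ler0n R k; rewrite -[k.+2%:R]natr1 -[k.+1%:R]natr1.
move: (k%:R : R) z0 => z z0.
have z1 : 0 < z + 1 by rewrite ltr_wpDl.
have z2 : 0 < z + 1 + 1 by rewrite addr_gt0.
have -> : 2 * ((z + 1)^-1 - (z + 1 + 1)^-1) = ((z + 1) * ((z + 1 + 1) / 2))^-1.
  by field; rewrite !gt_eqF.
rewrite lef_pV2 ?posrE ?mulr_gt0 ?exprn_gt0 ?invr_gt0// expr2 ler_pM2l//.
by rewrite ler_pdivrMr// mulr_natr mulr2n lerD2l lerDr.
Qed.

Lemma rprod_subsequence_ae : {ae P, forall w, cvgn (fun k => rprod (sub_index k) w)}.
Proof.
pose K := incr_const p0 c q.
have K0 : 0 <= K.
  by rewrite /K /incr_const mulr_ge0 ?expR_ge0// ltW// var_const_gt0.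
pose C := (1 + K) / 2.
have C0 : 0 <= C by rewrite divr_ge0// addr_ge0.
apply: (@ae_cvg_summable R _ T P (fun k => rprod (sub_index k)) (fun k => C / k.+1%:R ^+ 2) (2 * C)).
- by move=> k; exact: measurable_rprod.
- move=> k.
  have k0 : 0 < k.+1%:R :> R by [].
  (* the parameter of rprod_abs_increment: it makes both of its terms of order k^-2,
     since the second moments differ by O(k^-4) *)
  have e0 : 0 < (k.+1%:R ^+ 2)^-1 :> R by rewrite invr_gt0 exprn_gt0.
  apply: (le_trans (rprod_abs_increment (ltnW (sub_index_lt k)) e0)).
  rewrite lee_fin invrK.
  have : Pi (sub_index k.+1) 2 - Pi (sub_index k) 2 <= K / k.+1%:R ^+ 4.
    apply: (le_trans (second_moment_increment p0_gt0 c_gt0 q_gt0 (ltnW (sub_index_lt k)))).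
    rewrite -/K ler_wpM2l//; apply: (@le_trans _ _ (sub_index k).+1%:R^-1).
      by rewrite lerBlDr lerDl invr_ge0.
    rewrite lef_pV2 ?posrE ?exprn_gt0// -natrX ler_nat; exact: leqnSn.
  move: (_ - _) => D DK.
  apply: (@le_trans _ _ (((k.+1%:R ^+ 2)^-1 + K / k.+1%:R ^+ 4 * k.+1%:R ^+ 2) / 2)).
    by rewrite ler_pM2r ?invr_gt0// lerD2l ler_pM2r// exprn_gt0.
  apply: eq_ler; rewrite /C; move: k0; move: (k.+1%:R : R) => x x0; field; rewrite gt_eqF//.
- move=> n; apply: (@le_trans _ _ (2 * C * (1 - n.+1%:R^-1))); last first.
    by rewrite -[leRHS]mulr1; apply: ler_wpM2l; [exact: mulr_ge0|rewrite gerBl invr_ge0].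
  elim: n => [|n IH]; first by rewrite big_geq// invr1 subrr mulr0.
  rewrite big_nat_recr//=.
  have S : C / n.+1%:R ^+ 2 <= 2 * C * (n.+1%:R^-1 - n.+2%:R^-1).
    have -> : 2 * C * (n.+1%:R^-1 - n.+2%:R^-1) = C * (2 * (n.+1%:R^-1 - n.+2%:R^-1)).
      by rewrite -mulrA mulrCA.
    by rewrite ler_wpM2l// inv_sqr_le.
  apply: (le_trans (lerD IH S)); apply: eq_ler; ring.
Qed.

Lemma rprod_scale N w : rprod N w = scale p0 c q N * \prod_(i < N) ppow 1 (B i w).
Proof.
rewrite /rprod /scale -big_split/=; apply: eq_bigr => i _.
by rewrite /factor powRr1// ltW// gain_gt0.
Qed.

(** Where all [B i] lie between 0 and 1, [scale] is nondecreasing and the product of the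
    [B i] nonincreasing, so convergence along [sub_index] suffices. *)
Lemma rprod_cvg_ae : {ae P, forall w, cvgn (rprod ^~ w)}.
Proof.
have bae : {ae P, forall w, forall i, 0 < B i w < 1}.
  by apply: ae_foralln => i; exact: (beta_ae (betaB i)).
apply: filterS2 bae rprod_subsequence_ae => w bw cw.
pose r k := expR (q / Num.min p0 c * (15 / k.+1%:R)) : R.
apply: (cvgP (limn (fun k => rprod (sub_index k) w))).
have m0 : 0 < Num.min p0 c by rewrite lt_min p0_gt0.
pose b N := \prod_(i < N) ppow 1 (B i w).
have b0 N : 0 <= b N by apply: prodr_ge0 => i _; exact: ppow_ge0.
have E : (fun N => rprod N w) = (fun N => scale p0 c q N * b N).
  by apply/funext => N; rewrite rprod_scale.
rewrite E; apply: (@monotone_sandwich _ (scale p0 c q) b r sub_index).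
- exact: scale_gt0.
- exact: scale_nd.
- exact: b0.
- move=> N M /subnKC <-; elim: (M - N)%N => [|k IH]; first by rewrite addn0.
  rewrite addnS; apply: le_trans IH; rewrite /b big_ord_recr/=.
  rewrite ler_piMr//; first exact: b0.
  by have /andP[b1 b2] := bw (N + k)%N; rewrite ppowE// powRr1 ?ltW.
- exact: sub_index_lt.
- move=> k; apply: (le_trans (scale_le p0_gt0 c_gt0 q_gt0 (ltnW (sub_index_lt k)))).
  rewrite ler_wpM2r ?(ltW (scale_gt0 p0_gt0 c_gt0 q_gt0 _))// /r ler_expR ler_wpM2l//.
    by rewrite divr_ge0// ltW.
  have k0 : 0 < k.+1%:R :> R by [].
  apply: (@le_trans _ _ (15 * k.+1%:R ^+ 3 / k.+1%:R ^+ 4)).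
    apply: ler_pM; [by []|by rewrite invr_ge0|exact: sub_index_gap|].
    rewrite lef_pV2 ?posrE ?exprn_gt0// -natrX ler_nat; exact: leqnSn.
  by apply: eq_ler; move: k0; move: (k.+1%:R : R) => x x0; field; rewrite gt_eqF.
- exact: cvg_expR_inv_succ.
- have -> : (fun k => scale p0 c q (sub_index k) * b (sub_index k)) = (fun k => rprod (sub_index k) w).
    by apply/funext => k; rewrite rprod_scale.
  exact: cw.
Qed.

(** The partial products are replaced by 0 on a null set, so that the limit exists
    everywhere and is measurable. *)
Lemma limit_exists : exists Z : {RV P >-> R}, (forall w, 0 <= Z w) /\
  {ae P, forall w, rprod N w @[N --> \oo] --> Z w}.
Proof.
have [A [mA A0 HA]] := rprod_cvg_ae.
pose f N w := if w \in A then 0 else rprod N w.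
have cf w : f N w @[N --> \oo] --> limn (f ^~ w).
  have [wA|wA] := boolP (w \in A).
    have -> : f ^~ w = fun=> 0 by apply/funext => N; rewrite /f wA.
    exact: is_cvg_cst.
  have -> : f ^~ w = rprod ^~ w by apply/funext => N; rewrite /f (negbTE wA).
  by apply: contrapT => H; move/negP: wA; apply; apply/mem_set/HA.
have mf N : measurable_fun setT (f N).
  apply: measurable_fun_ifT; [|exact: measurable_cst|exact: measurable_rprod].
  apply: (measurable_fun_bool true); rewrite setTI.
  by rewrite (_ : _ @^-1` _ = A)//; apply/seteqP; split => w /=; [move=> /set_mem|move=> /mem_set].
have mZ : measurable_fun setT (fun w => limn (f ^~ w)).
  by apply: (measurable_fun_cvg mf) => w _; exact: cf.
exists (mfun_Sub (mem_set mZ)); split => [w|] /=.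
  apply: limr_ge; first exact: cf.
  by apply: nearW => N; rewrite /f; case: ifP => // _; exact: rprod_ge0.
exists A; split => // w /= H; apply: contrapT => wA; apply: H.
have wA' : (w \in A) = false by apply/negP => /set_mem.
by have := cf w; rewrite {1}/f wA'.
Qed.

End random_product.

Lemma cvg_upper_bound (R : realType) (u : nat -> R) (l : R) : u n @[n --> \oo] --> l ->
  exists2 K, 0 < K & forall n, u n <= K.
Proof.
move=> ul; have [M [_ HM]] := cvg_seq_bounded (cvgP _ ul).
exists (`|M| + 1) => [|n]; first by rewrite ltr_wpDl.
exact: le_trans (ler_norm _) (HM (`|M| + 1) (ltr_pwDr ltr01 (ler_norm _)) n I).
Qed.

(** * Moments and law of the infinite products *)

Section moment_limit.
Context d (T : measurableType d) (R : realType) (P : {measure set T -> \bar R}).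
Hypothesis P1 : (P setT = 1)%E.

(** A bound on second moments gives uniform integrability: truncation at [L]
    changes the integrals by at most [K / L], and bounded convergence applies to the
    truncated functions. *)
Lemma integral_cvg_bounded_sqr (f_ : nat -> T -> R) (f : T -> R) (a_ : nat -> R) (K : R) :
  (forall n, measurable_fun setT (f_ n)) -> (forall n w, 0 <= f_ n w) ->
  measurable_fun setT f -> (forall w, f_ n w @[n --> \oo] --> f w) ->
  (forall n, (\int[P]_w (f_ n w)%:E = (a_ n)%:E)%E) ->
  (forall n, (\int[P]_w (f_ n w ^+ 2)%:E <= K%:E)%E) ->
  exists2 l, (\int[P]_w (f w)%:E = l%:E)%E & a_ n @[n --> \oo] --> l.
Proof.
move=> mf_ f0_ mf cf fa fK.
have f0 w : 0 <= f w.
  rewrite -(cvg_lim (@Rhausdorff R) (cf w)); apply: limr_ge; first exact: cvgP (cf w).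
  exact: nearW.
have K0 : 0 <= K.
  rewrite -lee_fin; apply: le_trans (fK 0%N); apply: integral_ge0 => w _.
  by rewrite lee_fin sqr_ge0.
pose m_ n (L : R) := fine (\int[P]_w (Num.min (f_ n w) L)%:E)%E.
pose m (L : R) := fine (\int[P]_w (Num.min (f w) L)%:E)%E.
have mmin (h : T -> R) L : measurable_fun setT h -> measurable_fun setT (fun w => Num.min (h w) L).
  by move=> mh; apply: measurable_minr => //; exact: measurable_cst.
have minE (h : T -> R) L : measurable_fun setT h -> (forall w, 0 <= h w) -> 0 <= L ->
    (\int[P]_w (Num.min (h w) L)%:E)%E \is a fin_num.
  move=> mh h0 L0; rewrite ge0_fin_numE; last first.
    by apply: integral_ge0 => w _; rewrite lee_fin le_min h0.
  apply: (@le_lt_trans _ _ (\int[P]_w (cst L%:E w))%E).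
    apply: ge0_le_integral => //.
    - by move=> w _; rewrite lee_fin le_min h0.
    - by apply: measurable_EFinT; exact: mmin.
    - by move=> w _; rewrite lee_fin ge_min lexx orbT.
  by rewrite integral_cst// P1 mule1 ltry.
have m_m L : 0 < L -> m_ n L @[n --> \oo] --> m L.
  move=> L0; have L0' := ltW L0.
  (* rescaled to the unit interval, where bounded_convergence applies *)
  pose h_ n w := L^-1 * Num.min (f_ n w) L; pose h w := L^-1 * Num.min (f w) L.
  have bnd (x : R) : 0 <= x -> 0 <= L^-1 * Num.min x L <= 1.
    move=> x0; rewrite mulr_ge0 ?invr_ge0 ?le_min ?x0//=.
    by rewrite ler_pdivrMl// mulr1 ge_min lexx orbT.
  have := @bounded_convergence _ T R P P1 h_ h.
  have hE (k : T -> R) : measurable_fun setT k -> (forall w, 0 <= k w) ->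
      (\int[P]_w (L^-1 * Num.min (k w) L)%:E = (L^-1 * fine (\int[P]_w (Num.min (k w) L)%:E))%:E)%E.
    move=> mk k0; rewrite ge0_integral_mulc ?invr_ge0//; first by rewrite -[in LHS](fineK (minE _ _ mk k0 L0')) -EFinM.
      exact: mmin.
    by move=> w; rewrite le_min k0.
  rewrite /h_ /h => H.
  have {}H : (L^-1 * m_ n L)%:E @[n --> \oo] --> (L^-1 * m L)%:E.
    rewrite /m -hE//; under eq_fun do rewrite /m_ -hE//.
    apply: H.
    - by move=> n; apply: measurable_funM; [exact: measurable_cst|exact: mmin].
    - by apply: measurable_funM; [exact: measurable_cst|exact: mmin].
    - by move=> n w; exact: bnd.
    - move=> w; apply: cvgM; first exact: cvg_cst.
      apply: (@continuous_cvg _ _ _ _ _ _ (fun y : R => Num.min y L)) => //.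
      by apply: continuous_min; [exact: cvg_id|exact: cvg_cst].
  have {}H := fine_cvg H.
  have : L * (L^-1 * m_ n L) @[n --> \oo] --> L * (L^-1 * m L).
    by apply: cvgM; [exact: cvg_cst|exact: H].
  by rewrite mulVKf ?gt_eqF//; under eq_fun do rewrite mulVKf ?gt_eqF//.
have mfE n : measurable_fun setT (fun w => (f_ n w)%:E) by exact: measurable_EFinT.
have lo n L : 0 < L -> m_ n L <= a_ n.
  move=> L0; rewrite -lee_fin fineK ?minE ?(ltW L0)// -fa; apply: ge0_le_integral => //.
  - by move=> w _; rewrite lee_fin le_min f0_ ltW.
  - by apply: measurable_EFinT; exact: mmin.
  - by move=> w _; rewrite lee_fin ge_min lexx.
have up n L : 0 < L -> a_ n <= m_ n L + K / L.
  move=> L0; have L0' := ltW L0.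
  rewrite -lee_fin EFinD fineK ?minE// -fa.
  have mm : measurable_fun setT (fun w => (Num.min (f_ n w) L)%:E).
    by apply: measurable_EFinT; exact: mmin.
  have ms : measurable_fun setT (fun w => (L^-1 * (f_ n w) ^+ 2)%:E).
    by apply: measurable_EFinT; apply: measurable_funM; [exact: measurable_cst|exact: measurable_funX].
  apply: (@le_trans _ _ (\int[P]_w ((Num.min (f_ n w) L)%:E + (L^-1 * (f_ n w) ^+ 2)%:E))%E).
    apply: ge0_le_integral => //.
    - by move=> w _; rewrite lee_fin f0_.
    - exact: emeasurable_funD.
    - move=> w _; rewrite -EFinD lee_fin; have := f0_ n w; move: (f_ n w) => x x0.
      have [xL|Lx] := leP x L.
        by rewrite lerDl mulr_ge0 ?invr_ge0// sqr_ge0.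
      apply: (@le_trans _ _ (L^-1 * x ^+ 2)); last by rewrite lerDr.
      by rewrite ler_pdivlMl// expr2 ler_wpM2r// ltW.
  rewrite ge0_integralD//.
  - rewrite leeD2l// ge0_integral_mulc ?invr_ge0//; last by move=> w; rewrite sqr_ge0.
      by rewrite (mulrC K) EFinM lee_pmul2l ?lte_fin ?invr_gt0.
    exact: measurable_funX.
  - by move=> w _; rewrite lee_fin le_min f0_.
  - by move=> w _; rewrite lee_fin mulr_ge0 ?invr_ge0// sqr_ge0.
have a1 n : a_ n <= 1 + K.
  have := up n 1 ltr01; rewrite divr1 => /le_trans; apply; rewrite lerD2r.
  rewrite -lee_fin fineK ?minE//; apply: (@le_trans _ _ (\int[P]_w (cst 1%:E w))%E).
    apply: ge0_le_integral => //.
    - by move=> w _; rewrite lee_fin le_min f0_ ler01.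
    - by apply: measurable_EFinT; exact: mmin.
    - by move=> w _; rewrite lee_fin ge_min lexx orbT.
  by rewrite integral_cst// P1 mule1.
have m1 L : 0 < L -> m L <= 1 + K.
  move=> L0; rewrite -(cvg_lim (@Rhausdorff R) (m_m L L0)).
  apply: limr_le; first exact: cvgP (m_m L L0).
  by apply: nearW => n; exact: le_trans (lo n L L0) (a1 n).
have mono : (m n.+1%:R)%:E @[n --> \oo] --> (\int[P]_w (f w)%:E)%E.
  have := @cvg_monotone_convergence _ T R P setT measurableT
    (fun n w => (Num.min (f w) n.+1%:R)%:E).
  have -> : (\int[P]_w (f w)%:E)%E =
      (\int[P]_w limn (fun n => (Num.min (f w) n.+1%:R)%:E))%E.
    apply: eq_integral => w _; apply/esym/cvg_lim => //; apply: cvg_near_cst.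
    near=> n; congr EFin; apply/min_idPl; near: n.
    exists (Num.truncn (f w)) => // n /= wn.
    by apply: (le_trans (ltW (truncnS_gt _))); rewrite ler_nat.
  have -> : (fun n => (m n.+1%:R)%:E) = (fun n => \int[P]_w (Num.min (f w) n.+1%:R)%:E)%E.
    by apply/funext => n; rewrite /m fineK// minE.
  apply.
  - by move=> n; apply: measurable_EFinT; exact: mmin.
  - by move=> n w _; rewrite lee_fin le_min f0 /=.
  - move=> w _ n k nk; rewrite lee_fin le_min !ge_min lexx/=.
    by rewrite ler_nat ltnS nk orbT.
have fin : (\int[P]_w (f w)%:E)%E \is a fin_num.
  rewrite ge0_fin_numE; last by apply: integral_ge0 => w _; rewrite lee_fin f0.
  apply: (@le_lt_trans _ _ (1 + K)%:E); last exact: ltry.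
  rewrite -(cvg_lim _ mono)//; apply: lime_le; first exact: cvgP mono.
  by apply: nearW => n; rewrite lee_fin m1.
exists (fine (\int[P]_w (f w)%:E)%E); first by rewrite fineK.
move: mono; rewrite -(fineK fin); move: (fine _) => l /fine_cvg/= mono.
apply/cvgrPdist_le => e e0.
have e3 : 0 < e / 3 by rewrite divr_gt0.
have [k [Hk1 Hk2]] : exists k, `|l - m k.+1%:R| <= e / 3 /\ K / k.+1%:R <= e / 3.
  have [k1 _ H1] := (proj1 (cvgrPdist_le _ _) mono) _ e3.
  have [k2 _ H2] := (proj1 (cvgrPdist_le _ _) (cvg_inv_succ K)) _ e3.
  exists (maxn k1 k2); split; first by apply: H1 => /=; rewrite leq_maxl.
  have := H2 (maxn k1 k2) (leq_maxr _ _); rewrite sub0r normrN.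
  by apply: le_trans; exact: ler_norm.
have L0 : 0 < k.+1%:R :> R by [].
apply: filterS ((proj1 (cvgrPdist_le _ _) (m_m _ L0)) _ e3) => n Hn.
have := lo n _ L0; have := up n _ L0.
move: Hk1 Hn Hk2; rewrite !ler_norml.
move: (m k.+1%:R) (m_ n k.+1%:R) (a_ n) (K / k.+1%:R) => x y z t.
move=> /andP[h1 h2] /andP[h3 h4] h5 h6 h7.
clear e0 e3 L0 m1 a1 up lo m_m mono fin.
apply/andP; split; lra.
Unshelve. all: by end_near. Qed.

End moment_limit.

Section mpow_theory.
Variable R : realType.
Implicit Types s x y : R.

Lemma mpow_sqr s x : 0 <= s -> mpow s x ^+ 2 = mpow (s + s) x.
Proof.
move=> s0; have [->|sn] := eqVneq s 0; first by rewrite addr0 mpow0 expr1n.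
have s_gt0 : 0 < s by rewrite lt0r sn.
by rewrite !mpowE ?addr_gt0// ppowD.
Qed.

Lemma mpow_scale s c x : 0 <= s -> 0 < c -> mpow s (c * x) = c `^ s * mpow s x.
Proof.
move=> s0 c0; have [->|sn] := eqVneq s 0; first by rewrite !mpow0 powRr0 mulr1.
have s_gt0 : 0 < s by rewrite lt0r sn.
by rewrite !mpowE// ppow_scale.
Qed.

Lemma ppow_cvg s (u : nat -> R) x : 0 < s -> (forall n, 0 <= u n) ->
  u n @[n --> \oo] --> x -> ppow s (u n) @[n --> \oo] --> ppow s x.
Proof.
move=> s0 u0 ux.
have x0 : 0 <= x.
  rewrite -(cvg_lim (@Rhausdorff R) ux); apply: limr_ge; first exact: cvgP ux.
  exact: nearW.
have [xp|xn] := ltP 0 x; last first.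
  have -> : x = 0 by apply/eqP; rewrite eq_le xn x0.
  rewrite (ppow_le0 _ (lexx 0)); apply/cvgrPdist_lt => e e0.
  have e1 : 0 < e `^ s^-1 by rewrite powR_gt0.
  near=> n; rewrite sub0r normrN ger0_norm ?ppow_ge0//.
  have [un|un] := ltP 0 (u n); last by rewrite ppow_le0.
  rewrite ppowE//.
  have -> : e = (e `^ s^-1) `^ s by rewrite -powRrM mulVf ?gt_eqF// powRr1// ltW.
  rewrite gt0_ltr_powR ?nnegrE ?(ltW un) ?(ltW e1)//.
  near: n; apply: (cvgr_lt _ ux).
  by rewrite (le_lt_trans xn).
rewrite ppowE// /powR gt_eqF//.
have : expR (s * ln (u n)) @[n --> \oo] --> expR (s * ln x).
  apply: continuous_cvg; first exact: continuous_expR.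
  apply: cvgM; first exact: cvg_cst.
  by apply: continuous_cvg => //; exact: continuous_ln.
apply: cvg_trans; apply: near_eq_cvg; near=> n.
have un : 0 < u n by near: n; exact: (cvgr_gt _ ux).
by rewrite ppowE// /powR gt_eqF.
Unshelve. all: by end_near. Qed.

Lemma mpow_cvg s (u : nat -> R) x : 0 <= s -> (forall n, 0 <= u n) ->
  u n @[n --> \oo] --> x -> mpow s (u n) @[n --> \oo] --> mpow s x.
Proof.
move=> s0 u0 ux; have [->|sn] := eqVneq s 0.
  by rewrite mpow0; under eq_fun do rewrite mpow0; exact: cvg_cst.
have s_gt0 : 0 < s by rewrite lt0r sn.
by rewrite mpowE//; under eq_fun do rewrite mpowE//; exact: ppow_cvg.
Qed.

End mpow_theory.

Section product_limit.
Context d (T : measurableType d) (R : realType) (P : probability T R).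
Variables (B : nat -> {RV P >-> R}) (p0 c q : R).
Hypotheses (p0_gt0 : 0 < p0) (c_gt0 : 0 < c) (q_gt0 : 0 < q).
Hypothesis indB : mutually_independent B.
Hypothesis betaB : forall n, is_beta (B n) (par p0 c n) q.
Variable Z : {RV P >-> R}.

Hypothesis Zlim : {ae P, forall w, rprod B p0 c q N w @[N --> \oo] --> Z w}.
Implicit Types (N k : nat) (s t : R).

Local Notation Pi := (product_moment p0 c q).
Local Notation rprod := (rprod B p0 c q).

Lemma rprod_mpow_expectation s N : 0 <= s -> (\int[P]_w (mpow s (rprod N w))%:E = (Pi N s)%:E)%E.
Proof.
move=> s0; have [->|sn] := eqVneq s 0.
  under eq_integral do rewrite mpow0.
  by rewrite product_moment0// prob_integral_cst.
have s_gt0 : 0 < s by rewrite lt0r sn.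
by under eq_integral do rewrite mpowE//; rewrite rprod_expectation.
Qed.

(** For integer orders this follows from the convergence in [unit_recursion]; an
    order in between is bounded by [1] plus the next integer moment. *)
Lemma product_moment_bounded t : 0 <= t -> exists K, forall N, Pi N t <= K.
Proof.
move=> t0.
have H k : exists2 K, 0 < K & forall N, Pi N k%:R <= K.
  elim: k => [|k [K K0 IH]]; first by exists 1 => // N; rewrite product_moment0.
  have k0 := ler0n R k.
  have [K' K'0 HK'] := cvg_upper_bound (unit_recursion p0_gt0 c_gt0 q_gt0 k0).
  exists (K' * K) => [|N]; first exact: mulr_gt0.
  rewrite -natr1 product_momentS//.
  apply: (@le_trans _ _ (K' * Pi N k%:R)).
    by rewrite ler_wpM2r ?HK'// ltW// product_moment_gt0.
  by rewrite ler_wpM2l ?IH// ltW.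
have [K _ HK] := H (Num.truncn t).+1.
exists (1 + K) => N; apply: (@le_trans _ _ (1 + Pi N (Num.truncn t).+1%:R)); last by rewrite lerD2l.
have tk : t <= (Num.truncn t).+1%:R by rewrite ltW// truncnS_gt.
rewrite -lee_fin EFinD -!rprod_mpow_expectation//.
have mm s : measurable_fun setT (fun w => (mpow s (rprod N w))%:E).
  apply: measurable_EFinT; apply: measurableT_comp; first exact: measurable_mpow.
  exact: measurable_rprod.
apply: (@le_trans _ _ (\int[P]_w (1%:E + (mpow (Num.truncn t).+1%:R (rprod N w))%:E))%E).
  apply: ge0_le_integral => //.
  - by move=> w _; rewrite lee_fin mpow_ge0.
  - exact: emeasurable_funD.
  - by move=> w _; rewrite -EFinD lee_fin mpow_le1D.
rewrite ge0_integralD//; last by move=> w _; rewrite lee_fin mpow_ge0.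
by rewrite leeD2r// prob_integral_cst.
Qed.

(** Convergence of the moments follows from [integral_cvg_bounded_sqr], the second
    moments being moments of order [2 s]. *)
Lemma limit_moment s : 0 <= s ->
  exists2 l, (\int[P]_w (mpow s (Z w))%:E = l%:E)%E & Pi N s @[N --> \oo] --> l.
Proof.
move=> s0; have [A [mA A0 HA]] := Zlim.
pose r N w := if w \in A then 0 else rprod N w.
(* on the exceptional null set everything is replaced by 0, to have convergence at
     every point *)
pose Z' w := if w \in A then 0 else Z w.
have mif (h : T -> R) : measurable_fun setT h -> measurable_fun setT (fun w => if w \in A then 0 else h w).
  move=> mh; apply: measurable_fun_ifT; [|exact: measurable_cst|exact: mh].
  apply: (measurable_fun_bool true); rewrite setTI.
  by rewrite (_ : _ @^-1` _ = A)//; apply/seteqP; split => w /=; [move=> /set_mem|move=> /mem_set].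
have mr N : measurable_fun setT (r N) by apply: mif; exact: measurable_rprod.
have mZ' : measurable_fun setT Z' by apply: mif; exact: measurable_funP.
have mm (t : R) (h : T -> R) : measurable_fun setT h -> measurable_fun setT (fun w => mpow t (h w)).
  by move=> mh; apply: measurableT_comp => //; exact: measurable_mpow.
have aeq (t : R) (h : T -> R) : measurable_fun setT h ->
    (\int[P]_w (mpow t (if w \in A then 0 else h w))%:E = \int[P]_w (mpow t (h w))%:E)%E.
  move=> mh; apply: ae_eq_integral => //.
  - by apply: measurable_EFinT; apply: mm; exact: mif.
  - by apply: measurable_EFinT; exact: mm.
  - exists A; split => // w /= H; apply: contrapT => wA; apply: H => _.
    by have -> : (w \in A) = false by apply/negP => /set_mem.
have r0 N w : 0 <= r N w by rewrite /r; case: ifP => // _; apply: rprod_ge0.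
have rZ w : r N w @[N --> \oo] --> Z' w.
  rewrite /r /Z'; have [wA|wA] := boolP (w \in A); first exact: cvg_cst.
  by apply: contrapT => H; move/negP: wA; apply; apply/mem_set/HA.
have [K HK] := product_moment_bounded (addr_ge0 s0 s0).
have fK N : (\int[P]_w (mpow s (r N w) ^+ 2)%:E <= K%:E)%E.
  under eq_integral do rewrite mpow_sqr//.
  rewrite aeq; last exact: measurable_rprod.
  by rewrite rprod_mpow_expectation ?addr_ge0// lee_fin.
have [l El cl] := @integral_cvg_bounded_sqr _ T R P (probability_setT P)
  (fun N w => mpow s (r N w)) (fun w => mpow s (Z' w)) (fun N => Pi N s) K
  (fun N => mm _ _ (mr N)) (fun N w => mpow_ge0 _ _) (mm _ _ mZ')
  (fun w => mpow_cvg s0 (fun N => r0 N w) (rZ w))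
  (fun N => etrans (aeq s _ (measurable_rprod B p0 c q N)) (rprod_mpow_expectation N s0)) fK.
by exists l => //; rewrite -El aeq//; exact: measurable_funP.
Qed.

Lemma limit_unit_recursion s : 0 <= s ->
  (\int[P]_w (mpow (s + 1) (Z w))%:E = (unit_const p0 c q s)%:E * \int[P]_w (mpow s (Z w))%:E)%E.
Proof.
move=> s0; have [l1 -> c1] := limit_moment (addr_ge0 s0 ler01); have [l ->  cl] := limit_moment s0.
have c2 : Pi N (s + 1) @[N --> \oo] --> unit_const p0 c q s * l.
  under eq_fun do rewrite product_momentS//.
  by apply: cvgM => //; exact: unit_recursion.
by rewrite -EFinM; congr EFin; exact: (cvg_unique _ c1 c2).
Qed.

Lemma limit_shift_recursion s : 0 <= s ->
  (\int[P]_w (mpow (s + c) (Z w))%:E = (shift_const p0 c q s)%:E * \int[P]_w (mpow s (Z w))%:E)%E.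
Proof.
move=> s0; have [l1 -> c1] := limit_moment (addr_ge0 s0 (ltW c_gt0)); have [l ->  cl] := limit_moment s0.
have c2 : Pi N (s + c) @[N --> \oo] --> shift_const p0 c q s * l.
  under eq_fun do rewrite product_moment_shift//.
  by apply: cvgM => //; exact: shift_recursion.
by rewrite -EFinM; congr EFin; exact: (cvg_unique _ c1 c2).
Qed.

End product_limit.

Section product_laws.
Context d (T : measurableType d) (R : realType) (P : probability T R).
Variables (a alpha : R).
Hypotheses (a0 : 0 < a) (alpha0 : 0 < alpha).
Local Notation mT := (measurableTypeR R).
Local Notation m := (a + alpha).

Lemma moment_law_of (Y : T -> R) : measurable_fun setT Y -> (forall w, 0 <= Y w) ->
  (forall s, 0 <= s -> (\int[P]_w (mpow (s + a) (Y w))%:E =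
    (ratio a alpha s)%:E * \int[P]_w (mpow s (Y w))%:E)%E) ->
  exists nu : {measure set mT -> \bar R}, is_moment_law a alpha nu /\
    forall A : set R, measurable A -> nu A = P (Y @^-1` A).
Proof.
move=> mY Y0 fe.
have [nu [nuA nuI]] := @pushforward_exists _ T R _ mT P Y mY.
exists nu; split => //; split.
- by rewrite nuA preimage_setT; exact: probability_setT.
- rewrite nuA (_ : Y @^-1` _ = set0) ?measure0//.
  by apply/seteqP; split => w //=; rewrite ltNge Y0.
- have I s : (\int[nu]_y (mpow s y)%:E = \int[P]_w (mpow s (Y w))%:E)%E.
    rewrite nuI//; first by apply: measurable_EFinT; exact: measurable_mpow.
    by move=> y; rewrite lee_fin mpow_ge0.
  by move=> s s0; rewrite !I fe.
Qed.

Lemma integral_mpow_scale (Z : T -> R) (kappa s : R) : measurable_fun setT Z -> 0 < kappa -> 0 <= s ->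
  (\int[P]_w (mpow s (kappa * Z w))%:E = (kappa `^ s)%:E * \int[P]_w (mpow s (Z w))%:E)%E.
Proof.
move=> mZ k0 s0; under eq_integral do rewrite mpow_scale//.
rewrite ge0_integral_mulc ?powR_ge0//; first by apply: measurableT_comp => //; exact: measurable_mpow.
by move=> w; exact: mpow_ge0.
Qed.

Section first_product.
Variable B : nat -> {RV P >-> R}.
Hypothesis indB : mutually_independent B.
Hypothesis betaB : forall n, is_beta (B n) (par a a n) alpha.

(** Chosen so that its power [a] cancels the constant in [shift_const]. *)
Definition first_constant := a `^ (alpha / a) * Gamma (m / a).

Lemma first_constant_gt0 : 0 < first_constant.
Proof. by rewrite mulr_gt0 ?powR_gt0//; apply: Gamma_gt0; rewrite divr_gt0// addr_gt0. Qed.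

(** Here [c = a], so the recursion with step [c] is the wanted one. *)
Lemma first_product_law (Z : {RV P >-> R}) : (forall w, 0 <= Z w) ->
  {ae P, forall w, rprod B a a alpha N w @[N --> \oo] --> Z w} ->
  exists nu : {measure set mT -> \bar R}, is_moment_law a alpha nu /\
    forall A : set R, measurable A -> nu A = P ((fun w => first_constant * Z w) @^-1` A).
Proof.
move=> Z0 Zl; have k0 := first_constant_gt0.
have mZ : measurable_fun setT Z by exact: measurable_funP.
apply: moment_law_of.
- by apply: measurable_funM => //; exact: measurable_cst.
- by move=> w; rewrite mulr_ge0// ltW.
move=> s s0; rewrite !integral_mpow_scale ?addr_ge0 ?(ltW a0)//.
rewrite (limit_shift_recursion a0 a0 alpha0 indB betaB Zl s0) !muleA -!EFinM.
congr ((_)%:E * _)%E; rewrite gt0_powRD//.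
have -> : first_constant `^ a = a `^ alpha * Gamma (m / a) `^ a.
  rewrite /first_constant powRM ?powR_ge0//; first by rewrite -powRrM divfK ?gt_eqF.
  by apply/ltW/Gamma_gt0; rewrite divr_gt0// addr_gt0.
have G1 : Gamma (a / a) = 1 by rewrite divff ?gt_eqF// Gamma1.
have ma : 0 < m / a by rewrite divr_gt0// addr_gt0.
rewrite /shift_const G1 powR_div ?Gamma_gt0// powR1 /ratio.
have -> : m + s = s + a + alpha by ring.
rewrite (addrC a s).
have := powR_gt0 alpha a0; have := powR_gt0 a (Gamma_gt0 ma).
set x1 := Gamma (m / a) `^ a; set x2 := Gamma (s + a + alpha); set x3 := Gamma (s + a).
have /gt_eqF/negbT : 0 < x3 by apply: Gamma_gt0; rewrite ltr_wpDl.
move: x1 x2 x3 (first_constant `^ s) (a `^ alpha) => x1 x2 x3 x4 x5 n3 p1 p2.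
by field; rewrite n3 !gt_eqF.
Qed.

End first_product.

Section second_product.
Variable B : nat -> {RV P >-> R}.
Hypothesis indB : mutually_independent B.
Hypothesis betaB : forall n, is_beta (B n) (par 1 a^-1 n) (alpha / a).

Definition second_constant := Gamma m / Gamma a.

Lemma second_constant_gt0 : 0 < second_constant.
Proof. by rewrite divr_gt0//; apply: Gamma_gt0 => //; exact: addr_gt0. Qed.

(** Here [c = 1/a], and step 1 for [Z] is step [a] for its power [1/a]. *)
Lemma second_product_law (Z : {RV P >-> R}) : (forall w, 0 <= Z w) ->
  {ae P, forall w, rprod B 1 a^-1 (alpha / a) N w @[N --> \oo] --> Z w} ->
  exists nu : {measure set mT -> \bar R}, is_moment_law a alpha nu /\
    forall A : set R, measurable A -> nu A = P ((fun w => (second_constant * Z w) `^ a^-1) @^-1` A).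
Proof.
move=> Z0 Zl; have k0 := second_constant_gt0.
have mZ : measurable_fun setT Z by exact: measurable_funP.
have mkZ : measurable_fun setT (fun w => second_constant * Z w).
  by apply: measurable_funM => //; exact: measurable_cst.
have kZ0 w : 0 <= second_constant * Z w by rewrite mulr_ge0// ltW.
apply: moment_law_of.
- exact: measurable_powRT.
- by move=> w; exact: powR_ge0.
have ai : 0 < a^-1 by rewrite invr_gt0.
have q0 : 0 < alpha / a by rewrite divr_gt0.
have mp s w : 0 <= s -> mpow s ((second_constant * Z w) `^ a^-1) = mpow (s / a) (second_constant * Z w).
  move=> s0; have [->|sn] := eqVneq s 0; first by rewrite mul0r !mpow0.
  have s_gt0 : 0 < s by rewrite lt0r sn.
  rewrite !mpowE ?divr_gt0//; have := kZ0 w; rewrite le_eqVlt => /predU1P[<-|z0].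
    by rewrite powR0 ?gt_eqF// !ppow_le0.
  by rewrite !ppowE ?powR_gt0// -powRrM (mulrC a^-1).
move=> s s0; have sa0 : 0 <= s + a by rewrite addr_ge0// ltW.
have r0 : 0 <= s / a by rewrite divr_ge0// ltW.
under eq_integral do rewrite mp//.
under [in RHS]eq_integral do rewrite mp//.
have -> : (s + a) / a = s / a + 1 by rewrite mulrDl divff// gt_eqF.
rewrite !integral_mpow_scale ?addr_ge0//.
rewrite (limit_unit_recursion ltr01 ai q0 indB betaB Zl r0) !muleA -!EFinM.
congr ((_)%:E * _)%E; rewrite gt0_powRD// powRr1 ?(ltW k0)// /second_constant /unit_const /ratio !invrK.
have -> : (1 + alpha / a) * a = m by field; rewrite gt_eqF.
have -> : (1 + alpha / a + s / a) * a = s + a + alpha by field; rewrite gt_eqF.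
have -> : (1 + s / a) * a = s + a by field; rewrite gt_eqF.
rewrite mul1r.
set x1 := Gamma m; set x2 := Gamma a; set x3 := Gamma (s + a + alpha); set x4 := Gamma (s + a).
have /gt_eqF/negbT : 0 < x1 by apply: Gamma_gt0; rewrite addr_gt0.
have /gt_eqF/negbT : 0 < x2 by exact: Gamma_gt0.
have /gt_eqF/negbT : 0 < x4 by apply: Gamma_gt0; rewrite ltr_wpDl.
move: x1 x2 x3 x4 (_ `^ (s / a)) => x1 x2 x3 x4 x5 n1 n2 n3.
by field; apply/and3P.
Qed.

End second_product.
End product_laws.

(** * Independent sequences from binary digits *)

Lemma normr_half (R : realType) (z : R) : `|z / 2| = `|z| / 2.
Proof. by rewrite normrM; congr (_ * _); rewrite ger0_norm ?invr_ge0. Qed.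

Section coin_tossing.
Variable R : realType.
Local Notation mT := (measurableTypeR R).
Local Notation mu := (@lebesgue_measure R).
Local Notation U := (uniform_prob (@ltr01 R)).
Implicit Types (x y t u : R) (n : nat).

Definition unit_ind x : R := \1_`[0, 1[ x.

Lemma measurable_unit_ind : measurable_fun setT unit_ind.
Proof. by apply: measurable_indic; exact: measurable_itv. Qed.

Lemma unit_indE x : unit_ind x = ((0 <= x < 1)%R : bool)%:R.
Proof. by rewrite /unit_ind indicE mem_setE in_itv. Qed.

(** One binary digit splits the half-open unit interval into two copies of itself. *)
Lemma unit_ind_split x (y z : R) :
  (if x < 2^-1 then y else z) * unit_ind x = y * unit_ind (2 * x) + z * unit_ind (2 * x - 1).
Proof.
rewrite !unit_indE; have [xh|xh] := ltP x 2^-1.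
- have -> : (0 <= 2 * x - 1 < 1) = false by apply/negP => /andP[? ?]; lra.
  have -> : (0 <= 2 * x < 1) = (0 <= x < 1) by apply/idP/idP => /andP[? ?]; apply/andP; split; lra.
  by rewrite mulr0 addr0.
- have -> : (0 <= 2 * x < 1) = false by apply/negP => /andP[? ?]; lra.
  have -> : (0 <= 2 * x - 1 < 1) = (0 <= x < 1) by apply/idP/idP => /andP[? ?]; apply/andP; split; lra.
  by rewrite mulr0 add0r.
Qed.

Lemma uniform_integral (h : R -> R) : measurable_fun setT h -> (forall x, 0 <= h x) ->
  (\int[U]_x (h x)%:E = \int[mu]_x (h x * unit_ind x)%:E)%E.
Proof.
move=> mh h0; rewrite integral_uniform//; last by apply: measurable_EFinT.
rewrite subr0 invr1 mul1e -integral_itv_bndo_bndc; last first.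
  by apply/measurable_funTS; exact: measurable_EFinT.
rewrite integral_mkcond; apply: eq_integral => x _.
by rewrite patchE /unit_ind indicE; case: ifP => _; rewrite ?mulr1 ?mulr0.
Qed.

Lemma uniform_split (h0 h1 : R -> R) : measurable_fun setT h0 -> measurable_fun setT h1 ->
  (forall x, 0 <= h0 x) -> (forall x, 0 <= h1 x) ->
  (\int[U]_x (if x < 2^-1 then h0 (2 * x) else h1 (2 * x - 1))%:E =
    (2^-1)%:E * (\int[U]_x (h0 x)%:E + \int[U]_x (h1 x)%:E))%E.
Proof.
move=> m0 m1 p0 p1.
have ui0 x : 0 <= unit_ind x by [].
have mu2 : measurable_fun setT (fun x : R => 2 * x) by exact: measurable_funM.
have mu21 : measurable_fun setT (fun x : R => 2 * x - 1) by exact: measurable_funB.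
have M (h : R -> R) : measurable_fun setT h -> measurable_fun setT (fun x => (h x * unit_ind x)%:E).
  by move=> mh; apply: measurable_EFinT; apply: measurable_funM => //; exact: measurable_unit_ind.
rewrite uniform_integral; last first.
- by move=> x; case: ifP.
- apply: measurable_fun_ifT.
  + exact: measurable_fun_ltr.
  + exact: measurableT_comp m0 mu2.
  + exact: measurableT_comp m1 mu21.
rewrite !uniform_integral//.
transitivity (\int[mu]_x ((h0 (2 * x) * unit_ind (2 * x))%:E +
    (h1 (2 * x - 1) * unit_ind (2 * x - 1))%:E))%E.
  apply: eq_integral => x _; rewrite -EFinD; congr EFin.
  exact: unit_ind_split.
have M0 := measurableT_comp (M _ m0) mu2.
have M1 := measurableT_comp (M _ m1) mu21.
rewrite ge0_integralD//=.
- rewrite muleDr//; last first.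
    by rewrite ge0_adde_def// inE; apply: integral_ge0 => x _; rewrite lee_fin mulr_ge0.
  have G (h : R -> R) : (forall x, 0 <= h x) -> forall x, (0 <= (h x * unit_ind x)%:E)%E.
    by move=> h0' x; rewrite lee_fin mulr_ge0.
  have t0 : 0 < 2 :> R by [].
  have S0 := @ge0_integral_scale R (fun x => (h0 x * unit_ind x)%:E) 2 t0 (M _ m0) (G _ p0).
  have Ms : measurable_fun setT (fun x => (h1 (x - 1) * unit_ind (x - 1))%:E).
    by apply: (measurableT_comp (M _ m1)); exact: measurable_funB.
  have S1 := @ge0_integral_scale R _ 2 t0 Ms (fun x => G _ p1 (x - 1)).
  have S2 := @ge0_integral_shift R _ (- 1) (M _ m1) (G _ p1).
  by congr (_ + _)%E; [exact: S0|rewrite -S2; exact: S1].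
- by move=> x _; rewrite lee_fin mulr_ge0.
- by move=> x _; rewrite lee_fin mulr_ge0.
Qed.

(** The shift of binary digits. *)
Definition double x := if x < 2^-1 then 2 * x else 2 * x - 1.

(** The number with the first, third, fifth, ... binary digits of [x], cut after
    [n] digits. *)
Fixpoint odd_digits n x : R := match n with
  | 0%N => 0
  | k.+1 => if x < 2^-1 then odd_digits k (double (double x)) / 2
            else (1 + odd_digits k (double (double x))) / 2
  end.

Lemma measurable_double : measurable_fun setT double.
Proof.
apply: measurable_fun_ifT; first exact: measurable_fun_ltr.
  exact: measurable_funM.
by apply: measurable_funB => //; exact: measurable_funM.
Qed.

Lemma measurable_odd_digits n : measurable_fun setT (odd_digits n).
Proof.
elim: n => [|n IH] /=; first exact: measurable_cst.
have H : measurable_fun setT (fun x => odd_digits n (double (double x))).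
  apply: (measurableT_comp IH); exact: measurableT_comp measurable_double measurable_double.
apply: measurable_fun_ifT; first exact: measurable_fun_ltr.
  exact: measurable_funM.
by apply: measurable_funM => //; exact: measurable_funD.
Qed.

Lemma odd_digits01 n x : 0 <= odd_digits n x <= 1.
Proof.
elim: n x => [|n IH] x /=; first by rewrite lexx ler01.
by have /andP[h0 h1] := IH (double (double x)); case: ifP => _; apply/andP; split; lra.
Qed.

Lemma odd_digitsS n x : odd_digits n.+1 x =
  if x < 2^-1 then odd_digits n (double (double x)) / 2
  else (1 + odd_digits n (double (double x))) / 2.
Proof. by []. Qed.

Lemma odd_digits_nd x : nondecreasing_seq (odd_digits ^~ x).
Proof.
apply/nondecreasing_seqP => n; elim: n x => [|n IH] x.
  by have /andP[] := odd_digits01 1 x.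
have := IH (double (double x)).
rewrite (odd_digitsS n.+1 x) (odd_digitsS n x).
by move: (odd_digits n _) (odd_digits n.+1 _) => y z h; case: ifP => _; lra.
Qed.

(** The digits of odd rank and, in [psi], those of even rank.  Applied to a uniform
    variable they give two independent uniform variables. *)
Definition phi x : R := limn (odd_digits ^~ x).
Definition psi x : R := phi (double x).

Lemma phi_cvg x : odd_digits n x @[n --> \oo] --> phi x.
Proof.
apply: nondecreasing_is_cvgn; first exact: odd_digits_nd.
by exists 1 => _ [n _ <-]; case/andP: (odd_digits01 n x).
Qed.

Lemma measurable_phi : measurable_fun setT phi.
Proof. by apply: (measurable_fun_cvg measurable_odd_digits) => x _; exact: phi_cvg. Qed.

Lemma measurable_psi : measurable_fun setT psi.
Proof. exact: measurableT_comp measurable_phi measurable_double. Qed.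

Lemma phi01 x : 0 <= phi x <= 1.
Proof.
apply/andP; split.
- apply: limr_ge; first exact: cvgP (@phi_cvg x).
  by apply: nearW => n; case/andP: (odd_digits01 n x).
- apply: limr_le; first exact: cvgP (@phi_cvg x).
  by apply: nearW => n; case/andP: (odd_digits01 n x).
Qed.

(** After one digit of [x] the two families of ranks are exchanged. *)
Lemma phiE x : phi x = if x < 2^-1 then psi (2 * x) / 2 else (1 + psi (2 * x - 1)) / 2.
Proof.
have H : odd_digits n.+1 x @[n --> \oo] --> phi x.
  by rewrite (cvg_shiftS (odd_digits ^~ x)); exact: phi_cvg.
rewrite -(cvg_lim (@Rhausdorff R) H) /psi; apply/cvg_lim => //=.
have [xh|xh] := ltP x 2^-1; rewrite /double ?xh ?ltNge ?xh/=.
- apply: cvgM; last exact: cvg_cst.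
  exact: phi_cvg.
- apply: cvgM; last exact: cvg_cst.
  by apply: cvgD; [exact: cvg_cst|exact: phi_cvg].
Qed.

Lemma psiE x : psi x = if x < 2^-1 then phi (2 * x) else phi (2 * x - 1).
Proof. by rewrite /psi /double; case: ifP. Qed.

(** Self-similarity: each identity of laws below is the vanishing of a bounded defect
    whose value at a point is half of its value at another one. *)
Lemma contraction_zero (X : Type) (F : X -> R) :
  (forall p, `|F p| <= 1) -> (forall p, exists p', `|F p| <= `|F p'| / 2) -> forall p, F p = 0.
Proof.
move=> F1 Fc p.
have H n q : `|F q| <= 2^-1 ^+ n.
  elim: n q => [|n IH] q; first by rewrite expr0.
  have [q' Hq] := Fc q; rewrite exprSr; apply: (le_trans Hq).
  by rewrite ler_pM2r ?invr_gt0// IH.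
have L : 2^-1 ^+ n @[n --> \oo] --> (0 : R).
  by apply: cvg_expr; rewrite ger0_norm ?invr_ge0// invf_lt1// ltr1n.
apply/eqP; rewrite -normr_le0 -(cvg_lim (@Rhausdorff R) L).
apply: limr_ge; first exact: cvgP L.
exact: nearW.
Qed.

(** The probability that a uniform variable between 0 and 1 exceeds [x]. *)
Definition tail x : R := if x < 0 then 1 else if x < 1 then 1 - x else 0.

Lemma tail_split x : tail x = (tail (2 * x) + tail (2 * x - 1)) / 2.
Proof.
rewrite /tail; case: (ltP x 0) => h1; case: (ltP x 1) => h2; case: (ltP (2 * x) 0) => h3;
  case: (ltP (2 * x) 1) => h4; case: (ltP (2 * x - 1) 0) => h5; case: (ltP (2 * x - 1) 1) => h6; lra.
Qed.

Lemma tail01 x : 0 <= tail x <= 1.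
Proof. by rewrite /tail; case: ltP => h1; [|case: ltP => h2]; apply/andP; split; lra. Qed.

Definition gt_ind (b y : R) : R := ((b < y)%R : bool)%:R.

Lemma measurable_gt_ind b : measurable_fun setT (gt_ind b).
Proof.
rewrite (_ : gt_ind b = \1_`]b, +oo[); first by apply: measurable_indic; exact: measurable_itv.
by apply/funext => y; rewrite indicE mem_setE in_itv/= andbT.
Qed.

Lemma gt_ind01 (b y : R) : 0 <= gt_ind b y <= 1.
Proof. by rewrite /gt_ind; case: (b < y); rewrite ?lexx ?ler01. Qed.

Definition umean (h : R -> R) : R := fine (\int[U]_x (h x)%:E)%E.

Lemma uniform_int_le1 (h : R -> R) : measurable_fun setT h -> (forall x, 0 <= h x <= 1) ->
  (0 <= \int[U]_x (h x)%:E <= 1)%E.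
Proof.
move=> mh h01; apply/andP; split.
  by apply: integral_ge0 => x _; rewrite lee_fin; case/andP: (h01 x).
apply: (@le_trans _ _ (\int[U]_x (cst 1%:E x))%E).
  apply: ge0_le_integral => //.
  - by move=> x _; rewrite lee_fin; case/andP: (h01 x).
  - exact: measurable_EFinT.
  - by move=> x _; rewrite lee_fin; case/andP: (h01 x).
by rewrite prob_integral_cst.
Qed.

Lemma umeanE (h : R -> R) : measurable_fun setT h -> (forall x, 0 <= h x <= 1) ->
  (\int[U]_x (h x)%:E)%E = (umean h)%:E.
Proof.
move=> mh h01; have /andP[i0 i1] := uniform_int_le1 mh h01.
by rewrite /umean fineK// ge0_fin_numE// (le_lt_trans i1)// ltry.
Qed.

Lemma umean01 (h : R -> R) : measurable_fun setT h -> (forall x, 0 <= h x <= 1) ->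
  0 <= umean h <= 1.
Proof. by move=> mh h01; rewrite -!lee_fin -umeanE//; exact: uniform_int_le1. Qed.

Lemma umean_split (h h0 h1 : R -> R) : measurable_fun setT h -> measurable_fun setT h0 ->
  measurable_fun setT h1 -> (forall x, 0 <= h x <= 1) -> (forall x, 0 <= h0 x <= 1) ->
  (forall x, 0 <= h1 x <= 1) ->
  (forall x, h x = if x < 2^-1 then h0 (2 * x) else h1 (2 * x - 1)) ->
  umean h = (umean h0 + umean h1) / 2.
Proof.
move=> mh m0 m1 p p0 p1 hE; apply: EFin_inj; rewrite -umeanE//.
under eq_integral do rewrite hE.
rewrite uniform_split//; last 2 first.
- by move=> x; case/andP: (p0 x).
- by move=> x; case/andP: (p1 x).
by rewrite !umeanE// -EFinD -EFinM mulrC.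
Qed.

Lemma gt_ind_half (b y : R) : gt_ind b (y / 2) = gt_ind (2 * b) y.
Proof. by rewrite /gt_ind ltr_pdivlMr// mulrC. Qed.

Lemma gt_ind_half1 (b y : R) : gt_ind b ((1 + y) / 2) = gt_ind (2 * b - 1) y.
Proof. by rewrite gt_ind_half /gt_ind ltrBlDl. Qed.

Lemma gt_ind_low (b y : R) : b < 0 -> 0 <= y -> gt_ind b y = 1.
Proof. by move=> b0 y0; rewrite /gt_ind (lt_le_trans b0). Qed.

Lemma gt_ind_high (b y : R) : 1 <= b -> y <= 1 -> gt_ind b y = 0.
Proof. by move=> b1 y1; rewrite /gt_ind ltNge (le_trans y1). Qed.

Lemma umean_cst (c : R) : 0 <= c <= 1 -> umean (cst c) = c.
Proof.
by move=> c01; rewrite /umean /= prob_integral_cst.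
Qed.

Definition gphi b x := gt_ind b (phi x).
Definition gpsi b x := gt_ind b (psi x).

Lemma measurable_gphi b : measurable_fun setT (gphi b).
Proof. exact: measurableT_comp (measurable_gt_ind b) measurable_phi. Qed.

Lemma measurable_gpsi b : measurable_fun setT (gpsi b).
Proof. exact: measurableT_comp (measurable_gt_ind b) measurable_psi. Qed.

Lemma gphi01 b x : 0 <= gphi b x <= 1. Proof. exact: gt_ind01. Qed.
Lemma gpsi01 b x : 0 <= gpsi b x <= 1. Proof. exact: gt_ind01. Qed.

Lemma gphi_split b x : gphi b x =
  if x < 2^-1 then gpsi (2 * b) (2 * x) else gpsi (2 * b - 1) (2 * x - 1).
Proof. by rewrite /gphi phiE; case: ifP => _; [rewrite gt_ind_half|rewrite gt_ind_half1]. Qed.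

Lemma gpsi_split b x : gpsi b x = if x < 2^-1 then gphi b (2 * x) else gphi b (2 * x - 1).
Proof. by rewrite /gpsi psiE; case: ifP. Qed.

Lemma umean_gpsi b : umean (gpsi b) = umean (gphi b).
Proof.
rewrite (umean_split (measurable_gpsi b) (measurable_gphi b) (measurable_gphi b)
  (gpsi01 b) (gphi01 b) (gphi01 b) (gpsi_split b)).
by field.
Qed.

Lemma umean_gphi_rec b : umean (gphi b) = (umean (gphi (2 * b)) + umean (gphi (2 * b - 1))) / 2.
Proof.
by rewrite (umean_split (measurable_gphi b) (measurable_gpsi (2 * b)) (measurable_gpsi (2 * b - 1))
  (gphi01 b) (gpsi01 _) (gpsi01 _) (gphi_split b)) !umean_gpsi.
Qed.

Lemma gphi_low b : b < 0 -> gphi b = cst 1.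
Proof. by move=> b0; apply/funext => x; apply: gt_ind_low => //; case/andP: (phi01 x). Qed.
Lemma gphi_high b : 1 <= b -> gphi b = cst 0.
Proof. by move=> b0; apply/funext => x; apply: gt_ind_high => //; case/andP: (phi01 x). Qed.
Lemma gpsi_low b : b < 0 -> gpsi b = cst 1.
Proof. by move=> b0; apply/funext => x; apply: gt_ind_low => //; case/andP: (phi01 (double x)). Qed.
Lemma gpsi_high b : 1 <= b -> gpsi b = cst 0.
Proof. by move=> b0; apply/funext => x; apply: gt_ind_high => //; case/andP: (phi01 (double x)). Qed.

Lemma tail_low b : b < 0 -> tail b = 1.
Proof. by rewrite /tail => ->. Qed.
Lemma tail_high b : 1 <= b -> tail b = 0.
Proof.
move=> b1; rewrite /tail ltNge (le_trans ler01 b1)/=.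
by rewrite ltNge b1.
Qed.

Lemma phi_uniform b : umean (gphi b) = tail b.
Proof.
pose F b := umean (gphi b) - tail b.
have F0 z : z < 0 \/ 1 <= z -> F z = 0.
  case=> hz; rewrite /F.
    by rewrite gphi_low// tail_low// umean_cst ?subrr// ler01 lexx.
  by rewrite gphi_high// tail_high// umean_cst ?subrr// ler01 lexx.
suff : F b = 0 by move/eqP; rewrite subr_eq0 => /eqP.
apply: (@contraction_zero R F) => p.
  have /andP[a1 a2] := umean01 (measurable_gphi p) (gphi01 p).
  by have /andP[a3 a4] := tail01 p; rewrite /F ler_norml; apply/andP; split; lra.
have E : F p = (F (2 * p) + F (2 * p - 1)) / 2.
  by rewrite /F umean_gphi_rec [tail p]tail_split; field.
have [hp|hp] := ltP (2 * p - 1) 0.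
  by exists (2 * p); rewrite E (F0 _ (or_introl hp)) addr0 normr_half.
have hp' : 1 <= 2 * p by lra.
by exists (2 * p - 1); rewrite E (F0 _ (or_intror hp')) add0r normr_half.
Qed.

Definition joint b c x := gphi b x * gpsi c x.

Lemma measurable_joint b c : measurable_fun setT (joint b c).
Proof. by apply: measurable_funM; [exact: measurable_gphi|exact: measurable_gpsi]. Qed.

Lemma joint01 b c x : 0 <= joint b c x <= 1.
Proof.
have /andP[a1 a2] := gphi01 b x; have /andP[a3 a4] := gpsi01 c x.
by rewrite mulr_ge0//= mulr_ile1.
Qed.

(** The arguments are exchanged, as in [phiE]. *)
Lemma joint_split b c x : joint b c x =
  if x < 2^-1 then joint c (2 * b) (2 * x) else joint c (2 * b - 1) (2 * x - 1).
Proof. by rewrite /joint (gphi_split b x) (gpsi_split c x); case: ifP => _; exact: mulrC. Qed.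

Lemma joint_uniform b c : umean (joint b c) = tail b * tail c.
Proof.
pose F p := umean (joint p.1 p.2) - tail p.1 * tail p.2.
have F0 y z : z < 0 \/ 1 <= z -> F (y, z) = 0.
  case=> hz; rewrite /F/= /joint.
    rewrite (gpsi_low hz) (tail_low hz) mulr1 -phi_uniform.
    by under eq_fun do rewrite /= mulr1; rewrite subrr.
  rewrite (gpsi_high hz) (tail_high hz) mulr0; under eq_fun do rewrite /= mulr0.
  by rewrite (@umean_cst 0) ?subrr// ler01 lexx.
suff : F (b, c) = 0 by move/eqP; rewrite subr_eq0 => /eqP.
apply: (@contraction_zero _ F) => -[y z].
  have /andP[a1 a2] := umean01 (measurable_joint y z) (joint01 y z).
  have /andP[a3 a4] := tail01 y; have /andP[a5 a6] := tail01 z.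
  have a7 : 0 <= tail y * tail z by rewrite mulr_ge0.
  have a8 : tail y * tail z <= 1 by rewrite mulr_ile1.
  by rewrite /F ler_norml /=; move: (tail y * tail z) a7 a8 => t a7 a8; apply/andP; split; lra.
(* one of the two terms vanishes, since 2 y - 1 < 0 or 2 y >= 1 *)
have E : F (y, z) = (F (z, 2 * y) + F (z, 2 * y - 1)) / 2.
  rewrite /F/= (umean_split (measurable_joint y z) (measurable_joint z (2 * y))
    (measurable_joint z (2 * y - 1)) (joint01 _ _) (joint01 _ _) (joint01 _ _) (joint_split y z)).
  by rewrite [tail y]tail_split; field.
have [hp|hp] := ltP (2 * y - 1) 0.
  by exists (z, 2 * y); rewrite E (F0 z _ (or_introl hp)) addr0 normr_half.
have hp' : 1 <= 2 * y by lra.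
by exists (z, 2 * y - 1); rewrite E (F0 z _ (or_intror hp')) add0r normr_half.
Qed.

Lemma integral_preimage (A : set R) (X : R -> R) : measurable_fun setT X -> measurable A ->
  (\int[U]_x (\1_A (X x))%:E = U (X @^-1` A))%E.
Proof.
move=> mX mA; transitivity (\int[U]_x (\1_(X @^-1` A) x)%:E)%E => //.
rewrite integral_indic ?setIT// -[X in measurable X]setTI; exact: mX.
Qed.

Lemma gt_ind_preimage (b : R) (X : R -> R) : measurable_fun setT X ->
  U (X @^-1` `]b, +oo[) = (\int[U]_x (gt_ind b (X x))%:E)%E.
Proof.
move=> mX; rewrite -(integral_preimage mX (measurable_itv _)).
apply: eq_integral => x _; rewrite indicE /gt_ind; congr ((nat_of_bool _)%:R%:E).
by rewrite mem_setE in_itv/= andbT.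
Qed.

Lemma umean_eq_on_unit (h k : R -> R) : measurable_fun setT h -> measurable_fun setT k ->
  (forall x, 0 <= h x) -> (forall x, 0 <= k x) ->
  (forall x, 0 < x < 1 -> h x = k x) -> umean h = umean k.
Proof.
move=> mh mk h0 k0 hk; rewrite /umean !integral_uniform//; try exact: measurable_EFinT.
congr (fine (_ * _)%E).
have E (g : R -> R) : measurable_fun setT g ->
    (\int[mu]_(x in `[0%R, 1%R]) (g x)%:E = \int[mu]_(x in `]0%R, 1%R[) (g x)%:E)%E.
  by move=> mg; apply: integral_itv_bndoo; apply/measurable_funTS; exact: measurable_EFinT.
rewrite (E _ mh) (E _ mk).
by apply: eq_integral => x; rewrite mem_setE in_itv/= => x01; rewrite hk.
Qed.

Lemma gt_ind_split b x : gt_ind b x =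
  if x < 2^-1 then gt_ind (2 * b) (2 * x) else gt_ind (2 * b - 1) (2 * x - 1).
Proof.
by case: ifP => _; rewrite /gt_ind ?ltrD2r ltr_pM2l.
Qed.

Lemma umean_gt_ind b : umean (gt_ind b) = tail b.
Proof.
pose F b := umean (gt_ind b) - tail b.
have mg := measurable_gt_ind.
have g0 z x : 0 <= gt_ind z x by case/andP: (gt_ind01 z x).
have F0 z : z < 0 \/ 1 <= z -> F z = 0.
  case=> hz; rewrite /F.
    rewrite (@umean_eq_on_unit _ (cst 1))// ?tail_low// ?umean_cst ?subrr// ?ler01 ?lexx//.
    by move=> x /andP[x0 _]; apply: gt_ind_low => //; exact: ltW.
  rewrite (@umean_eq_on_unit _ (cst 0))// ?tail_high// ?umean_cst ?subrr// ?ler01 ?lexx//.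
  by move=> x /andP[_ x1]; rewrite gt_ind_high// ltW.
suff : F b = 0 by move/eqP; rewrite subr_eq0 => /eqP.
apply: (@contraction_zero R F) => p.
  have /andP[a1 a2] := umean01 (mg p) (gt_ind01 p).
  by have /andP[a3 a4] := tail01 p; rewrite /F ler_norml; apply/andP; split; lra.
have E : F p = (F (2 * p) + F (2 * p - 1)) / 2.
  rewrite /F (umean_split (mg p) (mg (2 * p)) (mg (2 * p - 1)) (gt_ind01 _) (gt_ind01 _) (gt_ind01 _)
    (gt_ind_split p)).
  by rewrite [tail p]tail_split; field.
have [hp|hp] := ltP (2 * p - 1) 0.
  by exists (2 * p); rewrite E (F0 _ (or_introl hp)) addr0 normr_half.
have hp' : 1 <= 2 * p by lra.
by exists (2 * p - 1); rewrite E (F0 _ (or_intror hp')) add0r normr_half.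
Qed.

Lemma gt_ind_integrals b : (\int[U]_x (gt_ind b x)%:E = (tail b)%:E)%E.
Proof. by rewrite (umeanE (measurable_gt_ind b) (gt_ind01 b)) umean_gt_ind. Qed.

Lemma uniform_ray b : U `]b, +oo[%classic = (tail b)%:E.
Proof. by rewrite -gt_ind_integrals; exact: (@gt_ind_preimage b id). Qed.

Lemma phi_law (A : set R) : measurable A -> U (phi @^-1` A) = U A.
Proof.
have [nu [nuA _]] := @pushforward_exists _ _ R _ mT U phi measurable_phi.
rewrite -nuA; apply: measure_eq_ray => [|b].
  by rewrite nuA preimage_setT; apply: (@le_lt_trans _ _ 1%E); [exact: probability_le1|exact: ltry].
apply: (etrans (nuA _)); apply: (etrans (gt_ind_preimage b measurable_phi)).
apply: (etrans (umeanE (measurable_gphi b) (gphi01 b))).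
by rewrite phi_uniform; apply/esym/uniform_ray.
Qed.

Lemma psi_law (A : set R) : measurable A -> U (psi @^-1` A) = U A.
Proof.
have [nu [nuA _]] := @pushforward_exists _ _ R _ mT U psi measurable_psi.
rewrite -nuA; apply: measure_eq_ray => [|b].
  by rewrite nuA preimage_setT; apply: (@le_lt_trans _ _ 1%E); [exact: probability_le1|exact: ltry].
apply: (etrans (nuA _)); apply: (etrans (gt_ind_preimage b measurable_psi)).
apply: (etrans (umeanE (measurable_gpsi b) (gpsi01 b))).
by rewrite umean_gpsi phi_uniform; apply/esym/uniform_ray.
Qed.

(** Both sides are finite measures in [A]. *)
Lemma independent_of_rays (X : R -> R) (D : set R) : measurable_fun setT X -> measurable D ->
  (forall b, U (X @^-1` `]b, +oo[ `&` D) = U `]b, +oo[%classic * U D)%E ->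
  forall A : set R, measurable A -> (U (X @^-1` A `&` D) = U A * U D)%E.
Proof.
move=> mX mD H A mA.
have UD : U D \is a fin_num by exact: fin_num_measure.
have [n1 [n1A _]] := @density_measure_exists _ mT R U (fun x => (\1_D x)%:E)
  (measurable_EFinT (measurable_indic mD)) (fun x => ltac:(by rewrite lee_fin)).
have [n2 [n2A _]] := @pushforward_exists _ mT R _ mT n1 X mX.
have [n3 [n3A _]] := @density_measure_exists _ mT R U (fun x => U D)
  (measurable_cst _) (fun x => measure_ge0 U D).
have pA (C : set R) : measurable C -> measurable (X @^-1` C).
  by move=> mC; rewrite -[X in measurable X]setTI; exact: mX.
have E2 (C : set R) : measurable C -> n2 C = U (X @^-1` C `&` D).
  move=> mC; have mXC := pA C mC; apply: (etrans (n2A C)); apply: (etrans (n1A _ mXC)).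
  by apply: (etrans (@integral_indic _ mT R U _ mXC _ mD)); rewrite setIC.
have E3 (C : set R) : measurable C -> n3 C = (U C * U D)%E.
  by move=> mC; apply: (etrans (n3A C mC)); apply: (etrans (@integral_cst _ mT R U C mC _)); rewrite muleC.
rewrite -E2// -E3//; apply: measure_eq_ray => [|b|//].
  by rewrite E2// preimage_setT setTI -ge0_fin_numE// measure_ge0.
by rewrite E2 ?E3 ?H//; exact: measurable_itv.
Qed.

Lemma phi_psi_independent (A C : set R) : measurable A -> measurable C ->
  (U (phi @^-1` A `&` psi @^-1` C) = U A * U C)%E.
Proof.
move=> mA mC.
have mphi := measurable_phi; have mpsi := measurable_psi.
have pre (X : R -> R) (D : set R) : measurable_fun setT X -> measurable D -> measurable (X @^-1` D).
  by move=> mX mD; rewrite -[Y in measurable Y]setTI; exact: mX.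
have mray (b : R) : measurable (`]b, +oo[%classic : set R) by exact: measurable_itv.
rewrite -(psi_law mC); apply: independent_of_rays => //; first exact: pre.
move=> b; rewrite -(phi_law (mray b)) setIC muleC (phi_law (mray b)).
rewrite (psi_law mC) -(phi_law (mray b)).
apply: independent_of_rays => //; first exact: pre.
move=> c; rewrite (phi_law (mray b)) !uniform_ray -EFinM mulrC -joint_uniform.
rewrite -(umeanE (measurable_joint b c) (joint01 b c)) setIC.
have mS : measurable (phi @^-1` `]b, +oo[ `&` psi @^-1` `]c, +oo[).
  by apply: measurableI; apply: pre.
have := @integral_indic _ mT R U _ measurableT _ mS; rewrite setIT => <-.
have memE (X : R -> R) (z x : R) : (x \in X @^-1` `]z, +oo[) = (z < X x).
  apply/idP/idP => [/set_mem|H]; first by rewrite /= in_itv/= andbT.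
  by apply/mem_set; rewrite /= in_itv/= andbT.
apply: eq_integral => x _; rewrite indicE in_setI !memE.
by rewrite /joint /gphi /gpsi /gt_ind -natrM mulnb.
Qed.

Section quantile.
Variable nu : {measure set mT -> \bar R}.
Hypotheses (nu1 : (nu setT = 1)%E) (nuI0 : nu `]-oo, 0%R]%classic = 0%E)
  (nuI1 : nu `]-oo, 1%R]%classic = 1%E).

Definition dist x : R := fine (nu `]-oo, x]%classic).

Lemma measurable_left x : measurable (`]-oo, x]%classic : set mT).
Proof. exact: measurable_itv. Qed.

Lemma distE x : nu `]-oo, x]%classic = (dist x)%:E.
Proof.
rewrite /dist fineK// ge0_fin_numE ?measure_ge0//.
apply: (@le_lt_trans _ _ (nu setT)); last by rewrite nu1 ltry.
by apply: le_measure; [apply/mem_set; exact: measurable_left|exact/mem_set|].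
Qed.

Lemma dist_nd x y : x <= y -> dist x <= dist y.
Proof.
move=> xy; rewrite -lee_fin -!distE.
apply: le_measure; [apply/mem_set; exact: measurable_left|apply/mem_set; exact: measurable_left|].
by move=> z /=; rewrite !in_itv/= => /le_trans; apply.
Qed.

Lemma dist0 : dist 0 = 0.
Proof. by rewrite /dist nuI0. Qed.
Lemma dist1 : dist 1 = 1.
Proof. by rewrite /dist nuI1. Qed.

Lemma dist_ray x : nu `]x, +oo[%classic = (1 - dist x)%:E.
Proof.
have I0 : `]-oo, x]%classic `&` `]x, +oo[%classic = set0 :> set R.
  apply/seteqP; split => y //= []; rewrite !in_itv/= andbT => h1 h2.
  by move: (lt_le_trans h2 h1); rewrite ltxx.
have mr : measurable (`]x, +oo[%classic : set mT) by exact: measurable_itv.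
have UE : `]-oo, x]%classic `|` `]x, +oo[%classic = setT :> set mT.
  apply/seteqP; split => y //= _; rewrite !in_itv/= andbT.
  by have [h|h] := leP y x; [left|right].
have e1 : nu (`]-oo, x]%classic `|` `]x, +oo[%classic) = 1%E by rewrite UE; exact: nu1.
have : (1%:E = (dist x)%:E + nu `]x, +oo[%classic)%E.
  by rewrite -distE; exact: etrans (esym e1) (@measureU _ _ _ nu _ _ (measurable_left x) mr I0).
case: (nu _) => [r||] //.
by rewrite -EFinD => H; have {}H := EFin_inj H; congr EFin; move: H; lra.
Qed.

Lemma dist01 x : 0 <= dist x <= 1.
Proof.
rewrite -!lee_fin -distE measure_ge0/= -nu1.
by apply: le_measure; [apply/mem_set; exact: measurable_left|exact/mem_set|].
Qed.

(** Right continuity of the distribution function. *)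
Lemma dist_right (x u : R) : dist x < u -> exists2 x', x < x' & dist x' < u.
Proof.
move=> xu.
have mF k : measurable (`]-oo, x + k.+1%:R^-1]%classic : set mT) by exact: measurable_left.
have capE : \bigcap_k `]-oo, x + k.+1%:R^-1]%classic = `]-oo, x]%classic :> set mT.
  apply/seteqP; split => z /=.
    move=> H; rewrite in_itv/=; apply/ler_addgt0Pr => e e0.
    have := H (Num.truncn e^-1) I; rewrite /= in_itv/= => /le_trans; apply.
    by rewrite lerD2l invf_ple ?posrE// ltW// truncnS_gt.
  rewrite in_itv/= => zx k _ /=; rewrite in_itv/= (le_trans zx)// lerDl invr_ge0//.
have H : nu (`]-oo, x + k.+1%:R^-1]%classic) @[k --> \oo] --> nu `]-oo, x]%classic.
  rewrite -capE; apply: (nonincreasing_cvg_mu _ mF).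
  - by rewrite distE ltry.
  - by rewrite capE; exact: measurable_left.
  - move=> n k nk; apply/subsetPset => z /=; rewrite !in_itv/= => /le_trans; apply.
    by rewrite lerD2l lef_pV2 ?posrE// ler_nat ltnS.
move: H; rewrite distE; under eq_fun do rewrite distE.
move=> /fine_cvg/= H.
have [k _ Hk] := (cvgr_lt _ H) _ xu.
exists (x + k.+1%:R^-1); first by rewrite ltrDl invr_gt0.
exact: (Hk k (leqnn k)).
Qed.

(** For [u <= 0] and [u > 1] the values only have to keep the function nondecreasing, which
    gives its measurability. *)
Definition quantile u : R :=
  if u <= 0 then 0 else if u <= 1 then sup [set x | dist x < u] else 1.

Lemma quantile_lower u : 0 < u -> [set x | dist x < u] 0.
Proof. by rewrite /= dist0. Qed.

Lemma quantile_upper u : u <= 1 -> ubound [set x | dist x < u] 1.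
Proof.
move=> u1 x /= xu; rewrite leNgt; apply/negP => /ltW/dist_nd.
by rewrite dist1 leNgt (lt_le_trans xu).
Qed.

Lemma quantile_gt (u x : R) : 0 < u <= 1 -> (x < quantile u) = (dist x < u).
Proof.
move=> /andP[u0 u1]; rewrite /quantile leNgt u0/= u1; apply/idP/idP.
  move=> /sup_gt [|y /= yu xy]; first by exists 0; exact: quantile_lower.
  exact: le_lt_trans (dist_nd (ltW xy)) yu.
move=> /dist_right[y xy yu]; apply: (lt_le_trans xy).
by apply: ub_le_sup => //; exists 1; exact: quantile_upper.
Qed.

Lemma quantile01 u : 0 <= quantile u <= 1.
Proof.
rewrite /quantile; have [u0|u0] := leP u 0; first by rewrite lexx ler01.
have [u1|u1] := leP u 1; last by rewrite lexx ler01.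
apply/andP; split.
  apply: ub_le_sup; last exact: quantile_lower.
  by exists 1; exact: quantile_upper.
apply: ge_sup; last exact: quantile_upper.
by exists 0; exact: quantile_lower.
Qed.

Lemma measurable_quantile : measurable_fun setT quantile.
Proof.
apply: nondecreasing_measurable => // u v uv.
rewrite {1}/quantile; have [u0|u0] := leP u 0; first by case/andP: (quantile01 v).
have [u1|u1] := leP u 1; last first.
  rewrite /quantile [v <= 0]leNgt (lt_le_trans u0 uv)/=.
  by rewrite [v <= 1]leNgt (lt_le_trans u1 uv).
have [v1|v1] := leP v 1; last first.
  rewrite [leRHS]/quantile [v <= 0]leNgt (lt_le_trans u0 uv)/= [v <= 1]leNgt v1/=.
  by have := quantile01 u; rewrite /quantile [u <= 0]leNgt u0/= u1 => /andP[].
rewrite /quantile [v <= 0]leNgt (lt_le_trans u0 uv)/= v1.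
apply: ge_sup; first by exists 0; exact: quantile_lower.
move=> x /= xu; apply: ub_le_sup; first by exists 1; exact: quantile_upper.
exact: lt_le_trans xu uv.
Qed.

Lemma quantile_law (A : set R) : measurable A -> U (quantile @^-1` A) = nu A.
Proof.
have mq := measurable_quantile.
have [n2 [n2A _]] := @pushforward_exists _ mT R _ mT U quantile mq.
rewrite -n2A; apply: measure_eq_ray => [|b].
  by rewrite n2A preimage_setT; apply: (@le_lt_trans _ _ 1%E); [exact: probability_le1|exact: ltry].
apply: (etrans (n2A _)); apply: (etrans (gt_ind_preimage b mq)).
have mgq : measurable_fun setT (fun u => gt_ind b (quantile u)).
  exact: measurableT_comp (measurable_gt_ind b) mq.
apply: (etrans (umeanE mgq (fun u => gt_ind01 _ _))).
rewrite dist_ray; congr EFin.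
have /andP[d0 d1] := dist01 b.
rewrite (@umean_eq_on_unit _ (gt_ind (dist b)))//.
- rewrite umean_gt_ind /tail ltNge d0/=; case: ltP => // d1'.
  by apply/eqP; rewrite eq_sym subr_eq0 eq_le d1'.
- exact: measurable_gt_ind.
- by move=> u /andP[u0 u1]; rewrite /gt_ind quantile_gt// u0 ltW.
Qed.

End quantile.

(** Repeated splitting: [phi x], [phi (psi x)], [phi (psi (psi x))], ... *)
Definition digit_block n x := phi (iter n psi x).

(** The event that the first [n] blocks lie in given sets and the remaining digits in
    [C], in the recursive form that suits [phi_psi_independent]. *)
Fixpoint cylinder n (A : nat -> set R) (C : set R) : set R := match n with
  | 0%N => C
  | k.+1 => phi @^-1` (A 0%N) `&` psi @^-1` (cylinder k (fun i => A i.+1) C)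
  end.

Lemma cylinderP n A C x : cylinder n A C x <->
  (forall i, (i < n)%N -> A i (digit_block i x)) /\ C (iter n psi x).
Proof.
elim: n A x => [|n IH] A x /=; first by split => [|[]].
rewrite IH; split => [[A0 [An Cn]]|[An Cn]].
  split; last by rewrite -iterS iterSr.
  by case=> [|i] // ni; rewrite /digit_block iterSr; apply: An.
split; first exact: (An 0%N).
split; last by rewrite -iterSr iterS.
by move=> i ni; have := An i.+1 ni; rewrite /digit_block iterSr.
Qed.

Lemma preimage_meas (X : R -> R) (D : set R) : measurable_fun setT X -> measurable D ->
  measurable (X @^-1` D).
Proof. by move=> mX mD; rewrite -[Y in measurable Y]setTI; exact: mX. Qed.

Lemma measurable_cylinder n A C : (forall i, measurable (A i)) -> measurable C ->
  measurable (cylinder n A C).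
Proof.
move=> + mC; elim: n A => [|n IH] A mA //=.
apply: measurableI; apply: preimage_meas => //; [exact: measurable_phi|exact: measurable_psi|].
by apply: IH.
Qed.

Lemma cylinder_prob n A C : (forall i, measurable (A i)) -> measurable C ->
  (U (cylinder n A C) = (\prod_(i < n) fine (U (A i)))%:E * U C)%E.
Proof.
move=> + mC; elim: n A => [|n IH] A mA; first by rewrite big_ord0 mul1e.
rewrite /= phi_psi_independent//; last by apply: measurable_cylinder.
rewrite IH// muleA big_ord_recl EFinM fineK ?fin_num_measure//.
exact: mA.
Qed.

Lemma measurable_iter n : measurable_fun setT (iter n psi).
Proof.
elim: n => [|n IH]; first exact: measurable_id.
by apply: (measurableT_comp measurable_psi IH).
Qed.

Lemma measurable_digit_block n : measurable_fun setT (digit_block n).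
Proof. exact: measurableT_comp measurable_phi (measurable_iter n). Qed.

Lemma digit_block_law n (A : set R) : measurable A -> U (digit_block n @^-1` A) = U A.
Proof.
move=> mA; have : U (iter n psi @^-1` (phi @^-1` A)) = U (phi @^-1` A); last by rewrite phi_law.
have : measurable (phi @^-1` A) by apply: preimage_meas => //; exact: measurable_phi.
move: (phi @^-1` A) => C mC; elim: n => [|n IH] //.
have -> : iter n.+1 psi @^-1` C = psi @^-1` (iter n psi @^-1` C).
  by apply/seteqP; split => x /=; rewrite -iterS iterSr.
by rewrite psi_law//; apply: preimage_meas => //; exact: measurable_iter.
Qed.

(** Each block of digits is turned by a quantile function into a variable with the
    prescribed law. *)
Lemma independent_sequence_exists (nu : nat -> {measure set mT -> \bar R}) :
  (forall n, nu n setT = 1%E) -> (forall n, nu n `]-oo, 0%R]%classic = 0%E) ->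
  (forall n, nu n `]-oo, 1%R]%classic = 1%E) ->
  exists B : nat -> {RV U >-> R}, mutually_independent B /\
    forall n (A : set R), measurable A -> distribution U (B n) A = nu n A.
Proof.
move=> n1 nI0 nI1.
pose Q n : R -> R := quantile (nu n).
have mQ n : measurable_fun setT (Q n) by apply: measurable_quantile.
have QL n (A : set R) : measurable A -> U (Q n @^-1` A) = nu n A by apply: quantile_law.
pose Bf n : mT -> R := Q n \o digit_block n.
have mB n : measurable_fun (setT : set mT) (Bf n).
  exact: measurableT_comp (mQ n) (measurable_digit_block n).
exists (fun n => mfun_Sub (mem_set (mB n))); split => [s A us mA|n A mA]; last first.
  rewrite /distribution /pushforward /= -QL//.
  by apply: (digit_block_law n); exact: preimage_meas.
(* the indices in s are completed to an initial segment, with no condition on the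
     added ones *)
pose n := (\max_(i <- s) i).+1.
have ns i : i \in s -> (i < n)%N.
  by move=> si; rewrite ltnS; exact: (@leq_bigmax_seq _ _ xpredT id).
pose A' i := if i \in s then Q i @^-1` (A i) else setT.
have mA' i : measurable (A' i).
  by rewrite /A'; case: ifP => // _; exact: preimage_meas.
transitivity (U (cylinder n A' setT)).
  congr (uniform_prob _ _); apply/seteqP; split => x.
    move=> H; apply/cylinderP; split => // i _; rewrite /A'; case: ifP => // si.
    exact: (H i si).
  move=> /cylinderP[H _] i /= si; have := H i (ns i si).
  by rewrite /A' si.
rewrite cylinder_prob// (_ : U setT = 1%E) ?mule1; last exact: probability_setT.
have E i : U ((Q i \o digit_block i) @^-1` A i) = (fine (U (Q i @^-1` A i)))%:E.
  rewrite fineK; last by apply: fin_num_measure; exact: preimage_meas.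
  by apply: (digit_block_law i); exact: preimage_meas.
transitivity (\prod_(i <- s) (fine (U (Q i @^-1` A i)))%:E)%E; last first.
  by apply: eq_bigr => i _; rewrite -E.
rewrite prodEFin; congr EFin.
rewrite -(big_mkord xpredT (fun i => fine (U (A' i)))).
rewrite (eq_bigr (fun i => if i \in s then fine (U (Q i @^-1` A i)) else 1)); last first.
  move=> i _; rewrite /A'; case: ifP => // _.
  by rewrite (_ : U setT = 1%E)//; exact: probability_setT.
rewrite -big_mkcond -big_filter; apply: perm_big; apply: uniq_perm => //.
  by rewrite filter_uniq// iota_uniq.
by move=> i; rewrite mem_filter mem_index_iota /=; case: (boolP (i \in s)) => //= /ns ->.
Qed.

End coin_tossing.

(** * Independent Beta variables *)

Section beta_sequences.
Variable R : realType.
Local Notation mT := (measurableTypeR R).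
Local Notation mu := (@lebesgue_measure R).

Lemma beta_measure_exists (p q : R) : 0 < p -> 0 < q ->
  exists nu : {measure set mT -> \bar R}, [/\ nu setT = 1%E, nu `]-oo, 0%R]%classic = 0%E,
    nu `]-oo, 1%R]%classic = 1%E &
    forall A : set R, measurable A -> nu A = (\int[mu]_(x in A `&` `]0%R, 1%R[) (beta_density p q x)%:E)%E].
Proof.
move=> p0 q0; have pq0 : 0 < p + q by exact: addr_gt0.
have Gp := Gamma_gt0 p0; have Gq := Gamma_gt0 q0; have Gpq := Gamma_gt0 pq0.
pose K := Gamma (p + q) / (Gamma p * Gamma q).
have K0 : 0 <= K by exact: (ltW (divr_gt0 Gpq (mulr_gt0 Gp Gq))).
pose g x := K * (ppow (q - 1) (1 - x) * ppow (p - 1) x).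
have g0 x : 0 <= g x by apply: mulr_ge0 => //; apply: mulr_ge0; exact: ppow_ge0.
have mg : measurable_fun setT g by rewrite /g; mtac.
have gN x : ~ (0 < x < 1) -> g x = 0.
  move=> /negP; rewrite negb_and -!leNgt => /orP[x0|x1]; rewrite /g.
    by rewrite (@ppow_le0 _ _ x)// !mulr0.
  by rewrite (@ppow_le0 _ _ (1 - x)) ?mul0r ?mulr0// subr_le0.
have gE x : 0 < x < 1 -> g x = beta_density p q x.
  move=> /andP[x0 x1]; rewrite /g !ppowE ?subr_gt0// /beta_density -/K.
  by rewrite -mulrA; congr (_ * _); rewrite mulrC.
have gI : (\int[mu]_x (g x)%:E = 1)%E.
  rewrite /g ge0_integral_mulc//; last by move=> x; apply: mulr_ge0; exact: ppow_ge0.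
    have := bintE q0 p0; rewrite /bint => ->; rewrite -EFinM; congr EFin.
    rewrite /K (addrC q p); move: Gp Gq Gpq => /gt_eqF/negbT + /gt_eqF/negbT + /gt_eqF/negbT.
    set g1 := Gamma p; set g2 := Gamma q; set g3 := Gamma (p + q).
    by move: g1 g2 g3 => g1 g2 g3 *; field; apply/and3P.
  by mtac.
have [nu [nuA _]] := @density_measure_exists _ mT R mu (EFin \o g) (measurable_EFinT mg) g0.
have nuE (A : set R) : measurable A ->
    nu A = (\int[mu]_(x in A `&` `]0%R, 1%R[) (beta_density p q x)%:E)%E.
  move=> mA; rewrite nuA//= integral_mkcondr; apply: eq_integral => x _.
  rewrite patchE; case: ifPn => [/set_mem|/negP xN] /=; first by rewrite in_itv/= => x01; rewrite gE.
  by rewrite gN// => x01; apply: xN; apply/mem_set; rewrite /= in_itv.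
have mI (b : R) : measurable (`]-oo, b]%classic : set mT) by exact: measurable_itv.
exists nu; split => //.
- by rewrite nuA.
- rewrite nuE; last exact: mI.
  rewrite (_ : _ `&` _ = set0) ?integral_set0//; apply/seteqP; split => x //= [].
  by rewrite !in_itv/= => x0 /andP[x1 _]; move: (lt_le_trans x1 x0); rewrite ltxx.
- rewrite nuE; last exact: mI.
  transitivity (nu setT); last by rewrite nuA.
  rewrite nuE//; congr (integral _ _ _); apply/seteqP; split => x /= [_ h]; split => //.
  by move: h; rewrite !in_itv/= => /andP[_ /ltW].
Qed.

Lemma beta_sequence_exists (p : nat -> R) (q : R) : (forall n, 0 < p n) -> 0 < q ->
  exists B : nat -> {RV (uniform_prob (@ltr01 R)) >-> R},
    mutually_independent B /\ forall n, is_beta (B n) (p n) q.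
Proof.
move=> p0 q0.
have /choice[nu H] := fun n => beta_measure_exists (p0 n) q0.
have [B [iB lB]] := @independent_sequence_exists R nu (fun n => let: And4 h _ _ _ := H n in h)
  (fun n => let: And4 _ h _ _ := H n in h) (fun n => let: And4 _ _ h _ := H n in h).
exists B; split => // n A mA; rewrite lB//.
by have [_ _ _] := H n; apply.
Qed.

End beta_sequences.

(** * The equation as a fixed-point problem *)

Section kernel.
Variables (R : realType) (alpha m : R).
Hypothesis alpha0 : 0 < alpha.
Local Notation mT := (measurableTypeR R).
Local Notation mu := (@lebesgue_measure R).
Implicit Types (x v s : R).

(** The equation reads [f x = integral of kernel x v * f v], both sides being divided by
    [x^m]. *)
Definition kernel x v : R := ppow (- m) x / Gamma alpha * ppow (alpha - 1) (x - v).

Lemma kernel_ge0 x v : 0 <= kernel x v.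
Proof. by rewrite mulr_ge0 ?ppow_ge0// divr_ge0 ?ppow_ge0// ltW// Gamma_gt0. Qed.

Lemma measurable_kernel_snd x : measurable_fun setT (kernel x).
Proof. by apply: measurable_funM; [exact: measurable_cst|mtac]. Qed.

Lemma kernel_le0 x v : x <= 0 -> kernel x v = 0.
Proof. by move=> x0; rewrite /kernel ppow_le0// mul0r mul0r. Qed.

(** The Beta integral behind the moment recursion. *)
Lemma kernel_moment s v : 0 < m + s - alpha -> 0 < v ->
  (\int[mu]_x (ppow (- s) x * kernel x v)%:E =
    (Gamma (m + s - alpha) / Gamma (m + s) * ppow (- (m + s - alpha)) v)%:E)%E.
Proof.
move=> p0 v0; have G0 := Gamma_gt0 alpha0.
transitivity (\int[mu]_x ((Gamma alpha)^-1 *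
    (ppow (- (m + s - alpha + alpha)) x * ppow (alpha - 1) (x - v)))%:E)%E.
  apply: eq_integral => x _; congr EFin.
  have -> : - (m + s - alpha + alpha) = - s + - m by ring.
  rewrite (ppowD (- s) (- m)) /kernel.
  by move: (ppow (- s) x) (ppow (- m) x) (Gamma alpha)^-1 (ppow _ _) => *; ring.
rewrite ge0_integral_mulc ?invr_ge0 ?(ltW G0)//; last first.
- by move=> x; rewrite mulr_ge0 ?ppow_ge0.
- by mtac.
rewrite Riesz_tail// -EFinM ppowE// subrK; congr EFin.
have ms : 0 < m + s by rewrite -(subrK alpha (m + s)) addr_gt0.
move: (Gamma_gt0 ms) G0 => /gt_eqF/negbT + /gt_eqF/negbT.
set g1 := Gamma (m + s); set g2 := Gamma alpha; set g3 := Gamma (m + s - alpha).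
by move: g1 g2 g3 (v `^ _) => g1 g2 g3 g4 n1 n2; field; apply/andP.
Qed.

Section expectation.
Context d (T : measurableType d) (P : {sigma_finite_measure set T -> \bar R}).
Variables (V : T -> R) (G : T -> \bar R).
Hypotheses (mV : measurable_fun setT V) (mG : measurable_fun setT G)
  (G0 : forall w, (0 <= G w)%E) (GV : forall w, V w <= 0 -> G w = 0%E).

(** The expectation of the kernel at [V] with weight [G].  The weight is a density in
    one use and, in the other, the indicator of the event where the variable is positive. *)
Definition transform x : \bar R := (\int[P]_w ((kernel x (V w))%:E * G w))%E.

Lemma measurable_kernel_joint :
  measurable_fun setT (fun z : R * T => ((kernel z.1 (V z.2))%:E * G z.2)%E).
Proof.
have mV2 : measurable_fun setT (fun z : R * T => V z.2) by apply: measurableT_comp => //; exact: measurable_snd.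
have mG2 : measurable_fun setT (fun z : R * T => G z.2) by apply: measurableT_comp => //; exact: measurable_snd.
apply: emeasurable_funM => //; apply: measurable_EFinT.
apply: measurable_funM.
  by apply: measurable_funM; [mtac|exact: measurable_cst].
by apply: measurable_ppowT; apply: measurable_funB => //; exact: measurable_fst.
Qed.

Lemma transform_ge0 x : (0 <= transform x)%E.
Proof. by apply: integral_ge0 => w _; rewrite mule_ge0// lee_fin kernel_ge0. Qed.

Lemma transform_le0 x : x <= 0 -> transform x = 0%E.
Proof.
move=> x0; rewrite /transform -[RHS](integral0 P setT); apply: eq_integral => w _.
by rewrite kernel_le0// mul0e.
Qed.

Lemma measurable_transform : measurable_fun setT transform.
Proof.
have := @measurable_fun_fubini_tonelli_F _ _ mT T R P
  (fun z : R * T => ((kernel z.1 (V z.2))%:E * G z.2)%E) measurable_kernel_joint.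
by apply => z; rewrite mule_ge0// lee_fin kernel_ge0.
Qed.

(** Tonelli and [kernel_moment]. *)
Lemma transform_moment s : 0 < m + s - alpha ->
  (\int[mu]_x ((ppow (- s) x)%:E * transform x) =
   (Gamma (m + s - alpha) / Gamma (m + s))%:E *
   \int[P]_w ((ppow (- (m + s - alpha)) (V w))%:E * G w))%E.
Proof.
move=> p0.
have ms : 0 < m + s by rewrite -(subrK alpha (m + s)) addr_gt0.
have C0 : 0 <= Gamma (m + s - alpha) / Gamma (m + s).
  exact: ltW (divr_gt0 (Gamma_gt0 p0) (Gamma_gt0 ms)).
have mk x : measurable_fun setT (fun w => ((kernel x (V w))%:E * G w)%E).
  apply: emeasurable_funM => //; apply: measurable_EFinT.
  exact: measurableT_comp (measurable_kernel_snd x) mV.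
transitivity (\int[mu]_x \int[P]_w ((ppow (- s) x)%:E * ((kernel x (V w))%:E * G w)))%E.
  apply: eq_integral => x _; rewrite /transform ge0_integralZl_EFin ?ppow_ge0//.
  by move=> w _; rewrite mule_ge0// lee_fin kernel_ge0.
rewrite (@tonelli _ _ _ mT T mu P (fun x w => (ppow (- s) x)%:E * ((kernel x (V w))%:E * G w))%E).
- rewrite -ge0_integralZl_EFin//; last 2 first.
  + by move=> w _; rewrite mule_ge0// lee_fin ppow_ge0.
  + by apply: emeasurable_funM => //; apply: measurable_EFinT; exact: measurable_ppowT.
  apply: eq_integral => w _.
  have [Vw|Vw] := leP (V w) 0.
    rewrite GV// !mule0 -[RHS](integral0 mu setT); apply: eq_integral => x _.
    by rewrite !mule0.
  transitivity (\int[mu]_x ((ppow (- s) x * kernel x (V w))%:E * G w))%E.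
    by apply: eq_integral => x _; rewrite muleA EFinM.
  rewrite ge0_integralZr//; last 2 first.
  + by apply: measurable_EFinT; rewrite /kernel; mtac.
  + by move=> x _; rewrite lee_fin mulr_ge0 ?ppow_ge0 ?kernel_ge0.
  by rewrite kernel_moment// muleA EFinM.
- apply: emeasurable_funM; first by apply: measurable_EFinT; mtac.
  exact: measurable_kernel_joint.
- by move=> x w; rewrite !mule_ge0// lee_fin ?ppow_ge0 ?kernel_ge0.
Qed.

End expectation.
End kernel.

Section inverse_law.
Variables (R : realType).
Local Notation mT := (measurableTypeR R).
Local Notation mu := (@lebesgue_measure R).

Lemma measurable_inv : measurable_fun setT (fun x : R => x^-1).
Proof.
rewrite (_ : (fun x => _) = (fun x : R => ppow (-1) x - ppow (-1) (- x))); first by mtac.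
apply/funext => x; have [x0|x0|->] := ltgtP x 0.
- rewrite ppow_le0 ?ltW// ppowE ?oppr_gt0// powR_inv1 ?oppr_ge0 ?ltW//.
  by rewrite invrN sub0r opprK.
- by rewrite ppowE// powR_inv1 ?ltW// ppow_le0 ?subr0// oppr_le0 ltW.
- by rewrite oppr0 !ppow_le0// subrr invr0.
Qed.

Variables (a alpha : R) (H : R -> \bar R).
Hypotheses (a0 : 0 < a) (alpha0 : 0 < alpha).
Hypotheses (mH : measurable_fun setT H) (H0 : forall x, (0 <= H x)%E)
  (HN : forall x, x <= 0 -> H x = 0%E).

(** The law of [1/X] when [X] has density [H]. *)
Lemma inverse_law_exists : (\int[mu]_x H x = 1)%E ->
  (forall s, 0 <= s -> (\int[mu]_x ((ppow (- (s + a)) x)%:E * H x) =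
    (ratio a alpha s)%:E * \int[mu]_x ((ppow (- s) x)%:E * H x))%E) ->
  exists nu : {measure set mT -> \bar R}, [/\ is_moment_law a alpha nu,
    (forall A : set R, measurable A -> nu A = (\int[mu]_(x in (fun x : R => (x^-1)%R) @^-1` A) H x)%E) &
    forall k : R -> R, measurable_fun setT k -> (forall y, 0 <= k y) ->
      (\int[nu]_y (k y)%:E = \int[mu]_x ((k (x^-1)%R)%:E * H x))%E].
Proof.
move=> H1 fe.
have mi := measurable_inv.
have [n1 [n1A n1I]] := @density_measure_exists _ mT R mu H mH H0.
have [nu [nuA nuI]] := @pushforward_exists _ mT R _ mT n1 (fun x => x^-1) mi.
have pre (A : set R) : measurable A -> measurable ((fun x : R => x^-1) @^-1` A).
  by move=> mA; rewrite -[X in measurable X]setTI; exact: mi.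
have I (k : R -> R) : measurable_fun setT k -> (forall y, 0 <= k y) ->
      (\int[nu]_y (k y)%:E = \int[mu]_x ((k x^-1)%:E * H x))%E.
  move=> mk k0; rewrite nuI//; last exact: measurable_EFinT.
  have mki : measurable_fun setT (fun x : R => k x^-1) := measurableT_comp mk mi.
  exact: (n1I (fun x => (k x^-1)%:E) (measurable_EFinT mki) (fun y => k0 _)).
have mom s : 0 <= s -> (\int[nu]_y (mpow s y)%:E = \int[mu]_x ((ppow (- s) x)%:E * H x))%E.
  move=> s0; rewrite I; [|exact: measurable_mpow|exact: mpow_ge0].
  apply: eq_integral => x _; have [x0|x0] := ltP 0 x; last by rewrite HN// !mule0.
  congr ((_)%:E * _)%E; have [->|sn] := eqVneq s 0.
    by rewrite mpow0 oppr0 ppowE// powRr0.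
  have s_gt0 : 0 < s by rewrite lt0r sn.
  by rewrite mpowE// !ppowE ?invr_gt0// -powR_inv1 ?ltW// -powRrM mulN1r.
have AE (A : set R) : measurable A -> nu A = (\int[mu]_(x in (fun x : R => (x^-1)%R) @^-1` A) H x)%E.
  by move=> mA; rewrite nuA n1A//; exact: pre.
exists nu; split => //; split.
- by rewrite AE// preimage_setT.
- have mneg : measurable ([set y : R | y < 0]).
    rewrite (_ : [set y : R | y < 0] = `]-oo, 0[%classic); first exact: measurable_itv.
    by apply/seteqP; split => y /=; rewrite in_itv.
  rewrite AE//; apply: integral0_eq => x /=; rewrite invr_lt0 => x0; exact/HN/ltW.
- move=> s s0; have sa : 0 <= s + a := addr_ge0 s0 (ltW a0).
  by rewrite (mom _ sa) (mom _ s0); exact: fe.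
Qed.

End inverse_law.

(** * Uniqueness, and absence of solutions for small exponents *)

Section density_equation.
Variables (R : realType) (alpha m : R).
Hypothesis alpha0 : 0 < alpha.
Local Notation mT := (measurableTypeR R).
Local Notation mu := (@lebesgue_measure R).
Local Notation a := (m - alpha).
Local Notation K := (kernel alpha m).

(** A solution extended by 0 to the line, where the equation becomes an identity between
    integrals over the whole line. *)
Definition total_solution (g : R -> R) := [/\ measurable_fun setT g, (forall x, 0 <= g x),
  (forall x, x <= 0 -> g x = 0), (\int[mu]_x (g x)%:E = 1)%E &
  forall x, ((g x)%:E = \int[mu]_v ((K x v)%:E * (g v)%:E))%E].

Definition cutoff (f : R -> R) x := if 0 < x then f x else 0.

Lemma measurable_cutoff (f : R -> R) : measurable_fun (`]0, +oo[ : set R) f ->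
  measurable_fun setT (cutoff f).
Proof.
move=> mf; apply: measurable_fun_if => //; first exact: measurable_fun_ltr.
rewrite setTI (_ : _ @^-1` _ = `]0, +oo[%classic)//.
by apply/seteqP; split => x /=; rewrite in_itv/= andbT.
Qed.

Lemma cutoff_ge0 (f : R -> R) : (forall x, 0 < x -> 0 <= f x) -> forall x, 0 <= cutoff f x.
Proof. by move=> f0 x; rewrite /cutoff; case: ifP => // x0; exact: f0. Qed.

Lemma kernel_integral (f : R -> R) x : 0 < x -> measurable_fun (`]0, +oo[ : set R) f ->
    (forall x, 0 < x -> 0 <= f x) ->
  (\int[mu]_v ((K x v)%:E * (cutoff f v)%:E) = (x `^ (- m))%:E * (((Gamma alpha)^-1)%:E *
   \int[mu]_(v in `]0%R, x[) ((x - v) `^ (alpha - 1) * f v)%:E))%E.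
Proof.
move=> x0 mf f0; have mc := measurable_cutoff mf; have c0 := cutoff_ge0 f0.
have G0 := Gamma_gt0 alpha0.
have C0 : 0 <= x `^ (- m) / Gamma alpha by rewrite divr_ge0 ?powR_ge0 ?(ltW G0).
transitivity (\int[mu]_v ((x `^ (- m) / Gamma alpha) * (ppow (alpha - 1) (x - v) * cutoff f v))%:E)%E.
  by apply: eq_integral => v _; rewrite -EFinM /kernel ppowE// mulrA.
rewrite ge0_integral_mulc//; last first.
- by move=> v; rewrite mulr_ge0 ?ppow_ge0.
- by mtac.
rewrite EFinM -muleA; congr (_ * (_ * _))%E.
rewrite [RHS]integral_mkcond; apply: eq_integral => v _.
rewrite patchE mem_setE in_itv/=; have [/andP[v0 vx]|] := boolP (0 < v < x).
  by rewrite /cutoff v0 ppowE// subr_gt0.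
rewrite /cutoff negb_and -!leNgt => /orP[v0|xv]; first by rewrite ltNge v0 mulr0.
by rewrite ppow_le0 ?mul0r// subr_le0.
Qed.

Lemma cutoff_total f : density_solution alpha m f -> total_solution (cutoff f).
Proof.
move=> [mf f0 f1 fE]; split.
- exact: measurable_cutoff.
- exact: cutoff_ge0.
- by move=> x; rewrite /cutoff ltNge => ->.
- rewrite -f1 [RHS]integral_mkcond; apply: eq_integral => x _.
  by rewrite patchE mem_setE in_itv/= andbT /cutoff; case: ifP.
- move=> x; have [x0|x0] := ltP 0 x; last first.
    rewrite {1}/cutoff ltNge x0/= -[LHS](integral0 mu setT); apply: eq_integral => v _.
    by rewrite kernel_le0// mul0e.
  rewrite kernel_integral// -fE// -EFinM mulrA -gt0_powRD// addNr powRr0 mul1r.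
  by rewrite /cutoff x0.
Qed.

Lemma total_density g : total_solution g -> density_solution alpha m g.
Proof.
move=> [mg g0 gN g1 gE].
have cg : cutoff g = g.
  by apply/funext => x; rewrite /cutoff; case: ltP => // /gN ->.
have mgi : measurable_fun (`]0, +oo[ : set R) g by exact: measurable_funTS.
split => //.
- rewrite -g1 integral_mkcond; apply: eq_integral => x _.
  rewrite patchE mem_setE in_itv/= andbT; case: ltP => // x0.
  by rewrite gN.
- move=> x x0; have := gE x; rewrite -{2}cg kernel_integral// => gx.
  by rewrite EFinM gx muleA -EFinM -gt0_powRD// subrr powRr0 mul1e.
Qed.

Lemma total_transform g : total_solution g -> forall x,
  (g x)%:E = transform alpha m mu id (EFin \o g) x.
Proof. by case. Qed.

Lemma total_moment g s : total_solution g -> 0 < m + s - alpha ->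
  (\int[mu]_x ((ppow (- s) x)%:E * (g x)%:E) = (Gamma (m + s - alpha) / Gamma (m + s))%:E *
   \int[mu]_x ((ppow (- (m + s - alpha)) x)%:E * (g x)%:E))%E.
Proof.
move=> tg p0; have [mg g0 gN _ _] := tg.
have := @transform_moment R alpha m alpha0 _ mT mu id (EFin \o g) (@measurable_id _ _ _)
  (measurable_EFinT mg) g0 (fun x x0 => congr1 EFin (gN x x0)) s p0.
by move=> <-; apply: eq_integral => x _; rewrite -total_transform.
Qed.

Lemma total_law g : alpha < m -> total_solution g ->
  exists nu : {measure set mT -> \bar R}, is_moment_law a alpha nu /\
    forall k : R -> R, measurable_fun setT k -> (forall y, 0 <= k y) ->
      (\int[nu]_y (k y)%:E = \int[mu]_x ((k (x^-1)%R)%:E * (g x)%:E))%E.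
Proof.
move=> am tg; have [mg g0 gN g1 _] := tg; have a0 : 0 < a by rewrite subr_gt0.
have fe s : 0 <= s -> (\int[mu]_x ((ppow (- (s + a)) x)%:E * (EFin \o g) x) =
    (ratio a alpha s)%:E * \int[mu]_x ((ppow (- s) x)%:E * (EFin \o g) x))%E.
  move=> s0; have p0 : 0 < m + s - alpha by rewrite addrAC ltr_pwDl.
  rewrite /= (total_moment tg p0) muleA -EFinM /ratio.
  have -> : s + a + alpha = m + s by ring.
  have -> : s + a = m + s - alpha by ring.
  have ms : 0 < m + s by rewrite -(subrK alpha (m + s)) addr_gt0.
  move: (Gamma_gt0 ms) (Gamma_gt0 p0) => /gt_eqF/negbT n1 /gt_eqF/negbT n2.
  by rewrite mulrA divfK// divff// mul1e.
have [nu [nuM _ nuI]] := @inverse_law_exists R a alpha (EFin \o g) a0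
  (measurable_EFinT mg) g0 (fun x x0 => congr1 EFin (gN x x0)) g1 fe.
by exists nu.
Qed.

(** The right-hand side of the equation is an integral against the law of [1/X], which
    is unique. *)
Lemma total_unique g1 g2 : alpha < m -> total_solution g1 -> total_solution g2 -> g1 =1 g2.
Proof.
move=> am t1 t2 x; apply: EFin_inj.
have [nu1 [M1 I1]] := total_law am t1; have [nu2 [M2 I2]] := total_law am t2.
have a0 : 0 < a by rewrite subr_gt0.
have U := moment_law_unique a0 alpha0 M1 M2.
pose k y := kernel alpha m x y^-1.
have mk : measurable_fun setT k.
  exact: measurableT_comp (measurable_kernel_snd alpha m x) (@measurable_inv R).
have k0 y : 0 <= k y by exact: kernel_ge0.
have E (g : R -> R) : total_solution g ->
    (g x)%:E = (\int[mu]_v ((k (v^-1)%R)%:E * (g v)%:E))%E.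
  by case=> _ _ _ _ ->; apply: eq_integral => v _; rewrite /k invrK.
rewrite (E _ t1) (E _ t2) -I1// -I2//.
by apply: (@eq_measure_integral _ mT) => A mA _; exact: U.
Qed.

(** Monotonicity of the Beta integral [bint (p+1) alpha] in [p]. *)
Lemma Gamma_ratio_lower (p : R) : 0 < p -> p <= 1 ->
  Gamma 2 / Gamma (2 + alpha) <= Gamma (p + 1) / Gamma (p + 1 + alpha).
Proof.
move=> p0 p1; have G0 := Gamma_gt0 alpha0.
have p10 : 0 < p + 1 by rewrite addr_gt0.
have : (bint 2 alpha <= bint (p + 1) alpha)%E.
  rewrite /bint; apply: ge0_le_integral => //.
  - by move=> u _; rewrite lee_fin mulr_ge0 ?ppow_ge0.
  - by mtac.
  - by mtac.
  move=> u _; rewrite lee_fin; have [u0|u0] := leP u 0; first by rewrite !(@ppow_le0 _ _ u)// !mulr0.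
  apply: ler_wpM2r; first exact: ppow_ge0.
  have [u1|u1] := ltP u 1; last by rewrite !ppow_le0// subr_le0.
  have u1' : 0 < 1 - u by rewrite subr_gt0.
  rewrite !ppowE//.
  have -> : 2 - 1 = p + (1 - p) :> R by ring.
  rewrite addrK gt0_powRD// ler_piMr ?powR_ge0//.
  apply: (@le_trans _ _ (1 `^ (1 - p))); last by rewrite powR1.
  by rewrite ge0_ler_powR ?nnegrE ?subr_ge0 ?gerBl// ltW.
have t0 : 0 < 2 :> R := ltr0Sn _ 1.
rewrite (bintE t0 alpha0) (bintE p10 alpha0) lee_fin; move: G0.
set x1 := Gamma 2; set x2 := Gamma (2 + alpha); set x3 := Gamma (p + 1).
set x4 := Gamma (p + 1 + alpha); set z := Gamma alpha.
by move: x1 x2 x3 x4 z => x1 x2 x3 x4 z z0; rewrite !(mulrAC _ z) ler_pM2r.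
Qed.

(** The integral is in fact infinite.  Replacing [x^(-m)] by
    [v^(p+alpha-m) x^(-(p+alpha))], which is smaller for [x > v], makes it a convergent
    Beta integral of order [1/p] as [p] tends to 0; [p] is taken small enough for the
    value 2. *)
Lemma kernel_mass_lower v : m <= alpha -> 0 < v -> (2%:E <= \int[mu]_x (K x v)%:E)%E.
Proof.
move=> ma v0; have G0 := Gamma_gt0 alpha0.
have [C C0 HC] : exists2 C, 0 < C &
    forall p, 0 < p -> p <= 1 -> C <= Gamma (p + 1) / Gamma (p + 1 + alpha).
  exists (Gamma 2 / Gamma (2 + alpha)); last exact: Gamma_ratio_lower.
  by apply: divr_gt0; apply: Gamma_gt0 => //; exact: addr_gt0.
pose W := v `^ (alpha - m) * (alpha * C).
have W0 : 0 < W by apply: mulr_gt0; [exact: powR_gt0|exact: mulr_gt0].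
(* [W / p] is a lower bound of the integral, so this [p] makes it at least 2. *)
pose p := Num.min 1 (W / 2).
have p0 : 0 < p by rewrite lt_min ltr01 divr_gt0.
have p1 : p <= 1 by rewrite ge_min lexx.
have pW : 2 <= W / p.
  by rewrite ler_pdivlMr// mulrC -ler_pdivlMr// ge_min lexx orbT.
have pa : 0 < p + alpha by rewrite addr_gt0.
have D0 : 0 <= v `^ (p + alpha - m) / Gamma alpha by rewrite divr_ge0 ?powR_ge0 ?(ltW G0).
apply: (@le_trans _ _ (\int[mu]_x ((v `^ (p + alpha - m) / Gamma alpha) *
    (ppow (- (p + alpha)) x * ppow (alpha - 1) (x - v)))%:E)%E); last first.
  apply: ge0_le_integral => //.
  - by move=> x _; rewrite lee_fin; apply: mulr_ge0 => //; apply: mulr_ge0; exact: ppow_ge0.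
  - by mtac.
  - by rewrite /kernel; mtac.
  move=> x _; rewrite lee_fin /kernel.
  have [xv|vx] := leP x v; first by rewrite !(@ppow_le0 _ (alpha - 1)) ?subr_le0// !mulr0.
  have x0 : 0 < x by exact: lt_trans vx.
  rewrite mulrA; apply: ler_wpM2r; first exact: ppow_ge0.
  rewrite mulrAC; apply: ler_wpM2r; first by rewrite invr_ge0 ltW.
  rewrite !ppowE//.
  have -> : x `^ (- m) = x `^ (p + alpha - m) * x `^ (- (p + alpha)).
    by rewrite -gt0_powRD//; congr (_ `^ _); ring.
  apply: ler_wpM2r; first exact: powR_ge0.
  apply: ge0_ler_powR; rewrite ?nnegrE ?(ltW v0) ?(ltW x0) ?(ltW vx)//.
  by rewrite -addrA addr_ge0 ?(ltW p0)// subr_ge0.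
rewrite ge0_integral_mulc//; last first.
- by move=> x; rewrite mulr_ge0 ?ppow_ge0.
- by mtac.
rewrite Riesz_tail// -EFinM lee_fin.
have -> : v `^ (p + alpha - m) / Gamma alpha * (Gamma p * Gamma alpha / Gamma (p + alpha) * v `^ (- p)) =
    v `^ (alpha - m) * (Gamma p / Gamma (p + alpha)).
  have -> : p + alpha - m = alpha - m + p by ring.
  rewrite gt0_powRD// powRN.
  have /gt_eqF/negbT vp := powR_gt0 p v0.
  move: G0 (Gamma_gt0 pa) => /gt_eqF/negbT + /gt_eqF/negbT.
  set g1 := Gamma alpha; set g2 := Gamma (p + alpha); set g3 := Gamma p.
  by move: g1 g2 g3 vp (v `^ (alpha - m)) => g1 g2 g3; move: (v `^ p) => z; move=> *; field; apply/and3P.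
apply: (le_trans pW); rewrite /W -mulrA; apply: ler_wpM2l; first exact: powR_ge0.
have := HC p p0 p1.
have -> : Gamma (p + 1) / Gamma (p + 1 + alpha) = p / (p + alpha) * (Gamma p / Gamma (p + alpha)).
  rewrite GammaS// addrAC GammaS//.
  move: (Gamma_gt0 pa) (pa) => /gt_eqF/negbT + /gt_eqF/negbT.
  set g1 := Gamma (p + alpha); set g2 := Gamma p; set z := p + alpha.
  by move: g1 g2 z => g1 g2 z *; field; apply/andP.
move: (Gamma p / _) => r Cr.
have r0 : 0 <= r by move: (lt_le_trans C0 Cr); rewrite pmulr_rgt0 ?divr_gt0// => /ltW.
rewrite ler_pdivrMr//; apply: (@le_trans _ _ (alpha * (p / (p + alpha) * r))).
  by rewrite ler_pM2l.
rewrite mulrA (mulrC r); apply: ler_wpM2r => //.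
by rewrite mulrCA ler_piMr ?(ltW p0)// ler_pdivrMr// mul1r lerDr ltW.
Qed.

Lemma no_solution g : m <= alpha -> ~ total_solution g.
Proof.
move=> ma [mg g0 gN g1 gE].
have mK : measurable_fun setT (fun z : R * R => ((K z.1 z.2)%:E * (g z.2)%:E)%E).
  exact: (@measurable_kernel_joint R alpha m _ mT id (EFin \o g) (@measurable_id _ _ _)
    (measurable_EFinT mg)).
have K0 x v : (0 <= (K x v)%:E * (g v)%:E)%E.
  by apply: mule_ge0; rewrite lee_fin; [exact: kernel_ge0|exact: g0].
have E : (\int[mu]_x (g x)%:E = \int[mu]_v \int[mu]_x ((K x v)%:E * (g v)%:E))%E.
  rewrite -(@tonelli _ _ _ mT mT mu mu (fun x v => (K x v)%:E * (g v)%:E)%E mK K0).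
  by apply: eq_integral => x _; exact: gE.
have : (\int[mu]_v (2%:E * (g v)%:E) <= \int[mu]_x (g x)%:E)%E.
  rewrite E; apply: ge0_le_integral => //.
  - by move=> v _; rewrite mule_ge0// lee_fin.
  - by apply: emeasurable_funM; [exact: measurable_cst|exact: measurable_EFinT].
  - have := @measurable_fun_fubini_tonelli_G _ _ mT mT R mu
      (fun z : R * R => ((K z.1 z.2)%:E * (g z.2)%:E)%E) mK.
    by apply => z; exact: K0.
  move=> v _; have [v0|v0] := leP v 0.
    by rewrite gN// mule0; apply: integral_ge0 => x _; rewrite mule0.
  rewrite ge0_integralZr//; last 3 first.
  - by apply: measurable_EFinT; rewrite /kernel; mtac.
  - by move=> x _; rewrite lee_fin; exact: kernel_ge0.
  - by rewrite lee_fin.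
  by apply: lee_wpmul2r; [rewrite lee_fin|exact: kernel_mass_lower].
rewrite ge0_integralZl_EFin//; last 2 first.
- by move=> v _; rewrite lee_fin.
- exact: measurable_EFinT.
by rewrite g1 mule1 lee_fin leNgt ltr1n.
Qed.

End density_equation.

(** * Existence of a solution *)

Section existence.
Variables (R : realType) (alpha m : R).
Hypotheses (alpha0 : 0 < alpha) (am : alpha < m).
Local Notation mT := (measurableTypeR R).
Local Notation mu := (@lebesgue_measure R).
Local Notation a := (m - alpha).
Local Notation K := (kernel alpha m).
Context d (T : measurableType d) (P : probability T R).
Variables (Y : T -> R) (nu0 : {measure set mT -> \bar R}).
Hypotheses (mY : measurable_fun setT Y).
Hypothesis nu0M : is_moment_law a alpha nu0.
Hypothesis nu0Y : forall A : set R, measurable A -> nu0 A = P (Y @^-1` A).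

Let a0 : 0 < a. Proof. by rewrite subr_gt0. Qed.

(** The expectation of [K x (1/Y)]; a density of [1/Y] solving the equation is this
    function.
    The weight [ppow 0] is the indicator of [Y > 0]. *)
Definition candidate : R -> \bar R :=
  transform alpha m P (fun w => (Y w)^-1) (fun w => (ppow 0 (Y w))%:E).

Lemma nu0_integral (k : R -> R) : measurable_fun setT k -> (forall y, 0 <= k y) ->
  (\int[nu0]_y (k y)%:E = \int[P]_w (k (Y w))%:E)%E.
Proof.
move=> mk k0; have [nu [nuA nuI]] := @pushforward_exists _ T R _ mT P Y mY.
rewrite -(nuI (EFin \o k))//; last exact: measurable_EFinT.
by apply: (@eq_measure_integral _ mT) => A mA _; rewrite nuA nu0Y.
Qed.

Lemma mYi : measurable_fun setT (fun w => (Y w)^-1).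
Proof. exact: measurableT_comp (@measurable_inv R) mY. Qed.

Lemma mYp : measurable_fun setT (fun w => (ppow 0 (Y w))%:E).
Proof. by apply: measurable_EFinT; exact: measurable_ppowT. Qed.

Lemma candidate_ge0 x : (0 <= candidate x)%E.
Proof. by apply: transform_ge0 => // w; rewrite lee_fin ppow_ge0. Qed.

Lemma candidate_le0 x : x <= 0 -> candidate x = 0%E.
Proof. exact: transform_le0. Qed.

Lemma measurable_candidate : measurable_fun setT candidate.
Proof.
apply: measurable_transform => //; [exact: mYi|exact: mYp|].
by move=> w; rewrite lee_fin ppow_ge0.
Qed.

Lemma candidate_moment s : 0 <= s ->
  (\int[mu]_x ((ppow (- s) x)%:E * candidate x) = \int[nu0]_y (mpow s y)%:E)%E.
Proof.
move=> s0; have p0 : 0 < m + s - alpha by rewrite addrAC ltr_pwDl.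
rewrite transform_moment//; last first.
- by move=> w; rewrite invr_le0 => y0; rewrite ppow_le0.
- by move=> w; rewrite lee_fin ppow_ge0.
- exact: mYp.
- exact: mYi.
have sa : s + a = m + s - alpha by ring.
have sa0 : 0 < s + a by rewrite sa.
transitivity ((Gamma (m + s - alpha) / Gamma (m + s))%:E * \int[P]_w (mpow (s + a) (Y w))%:E)%E.
  congr (_ * _)%E; apply: eq_integral => w _; rewrite -EFinM mpowE//; congr EFin.
  have [y0|y0] := ltP 0 (Y w); last by rewrite !(@ppow_le0 _ _ (Y w))// mulr0.
  rewrite !ppowE ?invr_gt0// powRr0 mulr1 -sa -powR_inv1 ?ltW// -powRrM.
  by rewrite mulN1r opprK.
rewrite -nu0_integral; [|exact: measurable_mpow|exact: mpow_ge0].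
have [_ _ fe] := nu0M; rewrite fe// muleA -EFinM /ratio.
have -> : s + a + alpha = m + s by ring.
rewrite sa.
have ms : 0 < m + s by rewrite -(subrK alpha (m + s)) addr_gt0.
move: (Gamma_gt0 ms) (Gamma_gt0 p0) => /gt_eqF/negbT n1 /gt_eqF/negbT n2.
by rewrite mulrA divfK// divff// mul1e.
Qed.

(** A variable with density [candidate] has an inverse which obeys the moment recursion. *)
Lemma candidate_law : exists nu : {measure set mT -> \bar R}, [/\ is_moment_law a alpha nu,
    (forall A : set R, measurable A ->
      nu A = (\int[mu]_(x in (fun x : R => (x^-1)%R) @^-1` A) candidate x)%E) &
    forall k : R -> R, measurable_fun setT k -> (forall y, 0 <= k y) ->
      (\int[nu]_y (k y)%:E = \int[mu]_x ((k (x^-1)%R)%:E * candidate x))%E].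
Proof.
apply: (inverse_law_exists a0 measurable_candidate candidate_ge0 candidate_le0).
  have := candidate_moment (lexx 0); under [in X in _ = X -> _]eq_integral do rewrite mpow0.
  have [n1 _ _] := nu0M; rewrite integral_cst// n1 mule1 => <-.
  apply: eq_integral => x _; have [x0|x0] := ltP 0 x; last by rewrite candidate_le0// mule0.
  by rewrite oppr0 ppowE// powRr0 mul1e.
move=> s s0; have sa0 : 0 <= s + a := addr_ge0 s0 (ltW a0).
rewrite (candidate_moment sa0) (candidate_moment s0).
by have [_ _ fe] := nu0M; exact: fe.
Qed.

Lemma candidate_integral (k : R -> R) : measurable_fun setT k -> (forall y, 0 <= k y) ->
  (\int[P]_w (k (Y w))%:E = \int[mu]_x ((k (x^-1)%R)%:E * candidate x))%E.
Proof.
move=> mk k0; have [nu [nuM _ nuI]] := candidate_law.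
rewrite -nuI// -nu0_integral//; apply: (@eq_measure_integral _ mT) => A mA _.
exact: (moment_law_unique a0 alpha0 nu0M nuM).
Qed.

Lemma candidate_law_inv (A : set R) : measurable A ->
  P ((fun w => (Y w)^-1) @^-1` A) = (\int[mu]_(x in A) candidate x)%E.
Proof.
move=> mA; have [nu [nuM nuA _]] := candidate_law.
have mi : measurable ((fun x : R => x^-1) @^-1` A).
  by rewrite -[X in measurable X]setTI; exact: measurable_inv.
have := nuA _ mi; rewrite (moment_law_unique a0 alpha0 nuM nu0M mi) nu0Y//.
move=> ->; congr (integral _ _ _); apply/seteqP; split => x /=; by rewrite invrK.
Qed.

(** The candidate is the density of [1/Y], so its definition is an integral against
    itself. *)
Lemma candidate_fixed x : candidate x = (\int[mu]_v ((K x v)%:E * candidate v))%E.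
Proof.
pose k y := K x y^-1 * ppow 0 y.
have mk : measurable_fun setT k.
  apply: measurable_funM; last exact: measurable_ppow.
  exact: measurableT_comp (measurable_kernel_snd alpha m x) (@measurable_inv R).
have k0 y : 0 <= k y by apply: mulr_ge0; [exact: kernel_ge0|exact: ppow_ge0].
transitivity (\int[P]_w (k (Y w))%:E)%E.
  by apply: eq_integral => w _; rewrite -EFinM.
rewrite (candidate_integral mk k0); apply: eq_integral => v _.
have [v0|v0] := ltP 0 v; last by rewrite candidate_le0// !mule0.
by rewrite /k invrK ppowE ?invr_gt0// powRr0 mulr1.
Qed.

Lemma measurable_iterated k x : measurable_fun setT (fun v : R =>
  ((ppow (k.+1%:R * alpha - 1) (x - v) * ppow (- (m * k%:R)) v)%:E * candidate v)%E).
Proof.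
apply: emeasurable_funM; last exact: measurable_candidate.
by mtac.
Qed.

Lemma weighted_scale (c : R) (f : R -> R) : 0 <= c -> measurable_fun setT f ->
  (forall v, 0 <= f v) ->
  (c%:E * \int[mu]_v ((f v)%:E * candidate v) = \int[mu]_v ((c * f v)%:E * candidate v))%E.
Proof.
move=> c0 mf f0; rewrite -ge0_integralZl_EFin//; last 2 first.
- by move=> v _; rewrite mule_ge0 ?lee_fin ?candidate_ge0.
- by apply: emeasurable_funM; [exact: measurable_EFinT|exact: measurable_candidate].
by apply: eq_integral => v _; rewrite muleA -EFinM.
Qed.

Lemma weighted_le (f g : R -> R) : measurable_fun setT f -> measurable_fun setT g ->
  (forall v, 0 < v -> 0 <= f v <= g v) ->
  (\int[mu]_v ((f v)%:E * candidate v) <= \int[mu]_v ((g v)%:E * candidate v))%E.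
Proof.
move=> mf mg fg; apply: ge0_le_integral => //.
- move=> v _; have [v0|v0] := ltP 0 v; last by rewrite candidate_le0// mule0.
  by have /andP[f0 _] := fg v v0; rewrite mule_ge0 ?lee_fin ?candidate_ge0.
- by apply: emeasurable_funM; [exact: measurable_EFinT|exact: measurable_candidate].
- by apply: emeasurable_funM; [exact: measurable_EFinT|exact: measurable_candidate].
move=> v _; have [v0|v0] := ltP 0 v; last by rewrite candidate_le0// !mule0.
by have /andP[_ le] := fg v v0; apply: lee_wpmul2r; rewrite ?candidate_ge0 ?lee_fin.
Qed.

(** The (k+1)-fold iterate of the kernel.  The powers [v^(-m)] met on the way are
    bounded by [w^(-m)] for [w < v], and the remaining factors compose to the fractional
    integral of order [(k+1) alpha]. *)
Lemma candidate_iterated k : exists2 C, 0 <= C & forall x, 0 < x ->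
  (candidate x <= (C * x `^ (- m))%:E *
    \int[mu]_v ((ppow (k.+1%:R * alpha - 1) (x - v) * ppow (- (m * k%:R)) v)%:E * candidate v))%E.
Proof.
have m0 : 0 < m by exact: lt_trans am.
have G0 := Gamma_gt0 alpha0.
have c0 := candidate_ge0.
elim: k => [|k [C C0 IH]].
  exists (Gamma alpha)^-1 => [|x x0]; first by rewrite invr_ge0 ltW.
  rewrite candidate_fixed -ge0_integralZl_EFin//; last 3 first.
  - by move=> v _; rewrite mule_ge0// lee_fin mulr_ge0 ?ppow_ge0.
  - exact: measurable_iterated.
  - by rewrite mulr_ge0 ?powR_ge0// invr_ge0 ltW.
  apply: ge0_le_integral => //.
  - by move=> v _; rewrite mule_ge0// lee_fin kernel_ge0.
  - apply: emeasurable_funM; last exact: measurable_candidate.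
    by apply: measurable_EFinT; exact: measurable_kernel_snd.
  - apply: emeasurable_funM; first exact: measurable_cst.
    exact: measurable_iterated.
  move=> v _; have [v0|v0] := ltP 0 v; last by rewrite candidate_le0// !mule0.
  rewrite muleA -EFinM; apply: lee_wpmul2r => //; rewrite lee_fin; apply: eq_ler.
  rewrite /kernel ppowE// (ppowE (- (m * 0%:R)))// mulr0 oppr0 powRr0 mulr1 mul1r.
  by rewrite (mulrC (_ `^ _)).
pose b : R := k.+1%:R * alpha.
have b0 : 0 < b by rewrite mulr_gt0.
pose D := C / Gamma alpha * (Gamma b * Gamma alpha / Gamma (b + alpha)).
exists D => [|x x0].
  by apply: mulr_ge0; [exact: (divr_ge0 C0 (ltW G0))|]; apply: divr_ge0;
    [apply: mulr_ge0; apply/ltW; exact: Gamma_gt0|exact/ltW/Gamma_gt0/addr_gt0].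
apply: (le_trans (IH x x0)).
have -> : k.+2%:R * alpha = b + alpha by rewrite /b -[k.+2%:R]natr1; ring.
rewrite -/b.
(* after substituting the fixed-point equation for candidate v: the factors of the
     composition integral over v, with all powers v^-m moved to w *)
pose h v w := ppow (b - 1) (x - v) * ppow (alpha - 1) (v - w) * ppow (- (m * k.+1%:R)) w.
have h0 v w : 0 <= h v w by rewrite mulr_ge0 ?ppow_ge0// mulr_ge0 ?ppow_ge0.
have mh : measurable_fun setT (fun z : R * R => ((h z.1 z.2)%:E * candidate z.2)%E).
  apply: emeasurable_funM; first by apply: measurable_EFinT; rewrite /h; mtac.
  by apply: measurableT_comp; [exact: measurable_candidate|exact: measurable_snd].
have mhs v : measurable_fun setT (fun w => ((h v w)%:E * candidate w)%E).
  apply: emeasurable_funM; last exact: measurable_candidate.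
  by apply: measurable_EFinT; rewrite /h; mtac.
have hc0 v w : (0 <= (h v w)%:E * candidate w)%E by rewrite mule_ge0// lee_fin.
have mbound v : ((ppow (b - 1) (x - v) * ppow (- (m * k%:R)) v)%:E * candidate v <=
    (Gamma alpha)^-1%:E * \int[mu]_w ((h v w)%:E * candidate w))%E.
  rewrite (candidate_fixed v) weighted_scale; last 3 first.
  - by rewrite mulr_ge0 ?ppow_ge0.
  - exact: measurable_kernel_snd.
  - by move=> w; exact: kernel_ge0.
  rewrite weighted_scale; last 3 first.
  - by rewrite invr_ge0 (ltW G0).
  - by rewrite /h; mtac.
  - by move=> w; exact: h0.
  apply: weighted_le => [||w w0]; last (apply/andP; split).
  - by apply: measurable_funM; [exact: measurable_cst|exact: measurable_kernel_snd].
  - by apply: measurable_funM; [exact: measurable_cst|rewrite /h; mtac].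
  - by apply: mulr_ge0; [apply: mulr_ge0; exact: ppow_ge0|exact: kernel_ge0].
  have [vw|vw] := ltP w v; last first.
    by rewrite /kernel /h (@ppow_le0 _ (alpha - 1) (v - w)) ?subr_le0// !(mulr0,mul0r).
  have v0 : 0 < v := lt_trans w0 vw.
  rewrite /kernel /h.
  have E : ppow (- (m * k%:R)) v * ppow (- m) v <= ppow (- (m * k.+1%:R)) w.
    rewrite -ppowD (_ : - (m * k%:R) + - m = - (m * k.+1%:R)); last first.
      by rewrite -natr1; ring.
    rewrite !ppowE// !powRN lef_pV2 ?posrE ?powR_gt0//.
    apply: ge0_ler_powR; rewrite ?nnegrE ?(ltW w0) ?(ltW v0) ?(ltW vw)//.
    by apply: mulr_ge0; [exact: ltW|exact: ler0n].
  have := @ppow_ge0 _ (b - 1) (x - v); have := @ppow_ge0 _ (alpha - 1) (v - w).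
  have : 0 <= (Gamma alpha)^-1 by rewrite invr_ge0 (ltW G0).
  move: E; move: (ppow _ v) (ppow _ v) (ppow _ w) (Gamma alpha)^-1 (ppow _ (v - w)) (ppow _ (x - v)).
  move=> p1 p2 p3 g p4 p5 E g0 p40 p50.
  rewrite (_ : _ * _ = (p5 * p4 * g) * (p2 * p1)); last by ring.
  rewrite (_ : g * _ = (p5 * p4 * g) * p3); last by ring.
  by apply: ler_wpM2l => //; apply: mulr_ge0 => //; apply: mulr_ge0.
have c1 : 0 <= C * x `^ (- m) by apply: mulr_ge0 => //; exact: powR_ge0.
have c2 : 0 <= Gamma b * Gamma alpha / Gamma (b + alpha).
  by apply: divr_ge0; [apply: mulr_ge0|]; apply/ltW/Gamma_gt0 => //; exact: addr_gt0.
have mI : measurable_fun setT (fun v => (\int[mu]_w ((h v w)%:E * candidate w))%E).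
  have := @measurable_fun_fubini_tonelli_F _ _ mT mT R mu
    (fun z : R * R => ((h z.1 z.2)%:E * candidate z.2)%E) mh.
  by apply => z; exact: hc0.
have I0 v : (0 <= \int[mu]_w ((h v w)%:E * candidate w))%E.
  by apply: integral_ge0 => w _; exact: hc0.
have g0 : 0 <= (Gamma alpha)^-1 by rewrite invr_ge0 (ltW G0).
apply: (@le_trans _ _ ((C * x `^ (- m))%:E * ((Gamma alpha)^-1%:E *
    \int[mu]_v \int[mu]_w ((h v w)%:E * candidate w)))%E).
  apply: lee_wpmul2l; first by rewrite lee_fin.
  rewrite [leRHS](_ : _ = \int[mu]_v ((Gamma alpha)^-1%:E *
      \int[mu]_w ((h v w)%:E * candidate w)))%E; last first.
    apply: esym; apply: ge0_integralZl_EFin; [exact: measurableT|by move=> v _; exact: I0|exact: mI|exact: g0].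
  apply: ge0_le_integral => //.
  - by move=> v _; rewrite mule_ge0// lee_fin mulr_ge0 ?ppow_ge0.
  - exact: measurable_iterated.
  - by apply: emeasurable_funM; [exact: measurable_cst|].
rewrite (@tonelli _ _ _ mT mT mu mu (fun v w => (h v w)%:E * candidate w)%E mh hc0).
rewrite muleA -EFinM.
have -> : (\int[mu]_w \int[mu]_v ((h v w)%:E * candidate w) =
    (Gamma b * Gamma alpha / Gamma (b + alpha))%:E * \int[mu]_v
     ((ppow (b + alpha - 1) (x - v) * ppow (- (m * k.+1%:R)) v)%:E * candidate v))%E.
  rewrite weighted_scale//; last 2 first.
  - by mtac.
  - by move=> v; apply: mulr_ge0; exact: ppow_ge0.
  apply: eq_integral => w _.
  rewrite ge0_integralZr//; last 2 first.
  - by apply: measurable_EFinT; rewrite /h; mtac.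
  - by move=> v _; rewrite lee_fin; exact: h0.
  congr (_ * _)%E.
  transitivity (\int[mu]_v (ppow (- (m * k.+1%:R)) w * (ppow (b - 1) (x - v) * ppow (alpha - 1) (v - w)))%:E)%E.
    by apply: eq_integral => v _; rewrite /h mulrC.
  rewrite ge0_integral_mulc ?ppow_ge0//; last 2 first.
  - by mtac.
  - by move=> v; apply: mulr_ge0; exact: ppow_ge0.
  rewrite (convolution_kernel w x b0 alpha0) -EFinM; congr EFin.
  by move: (ppow _ w) (Gamma b * _ / _) (ppow _ (x - w)) => *; ring.
rewrite muleA -EFinM; apply: lee_wpmul2r.
  by apply: integral_ge0 => v _; rewrite mule_ge0// lee_fin mulr_ge0 ?ppow_ge0.
rewrite lee_fin /D; apply: eq_ler.
by move: (Gamma b * _ / _) (Gamma alpha)^-1 (x `^ _) => *; ring.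
Qed.

(** Once the exponent [(k+1) alpha - 1] is non-negative, the bound of
    [candidate_iterated] is a moment of [Y] up to a constant. *)
Lemma candidate_fin x : candidate x \is a fin_num.
Proof.
have [x0|x0] := ltP 0 x; last by rewrite candidate_le0.
have m0 : 0 < m by exact: lt_trans am.
have [k k1] : exists k, 1 <= k.+1%:R * alpha.
  exists (Num.truncn alpha^-1); rewrite -ler_pdivrMr// mul1r.
  by apply: ltW; exact: truncnS_gt.
have [C C0 H] := candidate_iterated k.
have r0 : 0 <= k.+1%:R * alpha - 1 by rewrite subr_ge0.
have mk0 : 0 <= m * k%:R by apply: mulr_ge0; [exact: ltW|exact: ler0n].
rewrite ge0_fin_numE ?candidate_ge0//; apply: (le_lt_trans (H x x0)).
apply: lte_mul_pinfty; [by rewrite lee_fin mulr_ge0 ?powR_ge0|by []|].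
apply: (@le_lt_trans _ _ (\int[mu]_v
    ((x `^ (k.+1%:R * alpha - 1) * ppow (- (m * k%:R)) v)%:E * candidate v))%E).
  apply: weighted_le => [||v v0]; [by mtac|by mtac|].
  rewrite mulr_ge0 ?ppow_ge0//=; apply: ler_wpM2r; first exact: ppow_ge0.
  have [xv|xv] := ltP 0 (x - v); last by rewrite ppow_le0 ?powR_ge0.
  rewrite ppowE//; apply: ge0_ler_powR; rewrite ?nnegrE ?(ltW xv) ?(ltW x0)//.
  by rewrite gerBl ltW.
rewrite -weighted_scale; last 3 first.
- exact: powR_ge0.
- by mtac.
- by move=> v; exact: ppow_ge0.
apply: lte_mul_pinfty; [by rewrite lee_fin powR_ge0|by []|].
rewrite candidate_moment//.
by have := moment_fin a0 nu0M mk0; rewrite fin_numE => /andP[_]; rewrite -ltey.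
Qed.

Lemma solution_exists : total_solution alpha m (fun x => fine (candidate x)).
Proof.
have fc := candidate_fin; have c0 := candidate_ge0.
split.
- apply/measurable_EFinP; rewrite (_ : EFin \o _ = candidate); first exact: measurable_candidate.
  by apply/funext => x /=; rewrite fineK.
- by move=> x; exact: fine_ge0.
- by move=> x x0; rewrite candidate_le0.
- under eq_integral do rewrite fineK//.
  have := candidate_moment (lexx 0); have [n1 _ _] := nu0M.
  under [in X in _ = X -> _]eq_integral do rewrite mpow0.
  rewrite integral_cst// n1 mule1 => <-.
  apply: eq_integral => x _; have [x0|x0] := ltP 0 x; last by rewrite candidate_le0// mule0.
  by rewrite oppr0 ppowE// powRr0 mul1e.
- move=> x; transitivity (candidate x); first exact: (fineK (fc x)).
  transitivity (\int[mu]_v ((K x v)%:E * candidate v))%E; first exact: candidate_fixed.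
  apply: eq_integral => v _; congr (_ * _)%E; exact/esym/(fineK (fc v)).
Qed.

End existence.

(** * The theorem *)

Lemma is_as_infinite_product_rprod d (T : measurableType d) (R : realType) (P : probability T R)
    (B : nat -> {RV P >-> R}) (p0 c q : R) (Z : T -> R) :
  0 < p0 -> 0 < c -> 0 < q -> (forall n, is_beta (B n) (par p0 c n) q) ->
  {ae P, forall w, rprod B p0 c q N w @[N --> \oo] --> Z w} ->
  is_as_infinite_product P (fun n w => gain p0 c q n * B n w) Z.
Proof.
move=> p00 c0 q0 betaB; apply: filterS2 (ae_foralln (fun n => beta_ae (betaB n))) => w Bw.
have E N : rprod B p0 c q N w = \prod_(0 <= n < N) (gain p0 c q n * B n w).
  rewrite big_mkord; apply: eq_bigr => i _; have /andP[b0 _] := Bw i.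
  rewrite /factor ppowE// !powRr1 ?(ltW b0)//.
  by apply: divr_ge0; [apply: addr_ge0|]; rewrite ?(ltW q0)// ltW ?par_gt0.
by under eq_cvg do rewrite E.
Qed.

Lemma measurable_preimage_inv (R : realType) (A : set R) : measurable A ->
  measurable ((fun x : R => x^-1) @^-1` A).
Proof. by move=> mA; rewrite -[X in measurable X]setTI; exact: measurable_inv. Qed.

Lemma eq_law_inv (R : realType) (a alpha : R) d (T : measurableType d) (P : probability T R)
    d' (T' : measurableType d') (P' : probability T' R) (Y : T -> R) (Y' : T' -> R)
    (nu nu' : {measure set (measurableTypeR R) -> \bar R}) : 0 < a -> 0 < alpha ->
  measurable_fun setT Y -> measurable_fun setT Y' ->
  is_moment_law a alpha nu -> (forall A, measurable A -> nu A = P (Y @^-1` A)) ->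
  is_moment_law a alpha nu' -> (forall A, measurable A -> nu' A = P' (Y' @^-1` A)) ->
  eq_law P (fun w => (Y w)^-1) P' (fun w => (Y' w)^-1).
Proof.
move=> a0 al0 mY mY' M E M' E'; split.
- exact: measurableT_comp (@measurable_inv R) mY.
- exact: measurableT_comp (@measurable_inv R) mY'.
- move=> A mA; have mi := measurable_preimage_inv mA.
  have := moment_law_unique a0 al0 M M' mi.
  by rewrite (E _ mi) (E' _ mi).
Qed.

Section infinite_products.
Context d (T : measurableType d) (R : realType) (P : probability T R).
Variables (a alpha : R) (B : nat -> {RV P >-> R}).
Hypotheses (a0 : 0 < a) (alpha0 : 0 < alpha) (indB : mutually_independent B).
Local Notation m := (a + alpha).

Lemma first_product : (forall n, is_beta (B n) (a + a * n%:R) alpha) ->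
  exists Z : {RV P >-> R},
    is_as_infinite_product P (fun n w => (m + a * n%:R) / (a + a * n%:R) * B n w) Z /\
    exists nu : {measure set (measurableTypeR R) -> \bar R}, is_moment_law a alpha nu /\
      forall A : set R, measurable A ->
        nu A = P ((fun w => a `^ (alpha / a) * Gamma (m / a) * Z w) @^-1` A).
Proof.
move=> bB; have [Z [Z0 Zl]] := limit_exists a0 a0 alpha0 indB bB.
exists Z; split; last exact: (first_product_law a0 alpha0 indB bB Z0 Zl).
have := is_as_infinite_product_rprod a0 a0 alpha0 bB Zl.
congr is_as_infinite_product; apply/funext => n; apply/funext => w; rewrite /gain /par.
by congr (_ / _ * _); ring.
Qed.

Lemma second_product : (forall n, is_beta (B n) (1 + n%:R / a) (alpha / a)) ->
  exists Z : {RV P >-> R},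
    is_as_infinite_product P (fun n w => (m + n%:R) / (a + n%:R) * B n w) Z /\
    exists nu : {measure set (measurableTypeR R) -> \bar R}, is_moment_law a alpha nu /\
      forall A : set R, measurable A ->
        nu A = P ((fun w => (Gamma m / Gamma a * Z w) `^ a^-1) @^-1` A).
Proof.
move=> bB'; have bB n : is_beta (B n) (par 1 a^-1 n) (alpha / a).
  by rewrite /par mulrC; exact: bB'.
have ai : 0 < a^-1 by rewrite invr_gt0.
have q0 : 0 < alpha / a by rewrite divr_gt0.
have [Z [Z0 Zl]] := limit_exists ltr01 ai q0 indB bB.
exists Z; split; last exact: (second_product_law a0 alpha0 indB bB Z0 Zl).
have := is_as_infinite_product_rprod ltr01 ai q0 bB Zl.
congr is_as_infinite_product; apply/funext => n; apply/funext => w; congr (_ * _).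
have n0 : 0 <= n%:R :> R by exact: ler0n.
have an0 : a + n%:R != 0 by rewrite gt_eqF// ltr_pwDl.
rewrite /gain /par.
by field; rewrite an0 (gt_eqF a0).
Qed.

End infinite_products.

Theorem mainTheorem1 (R : realType) (alpha m : R) (halpha : 0 < alpha) :
  ((exists f : R -> R, density_solution alpha m f) <-> alpha < m) /\
  (alpha < m ->
   let a := m - alpha in
   exists f : R -> R,
     [/\ density_solution alpha m f,
         (forall g : R -> R, density_solution alpha m g ->
            forall x : R, 0 < x -> g x = f x) &
         exists (d : measure_display) (T : measurableType d)
                (P : probability T R) (X : {RV P >-> R}),
           [/\ has_density_on X `]0, +oo[ f,
               (forall (d' : measure_display) (T' : measurableType d')
                       (P' : probability T' R) (B : nat -> {RV P' >-> R}),
                  mutually_independent B ->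
                  (forall n : nat, is_beta (B n) (a + a * n%:R) (m - a)) ->
                  exists Z : {RV P' >-> R},
                    is_as_infinite_product P'
                      (fun n w => (m + a * n%:R) / (a + a * n%:R) * B n w) Z /\
                    eq_law P X P'
                      (fun w => (a `^ ((m - a) / a) * Gamma (m / a) * Z w)^-1)) &
               (forall (d' : measure_display) (T' : measurableType d')
                       (P' : probability T' R) (B : nat -> {RV P' >-> R}),
                  mutually_independent B ->
                  (forall n : nat, is_beta (B n) (1 + n%:R / a) (m / a - 1)) ->
                  exists Z : {RV P' >-> R},
                    is_as_infinite_product P'
                      (fun n w => (m + n%:R) / (a + n%:R) * B n w) Z /\
                    eq_law P X P'
                      (fun w => (Gamma m / Gamma a * Z w) `^ (- a^-1)))]]).
Proof.
have main : alpha < m -> let a := m - alpha in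
   exists f : R -> R,
     [/\ density_solution alpha m f,
         (forall g : R -> R, density_solution alpha m g ->
            forall x : R, 0 < x -> g x = f x) &
         exists (d : measure_display) (T : measurableType d)
                (P : probability T R) (X : {RV P >-> R}) (Y : T -> R)
                (nu : {measure set (measurableTypeR R) -> \bar R}),
         [/\ has_density_on X `]0, +oo[ f, measurable_fun setT Y,
          is_moment_law a alpha nu, forall A : set R, measurable A -> nu A = P (Y @^-1` A) &
          X = (fun w => (Y w)^-1) :> (T -> R) ]].
  move=> am a; have a0 : 0 < a by rewrite subr_gt0.
  have [B [indB bB]] := beta_sequence_exists (par_gt0 a0 a0) halpha.
  have [Z [_ [nu [nuM nuZ]]]] := first_product a0 halpha indB bB.
  set Y := fun w => _ in nuZ.
  have mY : measurable_fun setT Y.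
    by apply: measurable_funM; [exact: measurable_cst|exact: measurable_funP].
  have sol := solution_exists halpha am mY nuM nuZ.
  set f := fun x => _ in sol.
  exists f; split.
  - exact: (total_density halpha sol).
  - move=> g sg x x0; have := total_unique halpha am (cutoff_total halpha sg) sol x.
    by rewrite /cutoff x0.
  have mX : measurable_fun setT (fun w => (Y w)^-1).
    exact: measurableT_comp (@measurable_inv R) mY.
  exists _, _, (uniform_prob (@ltr01 R)), (mfun_Sub (mem_set mX)), Y, nu; split => //.
  move=> A mA; transitivity (uniform_prob (@ltr01 R) ((fun w => (Y w)^-1) @^-1` A)) => //.
  rewrite (candidate_law_inv halpha am mY nuM nuZ mA) integral_mkcondr.
  apply: eq_integral => x _; rewrite patchE mem_setE in_itv/= andbT /f.
  have [x0|x0] := ltP 0 x; last exact: candidate_le0.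
  exact/esym/(fineK (candidate_fin halpha am mY nuM nuZ x)).
split.
  split=> [[f sf]|am]; last by have [f [sf _ _]] := main am; exists f.
  by rewrite ltNge; apply/negP => ma; exact: (no_solution halpha ma (cutoff_total halpha sf)).
move=> am a; have a0 : 0 < a by rewrite subr_gt0.
have maE : m - a = alpha by rewrite /a; ring.
have mE : m = a + alpha by rewrite /a; ring.
have [f [sf uf [d [T [P [X [Y [nu [Xf mY nuM nuY XE]]]]]]]]] := main am.
exists f; split => //; exists d, T, P, X; split => // d' T' P' B indB.
- rewrite maE => bB.
  have [Z [ZB [nu' [nuM' nuZ]]]] := first_product a0 halpha indB bB.
  exists Z; rewrite mE; split => //; rewrite XE.
  apply: (eq_law_inv a0 halpha mY _ nuM nuY nuM' nuZ).
  by apply: measurable_funM; [exact: measurable_cst|exact: measurable_funP].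
- have -> : m / a - 1 = alpha / a.
    by rewrite {1}mE mulrDl divff ?gt_eqF// addrC addKr.
  move=> bB.
  have [Z [ZB [nu' [nuM' nuZ]]]] := second_product a0 halpha indB bB.
  exists Z; rewrite mE; split => //; rewrite XE.
  have -> : (fun w => (Gamma (a + alpha) / Gamma a * Z w) `^ (- a^-1)) =
      (fun w => ((Gamma (a + alpha) / Gamma a * Z w) `^ a^-1)^-1).
    by apply/funext => w; rewrite powRN.
  apply: (eq_law_inv a0 halpha mY _ nuM nuY nuM' nuZ).
  apply: measurable_powRT.
  by apply: measurable_funM; [exact: measurable_cst|exact: measurable_funP].
Qed.
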